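(* Let $G$ be an infinite locally finite graph on a countable vertex set $\mathbb{V}$ and let $\Gamma$ be a group acting quasi-transitively on $\mathbb{V}$ by automorphisms of $G$. Let $S$ be a totally ordered finite spin space and let $\rho$ be a monotone $\Gamma$-invariant irreducible upwards-downwards specification that satisfies weak spatial mixing with rate $c>0$. Let $f_n^{\pm,v,r}$ be the coupled random dynamics maps associated to $\rho$. If $G$ has sub-exponential growth, i.e. $B(r)=e^{o(r)}$ as $r\to\infty$, then $$\max_{v\in\mathbb{V}}\big\|f_n^{+,v,n}(\boldsymbol{+})_v-f_n^{-,v,n}(\boldsymbol{-})_v\big\|_{TV}\le e^{-n^{1-o(1)}}\qquad\text{as }n\to\infty .$$ Moreover, if there exists $\beta<c\log2$ such that $B(r)\le e^{\beta r/\log r}$ for all large $r$, then there exists $c'>0$ such that $$\max_{v\in\mathbb{V}}\big\|f_n^{+,v,n}(\boldsymbol{+})_v-f_n^{-,v,n}(\boldsymbol{-})_v\big\|_{TV}\le e^{-c'n}\qquad\text{for all large }n .$$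
   Context: **Graph.** $\mathbb{V}_{v,r}:=\{u:\mathrm{dist}(u,v)\le r\}$ with $\mathrm{dist}$ the graph distance; $B(r):=\max_{v}|\mathbb{V}_{v,r}|$. An action is quasi-transitive if it has finitely many orbits. For random variables, $\|X-Y\|_{TV}$ is the total variation distance between their laws, $\|\mu-\nu\|_{TV}=\max_A|\mu(A)-\nu(A)|$. **Specifications.** $S$ is finite, totally ordered, with maximal element $+$ and minimal element $-$. Put $\Omega:=S^{\mathbb{V}}$ with the product partial order, $\boldsymbol{+}$, $\boldsymbol{-}$ the constant maximal/minimal configurations, $\Omega_V^\tau:=\{\omega:\omega_{\mathbb{V}\setminus V}=\tau_{\mathbb{V}\setminus V}\}$, and $\Omega^{\pm}$ the set of configurations agreeing with $\boldsymbol{\pm}$ outside a finite set. $\Gamma$ acts by $(\gamma\omega)_v=\omega_{\gamma^{-1}v}$. An upwards-downwards specification is a family $\rho=\{\rho_V^\tau\}$ indexed by finite $V\subset\mathbb{V}$ and $\tau\in\Omega^+\cup\Omega^-$, $\rho_V^\tau$ a probability measure supported on $\Omega_V^\tau$, such that for finite $U\subset V$: $\rho_V^\tau=\rho_V^{\tau'}$ whenever $\tau_{\mathbb{V}\setminus V}=\tau'_{\mathbb{V}\setminus V}$, and $\rho_V^\tau(\cdot\mid\Omega_U^\tau)=\rho_U^\tau$ whenever $\rho_V^\tau(\Omega_U^\tau)>0$. It is $\Gamma$-invariant if $\rho_{\gamma V}^{\gamma\tau}(\gamma^{-1}\omega\in\cdot)=\rho_V^\tau$ for all $\gamma,V,\tau$;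 monotone if $\rho_V^\tau\le_{\mathrm{st}}\rho_V^{\tau'}$ for all finite $V$ and $\tau\le\tau'$ that are both in $\Omega^+$, or both in $\Omega^-$, or with $\tau\in\Omega^-,\tau'\in\Omega^+$; irreducible if for every finite $V$ and each sign, $\{\omega\in\Omega^\pm:\rho_V^{\boldsymbol{\pm}}(\omega)>0\}$ contains $\boldsymbol{\pm}$ and is connected in the Hamming graph on $\Omega^\pm$ (adjacency: differing at exactly one vertex). It satisfies weak spatial mixing with rate $c>0$ if for some $C$, $\|\rho^{\boldsymbol{+}}_{\mathbb{V}_{v,r}}(\sigma_v\in\cdot)-\rho^{\boldsymbol{-}}_{\mathbb{V}_{v,r}}(\sigma_v\in\cdot)\|_{TV}\le Ce^{-cr}$ for all $v\in\mathbb{V}$, $r\ge0$. **Dynamics.** Fix a probability space $(\mathcal{A},\pi)$ and a measurable $F:(\Omega^+\cup\Omega^-)\times\mathbb{V}\times\mathcal{A}\to S$ with (a) $\pi(F(\omega,v,\cdot)=s)=\rho^\omega_{\{v\}}(\sigma_v=s)$ for all $\omega,v,s$; (b) $F(\omega,v,a)\le F(\omega',v,a)$ whenever $\omega\le\omega'$; (c) $F(\gamma\omega,\gamma v,a)=F(\omega,v,a)$ for $\gamma\in\Gamma$. Fix a probability space $(\mathcal{B},\theta)$ and a measurable $\mathcal{O}:\mathcal{B}^{\mathbb{V}}\times\mathbb{V}^2\to\{0,1\}$ with $\mathcal{O}(\gamma\eta,\gamma u,\gamma v)=\mathcal{O}(\eta,u,v)$ for $\gamma\in\Gamma$, such that,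 when $(\eta_v)$ are i.i.d. from $\theta$, the relation $u\preceq_\eta v\iff\mathcal{O}(\eta,u,v)=1$ is almost surely a linear order on $\mathbb{V}$. (Any such choice is allowed.) Let $A_{v,n}\sim\pi$, $B_{v,n}\sim\theta$ ($v\in\mathbb{V}$, $n\in\mathbb{N}$) be independent, $A_n=(A_{v,n})_v$, $B_n=(B_{v,n})_v$. Let $F_{v,a}(\omega)$ be $\omega$ with the value at $v$ replaced by $F(\omega,v,a)$. For $\nu\in\mathcal{A}^{\mathbb{V}}$ and $\eta\in\mathcal{B}^{\mathbb{V}}$ with $\preceq_\eta$ linear, let $\mathbb{V}_{v,r}=\{v_1,\dots,v_m\}$ with $v_1\preceq_\eta\dots\preceq_\eta v_m$ and put $F_{q(\nu,\eta,v,r)}:=F_{v_1,\nu_{v_1}}\circ\dots\circ F_{v_m,\nu_{v_m}}$. Let $Q^{\pm,v,r}(\omega)$ equal $\omega$ on $\mathbb{V}_{v,r}$ and $\pm$ elsewhere. Define $\tilde f_n^{\pm,v,r}:=F_{q(A_n,B_n,v,r)}\circ Q^{\pm,v,r}$ and $f_n^{\pm,v,r}:=\tilde f_1^{\pm,v,r}\circ\dots\circ\tilde f_n^{\pm,v,r}$. *)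

(* Defs.v *)
From HB Require Import structures.
From mathcomp Require Import all_boot all_order all_algebra finmap.
From mathcomp Require Import all_classical all_reals all_analysis.

Set Implicit Arguments.
Unset Strict Implicit.
Unset Printing Implicit Defensive.

Import Order.TTheory GRing.Theory Num.Theory.
Import numFieldNormedType.Exports.

Local Open Scope classical_set_scope.
Local Open Scope ring_scope.
Local Open Scope ereal_scope.

Section Graph.
Context {V : choiceType}.
Implicit Types (e : rel V) (v : V) (r : nat).

Definition simple_graph e := symmetric e /\ irreflexive e.

Definition locally_finite e := forall v, finite_set [set u | e v u].

(* Graph distance, possibly infinite: [dist_le e u v r] reads dist(u,v) <= r. *)
Definition dist_le e u v r :=
  exists p : seq V, [/\ path e u p, last u p = v & (size p <= r)%N].

(* [fset_set] is only meaningful on finite sets; balls are finite as soon as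
   the graph is locally finite. *)
Definition vball e v r : {fset V} := fset_set [set u | dist_le e u v r].

Definition max_ball (R : realType) e r : \bar R :=
  ereal_sup (range (fun v => (#|` vball e v r|%fset%:R)%:E)).

Definition subexponential_growth (R : realType) e :=
  exists g : R^nat, g =o_\oo (fun r => r%:R : R) /\
    forall r, max_ball R e r = (expR (g r))%:E.

End Graph.

Section GroupAction.
Context {Gamma : groupType} {V : choiceType}.
Implicit Types (act : Gamma -> V -> V) (e : rel V).

Definition group_action act :=
  (forall v, act 1%g v = v) /\
  (forall g h v, act (g * h)%g v = act g (act h v)).

Definition acts_by_automorphisms act e :=
  forall g u v, e (act g u) (act g v) = e u v.

Definition quasi_transitive act :=
  finite_set (range (fun v => range (act^~ v))).

Definition act_fun (T : Type) act (g : Gamma) (x : V -> T) : V -> T :=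
  fun v => x (act g^-1%g v).

End GroupAction.

(* Generators of the product sigma-algebra on [I -> T], for the sigma-algebra
   [G] on [T]. *)
Definition cylinders (I T : Type) (G : set (set T)) : set (set (I -> T)) :=
  \bigcup_i preimage_set_system setT (fun x => x i) G.

Definition config (V : choiceType) (dS : Order.disp_t)
  (S : finTBOrderType dS) := V -> S.

(* Product sigma-algebra on configurations, each copy of the finite set [S]
   carrying the discrete one. *)
Section ConfigMeasurable.
Context (V : choiceType) (dS : Order.disp_t) (S : finTBOrderType dS).

HB.instance Definition _ := Choice.on (config V S).
HB.instance Definition _ := isPointed.Build (config V S) (fun=> \bot%O).

Let G : set (set (config V S)) := cylinders setT.

HB.instance Definition _ := @isMeasurable.Build (sigma_display G) (config V S)
  <<s G >> (@sigma_algebra0 _ setT G) (@sigma_algebraC (config V S) G)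
  (@sigma_algebra_bigcup _ setT G).

End ConfigMeasurable.

(* Total variation distance between the law of [X] under [P] and the law of
   [Y] under [Q], for variables with finitely many values. *)
Definition dTV (R : realType) d1 (T1 : measurableType d1) d2
    (T2 : measurableType d2) (S : finType)
    (P : probability T1 R) (X : T1 -> S) (Q : probability T2 R) (Y : T2 -> S) :
    \bar R :=
  \big[maxe/0]_(A : {set S}) `|P [set t | X t \in A] - Q [set t | Y t \in A]|.

Section Specification.
Context {R : realType} {V : choiceType} {dS : Order.disp_t}
  {S : finTBOrderType dS}.
Implicit Types (s : bool) (v : V) (Lambda : {fset V}) (tau omega : config V S).

Definition conf_le tau omega := forall v, (tau v <= omega v)%O.

(* The constant configurations + ([s = true]) and - ([s = false]). *)
Definition pm s : config V S := fun=> if s then \top%O else \bot%O.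

Definition Omega_sign s : set (config V S) :=
  [set omega | finite_set [set v | omega v <> pm s v]].

Definition Omega_pm : set (config V S) := Omega_sign true `|` Omega_sign false.

Definition agree_off Lambda tau omega :=
  forall v, v \notin Lambda -> omega v = tau v.

Definition Omega_bc Lambda tau : set (config V S) :=
  [set omega | agree_off Lambda tau omega].

(* The values at boundary conditions outside [Omega_pm] are never used. *)
Definition spec := {fset V} -> config V S -> probability (config V S) R.

Implicit Type rho : spec.

Definition updown_specification rho :=
  [/\ forall Lambda tau, Omega_pm tau ->
        rho Lambda tau (Omega_bc Lambda tau) = 1,
      forall Lambda tau tau', Omega_pm tau -> Omega_pm tau' ->
        agree_off Lambda tau tau' ->
        forall E : set (config V S), measurable E ->
          rho Lambda tau E = rho Lambda tau' E
    & forall U Lambda tau, (U `<=` Lambda)%fset -> Omega_pm tau ->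
        0 < rho Lambda tau (Omega_bc U tau) ->
        forall E : set (config V S), measurable E ->
          rho Lambda tau (E `&` Omega_bc U tau) /
            rho Lambda tau (Omega_bc U tau) = rho U tau E].

Definition invariant_spec (Gamma : groupType) (act : Gamma -> V -> V) rho :=
  forall g Lambda tau, Omega_pm tau ->
    forall E : set (config V S), measurable E ->
    rho [fset act g v | v in Lambda]%fset (act_fun act g tau)
      [set omega | E (act_fun act g^-1%g omega)] = rho Lambda tau E.

Definition st_le (mu nu : probability (config V S) R) :=
  forall E : set (config V S), measurable E ->
    (forall tau omega, conf_le tau omega -> E tau -> E omega) -> mu E <= nu E.

Definition monotone_spec rho :=
  forall Lambda tau tau', conf_le tau tau' ->
    [\/ Omega_sign true tau /\ Omega_sign true tau',
        Omega_sign false tau /\ Omega_sign false tau'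
      | Omega_sign false tau /\ Omega_sign true tau'] ->
    st_le (rho Lambda tau) (rho Lambda tau').

Definition hamming_adj : rel (config V S) :=
  fun tau omega => `[< exists! v, tau v <> omega v >].

Definition hamming_connected (D : set (config V S)) :=
  forall tau omega, D tau -> D omega ->
    exists p : seq (config V S), [/\ path hamming_adj tau p, last tau p = omega
      & forall sigma, sigma \in p -> D sigma].

Definition spec_support rho Lambda s : set (config V S) :=
  [set omega | Omega_sign s omega /\ 0 < rho Lambda (pm s) [set omega]].

Definition irreducible_spec rho :=
  forall Lambda s, spec_support rho Lambda s (pm s) /\
    hamming_connected (spec_support rho Lambda s).

Definition weak_spatial_mixing (e : rel V) rho (c : R) :=
  exists C : R, forall v r,
    dTV (rho (vball e v r) (pm true)) (fun sigma => sigma v)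
        (rho (vball e v r) (pm false)) (fun sigma => sigma v)
    <= (C * expR (- (c * r%:R)))%:E.

End Specification.

Arguments spec R V {dS} S.

Section Probability.
Context {R : realType} {d : measure_display} {T : measurableType d}.
Variable P : probability T R.

Definition mutually_independent (I : choiceType) (C : I -> set (set T)) :=
  forall (J : {fset I}) (E : I -> set T), (forall i, i \in J -> C i (E i)) ->
    P (\bigcap_(i in [set` J]) E i) = \prod_(i <- J) P (E i).

Definition has_law d' (T' : measurableType d') (mu : probability T' R)
    (X : T -> T') :=
  measurable_fun setT X /\
  forall E, measurable E -> P (X @^-1` E) = mu E.

Definition events d' (T' : measurableType d') (X : T -> T') : set (set T) :=
  preimage_set_system setT X measurable.

Definition iid (I : choiceType) d' (T' : measurableType d')
    (mu : probability T' R) (X : I -> T -> T') :=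
  (forall i, has_law mu (X i)) /\ mutually_independent (fun i => events (X i)).

Definition driving_noise (V : choiceType)
    dA (TA : measurableType dA) (pi : probability TA R)
    dB (TB : measurableType dB) (theta : probability TB R)
    (A : V -> nat -> T -> TA) (B : V -> nat -> T -> TB) :=
  [/\ forall v n, has_law pi (A v n),
      forall v n, has_law theta (B v n)
    & mutually_independent (fun i : (V * nat) + (V * nat) =>
        match i with
        | inl (v, n) => events (A v n)
        | inr (v, n) => events (B v n)
        end)].

End Probability.

Definition linear_order (V : eqType) (le : rel V) :=
  [/\ reflexive le, antisymmetric le, transitive le & total le].

Section Dynamics.
Context {R : realType} {V : countType} {dS : Order.disp_t}
  {S : finTBOrderType dS} {Gamma : groupType}.
Context {dA : measure_display} {TA : measurableType dA}
  {dB : measure_display} {TB : measurableType dB}.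
Implicit Types (act : Gamma -> V -> V) (e : rel V) (rho : spec R V S)
  (F : config V S -> V -> TA -> S) (O : (V -> TB) -> rel V).

(* The countable [V] and the finite [S] carry the discrete sigma-algebras, so
   joint measurability of [F] is that of the sections at fixed [v], tested on
   the points of [S]. *)
Definition update_rule act rho (pi : probability TA R) F :=
  [/\ forall v s, measurable ((Omega_pm `*` setT) `&`
        [set x : config V S * TA | F x.1 v x.2 = s]),
      forall omega v s, Omega_pm omega ->
        pi [set a | F omega v a = s] =
        rho [fset v]%fset omega [set sigma | sigma v = s],
      forall omega omega' v a, Omega_pm omega -> Omega_pm omega' ->
        conf_le omega omega' -> (F omega v a <= F omega' v a)%O
    & forall g omega v a, Omega_pm omega ->
        F (act_fun act g omega) (act g v) a = F omega v a].

Definition random_order act (theta : probability TB R) O :=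
  [/\ forall u v, <<s cylinders measurable >> [set eta | O eta u v],
      forall g eta u v, O (act_fun act g eta) (act g u) (act g v) = O eta u v
    & forall (d : measure_display) (T : measurableType d) (P : probability T R)
        (eta : V -> T -> TB), iid P theta eta ->
        {ae P, forall t, linear_order (O (fun v => eta v t))}].

Definition update F u (a : TA) (omega : config V S) : config V S :=
  fun w => if w == u then F omega u a else omega w.

(* The vertices of the ball are listed increasingly for [O eta], and the
   largest one is updated first. *)
Definition Fq e F O (nu : V -> TA) (eta : V -> TB) v r
    (omega : config V S) : config V S :=
  foldr (fun u => update F u (nu u)) omega (sort (O eta) (vball e v r)).

Definition Qpm e s v r (omega : config V S) : config V S :=
  fun u => if u \in vball e v r then omega u else pm s u.

Definition ftilde e F O (nu : nat -> V -> TA) (eta : nat -> V -> TB) s v r n :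
    config V S -> config V S :=
  Fq e F O (nu n) (eta n) v r \o Qpm e s v r.

Fixpoint fdyn e F O (nu : nat -> V -> TA) (eta : nat -> V -> TB) s v r n :
    config V S -> config V S :=
  if n is m.+1 then fdyn e F O nu eta s v r m \o ftilde e F O nu eta s v r m.+1
  else id.

Definition fdyn_spin e F O d (T : measurableType d)
    (A : V -> nat -> T -> TA) (B : V -> nat -> T -> TB) s v n (t : T) : S :=
  fdyn e F O (fun k u => A u k t) (fun k u => B u k t) s v n n (pm s) v.

Definition max_dTV e F O d (T : measurableType d) (P : probability T R)
    (A : V -> nat -> T -> TA) (B : V -> nat -> T -> TB) n : \bar R :=
  ereal_sup (range (fun v =>
    dTV P (fdyn_spin e F O A B true v n) P (fdyn_spin e F O A B false v n))).

End Dynamics.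

(* Main.v *)
(* Freeze the update orders: let phi(n) be the supremum, over all vertices v and
   all deterministic sequences of orders, of the probability that the + and the
   - dynamics run for n steps in the ball of radius n around v disagree at v.
   By monotonicity, stationarity of the finite-volume measures and weak spatial
   mixing, phi(T + n) <= B(r) phi(T) phi(n) + K e^{-cr} for r <= T: either an
   older discrepancy survives within distance r of v, or the disagreement at v
   is due to the boundary of the ball of radius r alone.  Irreducibility and
   quasi-transitivity give phi -> 0, after which iterating the recursion along
   T = n = 2^k yields phi(n) <= e^{-n^{1-o(1)}}.  When B(r) <= e^{beta r / log r}
   with beta < c log 2, the iteration gives phi(2^k) <= e^{-2^k k^{-theta}} for
   some theta < 1, which beats every power of B(r).  Splitting according to the
   distance q from v to the older discrepancies then bounds phi(N) by a renewal
   sum of the phi(N - T - 6q) with small total weight, hence exponential decay.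
   The update variables being independent of the orders, a bound uniform in the
   orders holds for random orders as well. *)
Require Import Defs.
From HB Require Import structures.
From mathcomp Require Import all_boot all_order all_algebra finmap.
From mathcomp Require Import all_classical all_reals all_analysis.
From mathcomp Require Import zify ring lra.

Set Implicit Arguments.
Unset Strict Implicit.
Unset Printing Implicit Defensive.

Import Order.TTheory GRing.Theory Num.Theory.
Import numFieldNormedType.Exports.

Local Open Scope classical_set_scope.
Local Open Scope ring_scope.

(* Predicates such as [supported] unfold to products, whose bound variables
   would otherwise be taken as implicit arguments. *)
Unset Implicit Arguments.

(** Sweeps are indexed by age: [dyn] with parameters [k] and [n] runs the sweeps [k + n] down to
    [k + 1], the oldest first. Adding older sweeps or enlarging the volume can then only remove
    discrepancies, and events at disjoint ages are independent. The two-step recursion alone falls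
    short of exponential decay: each use costs a factor [B r] with [r] proportional to the exponent
    reached, so the exponent never quite doubles. In the multiscale recursion the ball sizes are
    paid by coalescence at their own scale. An event at scale [q] forces seven independent failures
    of coalescence over a time [q]. Six of them, in consecutive periods, restore the exponential
    weight of the time [6q] that is skipped; the seventh, simultaneous with the first of these but
    in a disjoint region of space, beats the eight ball sizes that appear. Means over the update
    variables are taken by an abstract functional, [noise_mean], defined on all functions of these
    variables. It is realized by finite sums, and finite tables link it with the given probability
    space at the end. *)

Section Balls.
Context {V : choiceType} {e : rel V}.
Implicit Types (u v w : V) (r : nat).

Lemma dist_le_refl v r : dist_le e v v r.
Proof. by exists [::]. Qed.

Lemma dist_le_mono {u v r r'} : (r <= r')%N -> dist_le e u v r -> dist_le e u v r'.
Proof. by move=> rr' [p [ep pv pr]]; exists p; split=> //; apply: leq_trans rr'. Qed.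

Lemma dist_le_trans {u v w r r'} :
  dist_le e u v r -> dist_le e v w r' -> dist_le e u w (r + r').
Proof.
move=> [p [ep pv pr]] [q [eq qw qr]]; exists (p ++ q); split.
- by rewrite cat_path ep pv eq.
- by rewrite last_cat pv.
- by rewrite size_cat leq_add.
Qed.

Lemma dist_le_sym {u v r} (esym : symmetric e) : dist_le e u v r -> dist_le e v u r.
Proof.
move=> [p [ep pv pr]]; exists (rev (belast u p)); split.
- by rewrite -pv rev_path; apply: sub_path ep => x y; rewrite esym.
- case: p ep pv pr => [|x p] /= _ pv _; first by rewrite pv.
  by rewrite rev_cons last_rcons.
- by rewrite size_rev size_belast.
Qed.

Lemma dist_le_finite v r :
  locally_finite e -> finite_set [set u | dist_le e v u r].
Proof.
move=> fin; elim: r => [|r IHr].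
  apply: (@sub_finite_set _ _ [set v]); last exact: finite_set1.
  by move=> u [p [_ <-]]; rewrite leqn0 size_eq0 => /eqP ->.
apply: (@sub_finite_set _ _
  ([set u | dist_le e v u r] `|` \bigcup_(w in [set u | dist_le e v u r]) [set u | e w u])).
  move=> u [p]; case/lastP: p => [|p x] [ep pu pr].
    by left; rewrite /= in pu; rewrite -pu; apply: dist_le_refl.
  right; exists (last v p); last first.
    by move: ep pu; rewrite rcons_path last_rcons => /andP[_ ?] <-.
  by exists p; move: ep pr; rewrite rcons_path size_rcons => /andP[? _].
rewrite finite_setU; split => //.
by apply: bigcup_finite => // w _; apply: fin.
Qed.

Context (esym : symmetric e) (fin : locally_finite e).

Lemma in_vball {v r u} :
  (u \in vball e v r) <-> dist_le e v u r.
Proof.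
have -> : vball e v r = fset_set [set u | dist_le e v u r].
  by congr fset_set; apply/seteqP; split=> w /=; apply: dist_le_sym.
rewrite in_fset_set; last exact: dist_le_finite fin.
by split; rewrite inE.
Qed.

Lemma vball_sub {u v r r' s} :
  dist_le e v u r -> (r + r' <= s)%N -> (vball e u r' `<=` vball e v s)%fset.
Proof.
move=> vu rs; apply/fsubsetP => w /in_vball uw.
by apply/in_vball; apply: dist_le_mono rs _; apply: dist_le_trans vu uw.
Qed.

Lemma vball_mono {v r s} : (r <= s)%N -> (vball e v r `<=` vball e v s)%fset.
Proof. by apply: (vball_sub (r := 0)); apply: dist_le_refl. Qed.

Lemma vball_center v r : v \in vball e v r.
Proof. by apply/in_vball; apply: dist_le_refl. Qed.

End Balls.

(** * Sweeps of updates in a finite volume and their monotone comparison *)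

Section Comparison.
Context {V : countType} {dS : Order.disp_t} {S : finTBOrderType dS}.
Context {dA : measure_display} {TA : measurableType dA}.
Context {F : config V S -> V -> TA -> S}.
Implicit Types (s : bool) (L : {fset V}) (omega : config V S).
Implicit Types (o : nat -> rel V) (a : nat -> V -> TA).

(** Reversing the order for the sign [false] makes [pm s] the greatest configuration for both signs,
    so that one proof covers the + and the - dynamics. *)
Definition sign_le s (x y : S) := if s then (x <= y)%O else (y <= x)%O.

Definition confs_le s omega omega' := forall v, sign_le s (omega v) (omega' v).

Lemma sign_le_refl s x : sign_le s x x.
Proof. by case: s => /=. Qed.

Lemma sign_le_anti {s x y} : sign_le s x y -> sign_le s y x -> x = y.
Proof. by case: s => /= h1 h2; apply: le_anti; rewrite h1 h2. Qed.

Lemma sign_le_pm s x v : sign_le s x (pm (V := V) s v).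
Proof. by case: s => /=; rewrite /pm /= ?lex1 ?le0x. Qed.

Lemma confs_le_pm s omega : confs_le s omega (pm s).
Proof. by move=> v; apply: sign_le_pm. Qed.

Lemma confs_le_refl s omega : confs_le s omega omega.
Proof. by move=> v; apply: sign_le_refl. Qed.

Definition sweep (l : seq V) (nu : V -> TA) omega :=
  foldr (fun u => update F u (nu u)) omega l.

Definition restrict s L omega : config V S :=
  fun u => if u \in L then omega u else pm s u.

Definition step s L o a k omega :=
  sweep (sort (o k) L) (a k) (restrict s L omega).

(* Sweeps [k + n], ..., [k + 1], the largest index acting first. *)
Fixpoint dyn s L o a k n omega :=
  if n is m.+1 then dyn s L o a k m (step s L o a (k + m.+1) omega) else omega.

Definition supported s L omega := agree_off L (pm s) omega.

Lemma supported_sign {s L omega} : supported s L omega -> Omega_sign s omega.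
Proof.
move=> h; apply: (@sub_finite_set _ _ [set` L]); last exact: finite_fset.
by move=> v /= hv; apply: contrapT => /negP hL; apply: hv; apply: h.
Qed.

Lemma supported_Omega {s L omega} : supported s L omega -> Omega_pm omega.
Proof. by move/supported_sign; case: s => h; [left | right]. Qed.

Lemma supported_sub {s L L' omega} : (L' `<=` L)%fset ->
  supported s L' omega -> supported s L omega.
Proof. by move=> LL' h v vL; apply: h; apply: contra vL; apply: (fsubsetP LL'). Qed.

Lemma supported_restrict s L omega : supported s L (restrict s L omega).
Proof. by move=> v vL; rewrite /restrict (negbTE vL). Qed.

Lemma supported_pm s L : supported s L (pm s).
Proof. by []. Qed.

Lemma restrict_id {s L omega} : supported s L omega -> restrict s L omega = omega.
Proof.
by move=> h; apply/funext => v; rewrite /restrict; case: ifPn => // vL; rewrite h.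
Qed.

Lemma supported_update s L omega u x : u \in L -> supported s L omega ->
  supported s L (update F u x omega).
Proof.
by move=> uL h v vL; rewrite /update; case: eqP => [E|_]; [rewrite E uL in vL | apply: h].
Qed.

Lemma supported_sweep s L l nu omega : {subset l <= L} -> supported s L omega ->
  supported s L (sweep l nu omega).
Proof.
elim: l => //= u l IH sub h; apply: supported_update.
  by apply: sub; rewrite mem_head.
by apply: IH => // w wl; apply: sub; rewrite inE wl orbT.
Qed.

Lemma supported_step s L o a k omega : supported s L (step s L o a k omega).
Proof.
apply: supported_sweep; last exact: supported_restrict.
by move=> u; rewrite mem_sort.
Qed.

Lemma supported_dyn s L o a k n omega :
  supported s L omega -> supported s L (dyn s L o a k n omega).
Proof. by elim: n omega => //= n IH omega h; apply: IH; apply: supported_step. Qed.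

Lemma dynD s L o a k n m omega :
  dyn s L o a k (n + m) omega = dyn s L o a k n (dyn s L o a (k + n) m omega).
Proof.
elim: m omega => [|m IH] omega /=; first by rewrite addn0.
by rewrite addnS /= IH addnS addnS addnA.
Qed.

Lemma sweep_local l nu nu' omega : {in l, nu =1 nu'} ->
  sweep l nu omega = sweep l nu' omega.
Proof.
elim: l => //= u l IH h; rewrite IH; last by move=> w wl; apply: h; rewrite inE wl orbT.
by rewrite h // mem_head.
Qed.

Lemma dyn_local s L o a a' k n omega :
  (forall j u, (k < j <= k + n)%N -> u \in L -> a j u = a' j u) ->
  dyn s L o a k n omega = dyn s L o a' k n omega.
Proof.
elim: n omega => //= n IH omega h; rewrite IH; last first.
  by move=> j u /andP[jk jn] uL; apply: h => //; rewrite jk (leq_trans jn) // addnS.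
congr dyn; apply: sweep_local => u; rewrite mem_sort => uL; apply: h => //.
by rewrite leqnn addnS ltnS leq_addr.
Qed.

(** Every sweep starts by overwriting the values outside [L], so one sweep forgets them; with no
    sweep they would survive, hence [n.+1]. *)
Lemma dyn_agree s L o a k n omega omega' : {in L, omega =1 omega'} ->
  dyn s L o a k n.+1 omega = dyn s L o a k n.+1 omega'.
Proof.
move=> h /=; congr dyn; congr sweep; apply/funext => u.
by rewrite /restrict; case: ifP => // /h.
Qed.

(** A linear order admits only one sorted list, so the sweep of a smaller volume is the sweep of the
    larger one with the updates outside left out. Volumes can thus be compared update by update. *)
Lemma sort_filter {le : rel V} {L L'} : linear_order le -> (L' `<=` L)%fset ->
  sort le L' = [seq u <- sort le L | u \in L'].
Proof.
case=> _ anti trans tot sub; rewrite filter_sort //.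
apply/perm_sortP => //; apply: uniq_perm; rewrite ?filter_uniq ?fset_uniq // => u.
rewrite mem_filter; case uL' : (u \in L') => //=.
by rewrite (fsubsetP sub _ uL').
Qed.

Context (F_mono : forall omega omega' v x, Omega_pm omega -> Omega_pm omega' ->
  conf_le omega omega' -> (F omega v x <= F omega' v x)%O).
Context {o : nat -> rel V} (o_lin : forall k, linear_order (o k)).

Lemma F_sign s omega omega' v x : Omega_pm omega -> Omega_pm omega' ->
  confs_le s omega omega' -> sign_le s (F omega v x) (F omega' v x).
Proof. by case: s => h h' H; apply: F_mono. Qed.

(** An update that is left out happens at a vertex where the smaller volume keeps the extremal value
    [pm s]; the other updates are made in both systems and preserve the comparison. *)
Lemma sweep_shrink s L L' l nu omega omega' :
  (L' `<=` L)%fset -> {subset l <= L} ->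
  supported s L omega -> supported s L' omega' -> confs_le s omega omega' ->
  confs_le s (sweep l nu omega) (sweep [seq u <- l | u \in L'] nu omega').
Proof.
move=> sub; elim: l => //= u l IH lL h h' H.
have lL' : {subset l <= L} by move=> w wl; apply: lL; rewrite inE wl orbT.
have {IH} IH := IH lL' h h' H.
have f_supp : supported s L' (sweep [seq u <- l | u \in L'] nu omega').
  by apply: supported_sweep => // w; rewrite mem_filter => /andP[].
case: ifPn => uL' w /=; rewrite /update; case: eqP => [Ew|_]; try exact: IH.
  apply: F_sign; last exact: IH.
    by apply: (@supported_Omega s L); apply: supported_sweep.
  exact: supported_Omega f_supp.
by rewrite Ew f_supp //; apply: sign_le_pm.
Qed.

Lemma dyn_shrink s L L' a k n omega omega' : (L' `<=` L)%fset ->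
  confs_le s omega omega' ->
  confs_le s (dyn s L o a k n omega) (dyn s L' o a k n omega').
Proof.
move=> sub; elim: n omega omega' => //= n IH omega omega' H; apply: IH.
rewrite /step (sort_filter _ sub) //; apply: (sweep_shrink s L L') => //.
- by move=> u; rewrite mem_sort.
- exact: supported_restrict.
- exact: supported_restrict.
move=> u; rewrite /restrict; case: (boolP (u \in L')) => uL'; last exact: sign_le_pm.
by rewrite (fsubsetP sub _ uL'); apply: H.
Qed.

Lemma dyn_mono s L a k n omega omega' : confs_le s omega omega' ->
  confs_le s (dyn s L o a k n omega) (dyn s L o a k n omega').
Proof. by apply: dyn_shrink. Qed.

Lemma sweep_le L l nu omega omega' : {subset l <= L} ->
  supported false L omega -> supported true L omega' -> conf_le omega omega' ->
  conf_le (sweep l nu omega) (sweep l nu omega').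
Proof.
elim: l => //= u l IH lL h h' H w; rewrite /update.
have lL' : {subset l <= L} by move=> x xl; apply: lL; rewrite inE xl orbT.
case: eqP => [_|_]; last exact: IH.
apply: F_mono; last exact: IH.
- by apply: (@supported_Omega false L); apply: supported_sweep.
- by apply: (@supported_Omega true L); apply: supported_sweep.
Qed.

Lemma dyn_le L a k n omega omega' : conf_le omega omega' ->
  conf_le (dyn false L o a k n omega) (dyn true L o a k n omega').
Proof.
elim: n omega omega' => //= n IH omega omega' H; apply: IH.
apply: (@sweep_le L); rewrite /restrict.
- by move=> u; rewrite mem_sort.
- exact: supported_restrict.
- exact: supported_restrict.
by move=> u; case: ifP => // _; rewrite /pm /= le0x.
Qed.

End Comparison.

Arguments sweep {V dS S dA TA} F.
Arguments step {V dS S dA TA} F.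
Arguments dyn {V dS S dA TA} F.

(** * Finite-volume measures *)

Section RealValued.
Context {R : realType} {d : measure_display} {T : measurableType d}.
Context (mu : probability T R).

Definition pr (A : set T) : R := fine (mu A).

Lemma pr_fin A : measurable A -> (pr A)%:E = mu A.
Proof. by move=> mA; rewrite /pr fineK // fin_num_measure. Qed.

Lemma pr_ge0 A : 0 <= pr A.
Proof. by apply: fine_ge0; apply: measure_ge0. Qed.

Lemma pr_setT : pr setT = 1.
Proof. by rewrite /pr probability_setT. Qed.

Lemma pr_set0 : pr set0 = 0.
Proof. by rewrite /pr measure0. Qed.

Lemma pr_le A B : measurable A -> measurable B -> A `<=` B -> pr A <= pr B.
Proof.
by move=> mA mB AB; rewrite -lee_fin !pr_fin //; apply: le_measure; rewrite ?inE.
Qed.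

Lemma pr_le1 A : measurable A -> pr A <= 1.
Proof. by move=> mA; rewrite -pr_setT; apply: pr_le => //; apply: measurableT. Qed.

Lemma pr_setU A B : measurable A -> measurable B -> A `&` B = set0 ->
  pr (A `|` B) = pr A + pr B.
Proof.
move=> mA mB AB; apply: EFin_inj; rewrite EFinD !pr_fin ?measureU //.
exact: measurableU.
Qed.

Lemma pr_sum (Z : finType) (G : Z -> set T) :
  (forall z, measurable (G z)) -> (forall z z' t, G z t -> G z' t -> z = z') ->
  pr [set t | exists z, G z t] = \sum_z pr (G z).
Proof.
move=> mG dG.
suff H (s : seq Z) : uniq s ->
    pr (\big[setU/set0]_(z <- s) G z) = \sum_(z <- s) pr (G z).
  rewrite -[RHS](H _ (index_enum_uniq Z)); congr pr; rewrite -bigcup_seq.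
  apply/seteqP; split => t /= [z]; last by exists z.
  by exists z => //=; rewrite mem_index_enum.
elim: s => [|z s IH] /=; first by rewrite !big_nil pr_set0.
case/andP=> zs us; rewrite !big_cons pr_setU ?IH //.
- by apply: bigsetU_measurable.
- apply/seteqP; split => // t [Gz]; rewrite -bigcup_seq => -[z' /= z's Gz'].
  by move: zs; rewrite (dG _ _ _ Gz Gz') z's.
Qed.

Lemma pr_full A B : measurable A -> measurable B -> pr B = 1 -> pr (A `&` B) = pr A.
Proof.
move=> mA mB B1; have mAB := measurableI _ _ mA mB.
have := pr_setU (A `&` B) (A `&` ~` B) mAB (measurableI _ _ mA (measurableC mB)).
rewrite -setIUr setUv setIT => ->; last first.
  by apply/seteqP; split => // t [[_ ?] []].
suff -> : pr (A `&` ~` B) = 0 by rewrite addr0.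
apply: le_anti; rewrite pr_ge0 andbT.
have : pr (A `&` ~` B) <= pr (~` B).
  by apply: pr_le; [exact: measurableI (measurableC _)|exact: measurableC|move=> ? []].
have := pr_setU B (~` B) mB (measurableC mB) (setICr _).
by rewrite setUv pr_setT B1; lra.
Qed.

End RealValued.

Section ConfigSets.
Context {V : countType} {dS : Order.disp_t} {S : finTBOrderType dS}.
Implicit Types (s : bool) (L U : {fset V}) (omega : config V S).

Lemma measurable_at v (Q : set S) : measurable [set omega : config V S | Q (omega v)].
Proof.
apply: sub_sigma_algebra; exists v => //; exists Q => //.
by rewrite setTI.
Qed.

Lemma measurable_forall (I : pred V) (Q : V -> set S) :
  measurable [set omega : config V S | forall v, I v -> Q v (omega v)].
Proof.
(* Countably many conditions, indexed by the codes of vertices; a code of no vertex gives the full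
   set. *)
have -> : [set omega : config V S | forall v, I v -> Q v (omega v)] =
    \bigcap_(n in @setT nat) [set omega : config V S |
      forall v, choice.unpickle n = Some v -> I v -> Q v (omega v)].
  apply/seteqP; split => omega /= h; first by move=> n _ v _; apply: h.
  by move=> v; apply: (h (choice.pickle v)) => //; rewrite choice.pickleK.
apply: bigcapT_measurable => n; case E : (choice.unpickle n) => [v|]; last first.
  by rewrite (_ : [set _ | _] = setT) //; apply/seteqP; split.
case Iv : (I v); last first.
  rewrite (_ : [set _ | _] = setT) //; apply/seteqP; split => // omega _ w [<-].
  by rewrite Iv.
have -> : [set omega : config V S | forall w, Some v = Some w -> I w -> Q w (omega w)] =
    [set omega | Q v (omega v)].
  by apply/seteqP; split => omega /= h; [apply: h | move=> w [<-]].
exact: measurable_at.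
Qed.

Lemma measurable_point omega : measurable [set omega].
Proof.
have -> : [set omega] = [set omega' : config V S | forall v, predT v -> [set omega v] (omega' v)].
  apply/seteqP; split => omega' /= h; first by rewrite h.
  by apply/funext => v; apply: h.
exact: (measurable_forall predT (fun v => [set omega v])).
Qed.

Lemma measurable_Omega_bc L omega : measurable (Omega_bc L omega).
Proof.
have -> : Omega_bc L omega =
    [set omega' | forall v, [pred v | v \notin L] v -> [set omega v] (omega' v)].
  by apply/seteqP; split.
exact: (measurable_forall [pred v | v \notin L] (fun v => [set omega v])).
Qed.

(** The pair [ext], [enc] identifies the configurations supported in [L] with a finite type, so that
    finite sums stand for integrals over them. *)
Definition ext s L (x : {ffun L -> S}) : config V S :=
  fun v => if insub v is Some u then x u else pm s v.

Definition enc L omega : {ffun L -> S} := [ffun u => omega (val u)].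

Lemma supported_ext s L x : supported s L (ext s L x).
Proof. by move=> v vL; rewrite /ext insubN. Qed.

Lemma extK s L omega : supported s L omega -> ext s L (enc L omega) = omega.
Proof.
move=> h; apply/funext => v; rewrite /ext; case: insubP => [u uL <-|vL].
  by rewrite ffunE.
by rewrite h.
Qed.

Lemma encK s L x : enc L (ext s L x) = x.
Proof. by apply/ffunP => u; rewrite ffunE /ext valK. Qed.

Lemma ext_inj s L : injective (ext s L).
Proof. by move=> x y xy; rewrite -(encK s L x) xy encK. Qed.

Lemma measurable_local L (U : set (config V S)) :
  (forall omega omega', {in L, omega =1 omega'} -> U omega -> U omega') -> measurable U.
Proof.
move=> h.
have -> : U = \bigcup_(x in [set x | U (ext true L x)])
    [set omega' | forall v, [pred v | v \in L] v -> [set ext true L x v] (omega' v)].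
  apply/seteqP; split => omega.
    move=> Uo; exists (enc L omega) => /=.
      apply: h Uo => v vL; rewrite /ext; case: insubP => [u _ <-|]; first by rewrite ffunE.
      by rewrite vL.
    move=> v /= vL; rewrite /ext; case: insubP => [u _ <-|]; first by rewrite ffunE.
    by rewrite vL.
  by case=> x /= Ux H; apply: h Ux => v vL; rewrite H.
apply: fin_bigcup_measurable => [|x _]; first exact: finite_finset.
exact: (measurable_forall [pred v | v \in L] (fun v => [set ext true L x v])).
Qed.

End ConfigSets.

Arguments enc {V dS S}.
Arguments ext {V dS S}.

Section SpecificationFacts.
Context {R : realType} {V : countType} {dS : Order.disp_t} {S : finTBOrderType dS}.
Context {rho : spec R V S}.
Context (rho_spec : updown_specification rho) (rho_mono : monotone_spec rho).
Implicit Types (s : bool) (L U : {fset V}) (omega tau : config V S).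

Definition weight s L (x : {ffun L -> S}) : R := pr (rho L (pm s)) [set ext s L x].

(** The heat-bath kernel that resamples the block [U], read on configurations supported in [L]. *)
Definition kern s L U (x y : {ffun L -> S}) : R :=
  pr (rho U (ext s L x)) [set ext s L y].

Lemma pr_bc U tau : Omega_pm tau -> pr (rho U tau) (Omega_bc U tau) = 1.
Proof. by move=> h; case: rho_spec => H _ _; rewrite /pr H. Qed.

Lemma pm_Omega s : Omega_pm (pm s : config V S).
Proof. exact: (supported_Omega (supported_pm s fset0)). Qed.

Lemma ext_Omega s L (x : {ffun L -> S}) : Omega_pm (ext s L x).
Proof. exact: (supported_Omega (supported_ext s L x)). Qed.

Lemma ext_sign s L (x : {ffun L -> S}) : Omega_sign s (ext s L x).
Proof. exact: (supported_sign (supported_ext s L x)). Qed.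

Lemma pr_agree U tau tau' E : Omega_pm tau -> Omega_pm tau' ->
  agree_off U tau tau' -> measurable E -> pr (rho U tau) E = pr (rho U tau') E.
Proof.
by move=> h h' ag mE; case: rho_spec => _ H _; rewrite /pr (H _ _ _ h h' ag E mE).
Qed.

Lemma pr_expand s L (mu : probability (config V S) R) E :
  pr mu (Omega_bc L (pm s)) = 1 -> measurable E ->
  pr mu E = \sum_x pr mu [set ext s L x] * (`[< E (ext s L x) >])%:R.
Proof.
move=> mu1 mE; rewrite -(pr_full mu E (Omega_bc L (pm s))) //; last first.
  exact: measurable_Omega_bc.
pose G (x : {ffun L -> S}) : set (config V S) :=
  if `[< E (ext s L x) >] then [set ext s L x] else set0.
have -> : E `&` Omega_bc L (pm s) = [set t | exists x, G x t].
  apply/seteqP; split => omega /=.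
    case=> Eo bco; exists (enc L omega); rewrite /G (extK s L omega bco).
    by rewrite asboolT.
  case=> x; rewrite /G; case: asboolP => // Ex ->; split => //.
  exact: supported_ext.
rewrite pr_sum.
- apply: eq_bigr => x _; rewrite /G; case: asboolP => _; first by rewrite mulr1.
  by rewrite mulr0 pr_set0.
- by move=> x; rewrite /G; case: asboolP => _; [exact: measurable_point|].
- move=> x y omega; rewrite /G; case: asboolP => // _; case: asboolP => // _ -> h.
  exact: (ext_inj s L).
Qed.

Lemma pr_bc_ext s L U (x : {ffun L -> S}) : (U `<=` L)%fset ->
  pr (rho U (ext s L x)) (Omega_bc L (pm s)) = 1.
Proof.
move=> UL; apply: le_anti; rewrite pr_le1 /=; last exact: measurable_Omega_bc.
rewrite -(pr_bc U (ext s L x) (ext_Omega _ _ _)).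
apply: pr_le; [exact: measurable_Omega_bc|exact: measurable_Omega_bc|].
move=> omega h v vL; rewrite h; first exact: supported_ext.
by apply: contra vL; apply: (fsubsetP UL).
Qed.

Lemma weight_sum s L : \sum_x weight s L x = 1.
Proof.
rewrite -(pr_setT (rho L (pm s))) (pr_expand s L) //; last by apply: pr_bc; apply: pm_Omega.
by apply: eq_bigr => x _; rewrite asboolT // mulr1.
Qed.

Lemma weight_ge0 s L x : 0 <= weight s L x.
Proof. exact: pr_ge0. Qed.

Lemma kern_ge0 s L U x y : 0 <= kern s L U x y.
Proof. exact: pr_ge0. Qed.

Lemma kern_sum s L U x : (U `<=` L)%fset -> \sum_y kern s L U x y = 1.
Proof.
move=> UL; rewrite -(pr_setT (rho U (ext s L x))) (pr_expand s L) //; last exact: pr_bc_ext.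
by apply: eq_bigr => y _; rewrite asboolT // mulr1.
Qed.

(** The conditioning axiom multiplied out, so that it also covers boundary events of probability
    zero. *)
Lemma pr_cond s L U tau E : (U `<=` L)%fset -> supported s L tau -> measurable E ->
  pr (rho L (pm s)) (E `&` Omega_bc U tau) =
  pr (rho L (pm s)) (Omega_bc U tau) * pr (rho U tau) E.
Proof.
move=> UL st mE; have mbc := measurable_Omega_bc U tau.
have Ot := supported_Omega st.
have mEbc := measurableI _ _ mE mbc.
rewrite !(pr_agree L (pm s) tau) //; try exact: pm_Omega.
have [b0|b_gt0] := eqVneq (pr (rho L tau) (Omega_bc U tau)) 0.
  rewrite b0 mul0r; apply: le_anti; rewrite pr_ge0 andbT -b0.
  by apply: pr_le => // t [].
case: rho_spec => _ _ /(_ U L tau UL Ot).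
have -> : (0 < rho L tau (Omega_bc U tau))%E.
  by rewrite -pr_fin // lte_fin lt_def b_gt0 pr_ge0.
move=> /(_ isT E mE).
rewrite -!pr_fin // inver (negbTE b_gt0) -EFinM => -[] <-.
by rewrite mulrC mulfVK.
Qed.

Lemma bc_eq U tau tau' : agree_off U tau tau' -> Omega_bc U tau = Omega_bc U tau'.
Proof.
by move=> h; apply/seteqP; split => omega ho v vU; rewrite ho // h.
Qed.

Lemma kern0 s L U x y : ~ agree_off U (ext s L x) (ext s L y) -> kern s L U x y = 0.
Proof.
move=> h; rewrite /kern -(pr_full _ _ (Omega_bc U (ext s L x))).
- rewrite (_ : _ `&` _ = set0) ?pr_set0 //.
  by apply/seteqP; split => // t [/= ->].
- exact: measurable_point.
- exact: measurable_Omega_bc.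
- by apply: pr_bc; apply: ext_Omega.
Qed.

(** If [x] and [y] agree off [U], the kernel depends on its target alone, and each weight is the
    mass of the common boundary event times the kernel at that target; both sides are then the same
    product. Otherwise both kernels vanish. *)
Lemma detailed_balance s L U x y : (U `<=` L)%fset ->
  weight s L x * kern s L U x y = weight s L y * kern s L U y x.
Proof.
move=> UL; have [ag|nag] := pselect (agree_off U (ext s L x) (ext s L y)); last first.
  by rewrite !kern0 ?mulr0 // => h; apply: nag => v vU; rewrite h.
have W z : weight s L z =
    pr (rho L (pm s)) (Omega_bc U (ext s L z)) * kern s L U z z.
  rewrite /weight /kern -(pr_cond s) //; first last.
  - exact: measurable_point.
  - exact: supported_ext.
  congr pr; apply/seteqP; split => [t /= ->|t []] //.
have K z : kern s L U x z = kern s L U y z.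
  by apply: pr_agree; rewrite ?ag //; try exact: ext_Omega; exact: measurable_point.
by rewrite !W (K y) -(K x) (bc_eq U _ _ ag); ring.
Qed.

Lemma heat_bath s L U h : (U `<=` L)%fset ->
  \sum_x weight s L x * \sum_y kern s L U x y * h y = \sum_y weight s L y * h y.
Proof.
move=> UL; transitivity (\sum_x \sum_y weight s L x * kern s L U x y * h y).
  by apply: eq_bigr => x _; rewrite mulr_sumr; apply: eq_bigr => y _; rewrite mulrA.
rewrite exchange_big; apply: eq_bigr => y _ /=.
under eq_bigr => x _ do rewrite detailed_balance //.
by rewrite -mulr_suml -mulr_sumr kern_sum // mulr1.
Qed.

Lemma pr_mix s L U E : (U `<=` L)%fset -> measurable E ->
  pr (rho L (pm s)) E = \sum_x weight s L x * pr (rho U (ext s L x)) E.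
Proof.
move=> UL mE; rewrite (pr_expand s L) //; last by apply: pr_bc; apply: pm_Omega.
rewrite -(heat_bath s L U (fun y => (`[< E (ext s L y) >])%:R)) //.
apply: eq_bigr => x _; congr (_ * _).
by rewrite [RHS](pr_expand s L) //; apply: pr_bc_ext.
Qed.

Definition increasing (E : set (config V S)) :=
  forall tau omega, conf_le tau omega -> E tau -> E omega.

Lemma pr_mono U tau tau' E : conf_le tau tau' ->
  [\/ Omega_sign true tau /\ Omega_sign true tau',
      Omega_sign false tau /\ Omega_sign false tau'
    | Omega_sign false tau /\ Omega_sign true tau'] ->
  measurable E -> increasing E -> pr (rho U tau) E <= pr (rho U tau') E.
Proof.
by move=> h h' mE iE; rewrite -lee_fin !pr_fin //; apply: rho_mono.
Qed.

Lemma dom_top L U E : (U `<=` L)%fset -> measurable E -> increasing E ->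
  pr (rho L (pm true)) E <= pr (rho U (pm true)) E.
Proof.
move=> UL mE iE; rewrite (pr_mix true L U) //.
apply: (@le_trans _ _ (\sum_x weight true L x * pr (rho U (pm true)) E)).
  apply: ler_sum => x _; apply: ler_wpM2l; first exact: weight_ge0.
  apply: pr_mono => //; last first.
    by constructor 1; split; [exact: ext_sign|exact: (supported_sign (supported_pm true fset0))].
  by move=> v; apply: lex1.
by rewrite -mulr_suml weight_sum mul1r.
Qed.

(** The larger volume carries the + boundary condition here too: the single measure
    [rho L (pm true)] lies between [rho U (pm false)] and [rho U (pm true)], so one stationary
    sample can be compared with both dynamics in [U]. This is the mixed case of monotonicity. *)
Lemma dom_bot L U E : (U `<=` L)%fset -> measurable E -> increasing E ->
  pr (rho U (pm false)) E <= pr (rho L (pm true)) E.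
Proof.
move=> UL mE iE; rewrite (pr_mix true L U) //.
apply: (@le_trans _ _ (\sum_x weight true L x * pr (rho U (pm false)) E)).
  by rewrite -mulr_suml weight_sum mul1r.
apply: ler_sum => x _; apply: ler_wpM2l; first exact: weight_ge0.
apply: pr_mono => //; last first.
  by constructor 3; split; [exact: (supported_sign (supported_pm false fset0))|exact: ext_sign].
by move=> v; apply: le0x.
Qed.

End SpecificationFacts.

Arguments weight {R V dS S} rho.
Arguments kern {R V dS S} rho.

(** * Averages over the update variables *)

Section NoiseMean.
Context {R : realType} {V : countType} {dS : Order.disp_t} {S : finTBOrderType dS}.
Context {dA : measure_display} {TA : measurableType dA}.
Context {rho : spec R V S} {F : config V S -> V -> TA -> S}.
Implicit Types (s : bool) (L : {fset V}) (omega : config V S).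
Implicit Types (o : nat -> rel V) (a : nat -> V -> TA) (I J : set (nat * V)).

Local Notation field := (nat -> V -> TA).

(** A pointwise statement on functions, in the place of measurability with respect to the variables
    in [I]. *)
Definition depends_on I {X : Type} (f : field -> X) :=
  forall a a', (forall k u, I (k, u) -> a k u = a' k u) -> f a = f a'.

(* [E] stands for the expectation over the i.i.d. update variables; it acts on
   arbitrary functions of the variables because finitely many atoms of each
   suffice to run the dynamics in [L] up to time [M]. *)
Record noise_mean L (M : nat) (E : (field -> R) -> R) : Prop := NoiseMean {
  mean_add : forall f g, E (fun a => f a + g a) = E f + E g;
  mean_scale : forall x f, E (fun a => x * f a) = x * E f;
  mean_le : forall f g, (forall a, f a <= g a) -> E f <= E g;
  mean_one : E (fun=> 1) = 1;
  mean_indep : forall I J f g, I `&` J = set0 -> depends_on I f -> depends_on J g ->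
    E (fun a => f a * g a) = E f * E g;
  mean_site : forall s omega u k t, supported s L omega -> u \in L ->
    (0 < k <= M)%N ->
    E (fun a => (F omega u (a k u) == t)%:R) =
      pr (rho [fset u]%fset omega) [set sigma | sigma u = t] }.

Arguments mean_add {L M E}.
Arguments mean_scale {L M E}.
Arguments mean_le {L M E}.
Arguments mean_one {L M E}.
Arguments mean_indep {L M E}.
Arguments mean_site {L M E}.

Lemma noise_mean_sub {L L' M M' E} : (L' `<=` L)%fset -> (M' <= M)%N ->
  noise_mean L M E -> noise_mean L' M' E.
Proof.
move=> LL MM [? ? ? ? ? site]; split => // s omega u k t so uL /andP[k0 kM].
apply: (site s) => //; [exact: supported_sub so|exact: (fsubsetP LL)|].
by rewrite k0 (leq_trans kM).
Qed.

Lemma depends_onW I J {X : Type} (f : field -> X) : I `<=` J ->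
  depends_on I f -> depends_on J f.
Proof. by move=> IJ h a a' aa; apply: h => k u /IJ; apply: aa. Qed.

Lemma depends_on_comp I {X Y : Type} (g : X -> Y) (f : field -> X) :
  depends_on I f -> depends_on I (fun a => g (f a)).
Proof. by move=> h a a' /h ->. Qed.

Section Mean.
Context {L : {fset V}} {M : nat} {E : (field -> R) -> R} (EP : noise_mean L M E).

Definition Pr (Q : field -> bool) := E (fun a => (Q a)%:R).

Lemma mean_eq f g : f =1 g -> E f = E g.
Proof.
by move=> fg; apply: le_anti; apply/andP; split; apply: (mean_le EP) => a; rewrite fg.
Qed.

Lemma mean_cst x : E (fun=> x) = x.
Proof.
have -> : E (fun=> x) = E (fun=> x * 1) by apply: mean_eq => a; rewrite mulr1.
by rewrite (mean_scale EP) (mean_one EP) mulr1.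
Qed.

Lemma mean_sum (Z : Type) (r : seq Z) (f : Z -> field -> R) :
  E (fun a => \sum_(z <- r) f z a) = \sum_(z <- r) E (f z).
Proof.
elim: r => [|z r IH].
  by rewrite big_nil -[RHS](mean_cst 0); apply: mean_eq => a; rewrite big_nil.
rewrite big_cons -IH -(mean_add EP); apply: mean_eq => a; rewrite big_cons //.
Qed.

Lemma mean_sub f g : E (fun a => f a - g a) = E f - E g.
Proof.
rewrite -[- E g]mulN1r -(mean_scale EP) -(mean_add EP); apply: mean_eq => a.
by rewrite mulN1r.
Qed.

Lemma Pr_ge0 Q : 0 <= Pr Q.
Proof. by rewrite -(mean_cst 0); apply: (mean_le EP) => a; rewrite ler0n. Qed.

Lemma Pr_le {Q Q' : field -> bool} : (forall a, Q a -> Q' a) -> Pr Q <= Pr Q'.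
Proof.
move=> QQ; apply: (mean_le EP) => a; rewrite ler_nat.
by case Qa : (Q a) => //; rewrite QQ.
Qed.

Lemma Pr_le1 Q : Pr Q <= 1.
Proof. by rewrite -[leRHS](mean_one EP); apply: (mean_le EP) => a; rewrite lern1 leq_b1. Qed.

Lemma Pr_or Q Q' : Pr (fun a => Q a || Q' a) <= Pr Q + Pr Q'.
Proof.
rewrite -(mean_add EP); apply: (mean_le EP) => a.
by rewrite -natrD ler_nat; case: (Q a) => //=; rewrite leq_addr.
Qed.

Lemma Pr_has (Z : Type) (r : seq Z) (Q : Z -> field -> bool) :
  Pr (fun a => has (fun z => Q z a) r) <= \sum_(z <- r) Pr (Q z).
Proof.
elim: r => [|z r IH] /=; first by rewrite big_nil /Pr mean_cst.
by rewrite big_cons; apply: le_trans (Pr_or _ _) _; rewrite lerD2l.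
Qed.

Lemma Pr_has_le (Z : eqType) (r : seq Z) (Q : Z -> field -> bool) x :
  (forall z, z \in r -> Pr (Q z) <= x) ->
  Pr (fun a => has (fun z => Q z a) r) <= (size r)%:R * x.
Proof.
move=> h; apply: le_trans (Pr_has _ _ _) _.
apply: (@le_trans _ _ (\sum_(z <- r) x)).
  by rewrite big_seq [leRHS]big_seq; apply: ler_sum.
by rewrite big_const_seq count_predT iter_addr_0 mulr_natl.
Qed.

Lemma Pr_and I J Q Q' : I `&` J = set0 -> depends_on I Q -> depends_on J Q' ->
  Pr (fun a => Q a && Q' a) = Pr Q * Pr Q'.
Proof.
move=> IJ h h'; rewrite /Pr -(mean_indep EP I J) //.
- by apply: mean_eq => a; rewrite -natrM mulnb.
- exact: (depends_on_comp _ (fun b : bool => b%:R : R)).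
- exact: (depends_on_comp _ (fun b : bool => b%:R : R)).
Qed.

Lemma mean_fin (Z : finType) (G : field -> Z) (h : Z -> R) :
  E (fun a => h (G a)) = \sum_z Pr (fun a => G a == z) * h z.
Proof.
transitivity (E (fun a => \sum_z h z * (G a == z)%:R)).
  apply: mean_eq => a; rewrite (bigD1 (G a)) //= eqxx mulr1 big1 ?addr0 // => z zG.
  by rewrite eq_sym (negbTE zG) mulr0.
by rewrite mean_sum; apply: eq_bigr => z _; rewrite (mean_scale EP) mulrC.
Qed.

(** Fubini: [G] has finitely many values, so one may sum over them and average [h z] with [z]
    frozen. *)
Lemma mean_mix (Z : finType) I J (G : field -> Z) (h : Z -> field -> R) :
  I `&` J = set0 -> depends_on I G -> (forall z, depends_on J (h z)) ->
  E (fun a => h (G a) a) = E (fun a => E (h (G a))).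
Proof.
move=> IJ GI hJ; rewrite (mean_fin _ G (fun z => E (h z))).
transitivity (E (fun a => \sum_z (G a == z)%:R * h z a)).
  apply: mean_eq => a; rewrite (bigD1 (G a)) //= eqxx mul1r big1 ?addr0 // => z zG.
  by rewrite eq_sym (negbTE zG) mul0r.
rewrite mean_sum; apply: eq_bigr => z _; apply: (mean_indep EP I J) => //.
exact: (depends_on_comp _ (fun y => (y == z)%:R : R)).
Qed.

Context (rho_spec : updown_specification rho).

Lemma Pr_update s u k x y : u \in L -> (0 < k <= M)%N ->
  Pr (fun a => enc L (update F u (a k u) (ext s L x)) == y) =
  kern rho s L [fset u]%fset x y.
Proof.
move=> uL kM; have [ag|nag] := pselect (agree_off [fset u]%fset (ext s L x) (ext s L y)).
  rewrite /kern -(pr_full _ [set ext s L y] (Omega_bc [fset u]%fset (ext s L x))); first last.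
  - by apply: (pr_bc rho_spec); apply: ext_Omega.
  - exact: measurable_Omega_bc.
  - exact: measurable_point.
  have -> : [set ext s L y] `&` Omega_bc [fset u]%fset (ext s L x) =
      [set sigma | sigma u = ext s L y u] `&` Omega_bc [fset u]%fset (ext s L x).
    apply/seteqP; split => sigma /= [h1 h2]; split => //; first by rewrite h1.
    apply/funext => w; have [->//|wu] := eqVneq w u.
    have wu' : w \notin [fset u]%fset by rewrite in_fset1.
    by rewrite h2 // ag.
  rewrite pr_full; first last.
  - by apply: (pr_bc rho_spec); apply: ext_Omega.
  - exact: measurable_Omega_bc.
  - exact: (measurable_at u [set ext s L y u]).
  rewrite -(mean_site EP s _ u k) //; last exact: supported_ext.
  apply: mean_eq => a; congr (_%:R); congr nat_of_bool; apply/eqP/eqP => [<-|h].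
    rewrite extK; first by rewrite /update eqxx.
    by apply: supported_update => //; apply: supported_ext.
  apply: (ext_inj s L); rewrite extK; last first.
    by apply: supported_update => //; apply: supported_ext.
  apply/funext => w; rewrite /update; case: eqP => [->//|/eqP wu].
  by rewrite ag // in_fset1.
rewrite (kern0 rho_spec) // -[RHS](mean_cst 0); apply: mean_eq => a.
case: eqP => // h; exfalso; apply: nag => w; rewrite in_fset1 => wu.
rewrite -h extK; first by rewrite /update (negbTE wu).
by apply: supported_update => //; apply: supported_ext.
Qed.

Lemma sweep_depends s k l omega :
  depends_on [set p | p.1 = k /\ p.2 \in l] (fun a => enc L (sweep F l (a k) omega)).
Proof. by move=> a a' aa; congr enc; apply: sweep_local => w wl; apply: aa. Qed.

Lemma dyn_depends s o L' k n omega :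
  depends_on [set p | (k < p.1 <= k + n)%N /\ p.2 \in L']
    (fun a => dyn F s L' o a k n omega).
Proof. by move=> a a' aa; apply: dyn_local => j u h uL; apply: aa. Qed.

(** The head of the list is updated last, with a variable independent of the rest of the sweep.
    Averaging over it replaces [h] by its image under a heat-bath kernel, which preserves the
    weighted sum, and the induction applies to that image. *)
Lemma sweep_stationary s k l h : uniq l -> {subset l <= L} -> (0 < k <= M)%N ->
  \sum_x weight rho s L x * E (fun a => h (enc L (sweep F l (a k) (ext s L x)))) =
  \sum_x weight rho s L x * h x.
Proof.
move=> + + kM; elim: l h => [|u l IH] h /=.
  by move=> _ _; apply: eq_bigr => x _; rewrite encK mean_cst.
case/andP=> ul uniql lL.
have uL : u \in L by apply: lL; rewrite mem_head.
have lL' : {subset l <= L} by move=> w wl; apply: lL; rewrite inE wl orbT.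
have uLf : ([fset u] `<=` L)%fset by rewrite fsub1set.
rewrite -[RHS](heat_bath rho_spec s L [fset u]%fset h) //.
have /= <- := IH (fun x => \sum_y kern rho s L [fset u]%fset x y * h y) uniql lL'.
apply: eq_bigr => x _; congr (_ * _).
transitivity (E (fun a => h (enc L (update F u (a k u)
    (ext s L (enc L (sweep F l (a k) (ext s L x)))))))).
  by apply: mean_eq => a; rewrite extK //; apply: supported_sweep => //; apply: supported_ext.
rewrite (mean_mix _ [set p | p.1 = k /\ p.2 \in l] [set (k, u)]
  (fun a => enc L (sweep F l (a k) (ext s L x)))
  (fun z a => h (enc L (update F u (a k u) (ext s L z))))).
- apply: mean_eq => a; rewrite (mean_fin _ _ h); apply: eq_bigr => y _.
  by rewrite Pr_update.
- by apply/seteqP; split => // -[j w] /= [[_ wl] [_ wu]]; rewrite -wu wl in ul.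
- exact: sweep_depends.
- by move=> z a a' aa; rewrite (aa k u).
Qed.

(** The oldest sweep acts first: it is absorbed by [sweep_stationary], applied to the mean of [h]
    over the [n] younger sweeps. *)
Lemma dyn_stationary s o k n h : (k + n <= M)%N ->
  \sum_x weight rho s L x * E (fun a => h (enc L (dyn F s L o a k n (ext s L x)))) =
  \sum_x weight rho s L x * h x.
Proof.
elim: n h => [|n IH] h kn /=.
  by apply: eq_bigr => x _; rewrite encK mean_cst.
have kn' : (k + n <= M)%N by apply: leq_trans kn; rewrite addnS.
rewrite -(IH h kn').
have /= <- := sweep_stationary s (k + n.+1) (sort (o (k + n.+1)%N) L)
  (fun x => E (fun a => h (enc L (dyn F s L o a k n (ext s L x))))).
- apply: eq_bigr => x _; congr (_ * _).
  transitivity (E (fun a => h (enc L (dyn F s L o a k n (ext s L (enc L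
      (sweep F (sort (o (k + n.+1)%N) L) (a (k + n.+1)%N) (ext s L x)))))))).
    apply: mean_eq => a; rewrite extK.
      by rewrite /step restrict_id //; apply: supported_ext.
    by apply: supported_sweep => [u|]; [rewrite mem_sort|apply: supported_ext].
  rewrite (mean_mix _ [set p | p.1 = (k + n.+1)%N /\ p.2 \in sort (o (k + n.+1)%N) L]
     [set p | (k < p.1 <= k + n)%N /\ p.2 \in L]
     (fun a => enc L (sweep F (sort (o (k + n.+1)%N) L) (a (k + n.+1)%N) (ext s L x)))
     (fun z a => h (enc L (dyn F s L o a k n (ext s L z))))) //.
  + apply/seteqP; split => // -[j w] /= [[-> _]] [/andP[_]].
    by rewrite addnS ltnn.
  + exact: sweep_depends.
  + by move=> z; exact: (depends_on_comp _ (fun w => h (enc L w)) _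
      (dyn_depends s o L k n (ext s L z))).
- by rewrite sort_uniq fset_uniq.
- by move=> u; rewrite mem_sort.
- by rewrite kn addnS.
Qed.

(** The observable may itself run the younger sweeps: they are independent of the older ones, which
    hand it a stationary sample. *)
Lemma dyn_stationary_mix s o k n n' (h : {ffun L -> S} -> field -> R) :
  (k + n + n' <= M)%N -> (forall z, depends_on [set p | (p.1 <= k + n)%N] (h z)) ->
  \sum_x weight rho s L x *
    E (fun a => h (enc L (dyn F s L o a (k + n) n' (ext s L x))) a) =
  \sum_x weight rho s L x * E (h x).
Proof.
move=> kn hJ; rewrite -(dyn_stationary s o (k + n) n' (fun x => E (h x))) //.
apply: eq_bigr => x _; congr (_ * _).
apply: (mean_mix _ [set p | (k + n < p.1 <= k + n + n')%N /\ p.2 \in L]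
  [set p | (p.1 <= k + n)%N]) => //.
- apply/seteqP; split => // -[j w] /= [[/andP[+ _] _]].
  by rewrite ltnNge => /negbTE ->.
- exact: (depends_on_comp _ (enc L) _ (dyn_depends s o L (k + n) n' (ext s L x))).
Qed.


End Mean.
End NoiseMean.

Arguments noise_mean {R V dS S dA TA} rho F.
Arguments mean_add {R V dS S dA TA rho F L M E}.
Arguments mean_scale {R V dS S dA TA rho F L M E}.
Arguments mean_le {R V dS S dA TA rho F L M E}.
Arguments mean_one {R V dS S dA TA rho F L M E}.
Arguments mean_indep {R V dS S dA TA rho F L M E}.
Arguments mean_site {R V dS S dA TA rho F L M E}.
Arguments Pr {R V dA TA} E Q.

(** * Influence of the boundary of a ball on its centre *)

Section Influence.
Context {R : realType} {V : countType} {dS : Order.disp_t} {S : finTBOrderType dS}.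
Context {dA : measure_display} {TA : measurableType dA}.
Context {rho : spec R V S} {F : config V S -> V -> TA -> S}.
Context (rho_spec : updown_specification rho) (rho_mono : monotone_spec rho).
Context (F_mono : forall omega omega' v x, Omega_pm omega -> Omega_pm omega' ->
  conf_le omega omega' -> (F omega v x <= F omega' v x)%O).
Context {e : rel V} (esym : symmetric e) (fin : locally_finite e) {c C : R}.
Context (mixing : forall v r,
  (dTV (rho (vball e v r) (pm true)) (fun sigma => sigma v)
       (rho (vball e v r) (pm false)) (fun sigma => sigma v)
   <= (C * expR (- (c * r%:R)))%:E)%E).
Implicit Types (s : bool) (L : {fset V}) (omega : config V S).

Local Notation field := (nat -> V -> TA).

Lemma mixing_ge v r t :
  pr (rho (vball e v r) (pm true)) [set sigma | (t <= sigma v)%O] -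
  pr (rho (vball e v r) (pm false)) [set sigma | (t <= sigma v)%O] <=
  C * expR (- (c * r%:R)).
Proof.
apply: le_trans (ler_norm _) _; rewrite -lee_fin.
apply: le_trans _ (mixing v r).
have mt : measurable [set sigma : config V S | (t <= sigma v)%O].
  exact: (measurable_at v [set x | (t <= x)%O]).
rewrite /dTV; apply: le_trans; last exact: (le_bigmax _ _ [set x : S | (t <= x)%O]%SET).
have -> : [set sigma : config V S | sigma v \in [set x : S | (t <= x)%O]%SET] =
    [set sigma | (t <= sigma v)%O].
  by apply/seteqP; split => sigma /=; rewrite inE.
by rewrite -!(pr_fin _ _ mt) -EFinB abse_EFin.
Qed.

(** The sum counts the spins [t] with [y < t <= x], and [t = x] is one of them. A disagreement is
    thus bounded by differences of indicators of increasing events, at the price of a factor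
    [#|S|]. *)
Lemma neq_count (x y : S) : (y <= x)%O ->
  (x != y)%:R <= \sum_(t : S) ((t <= x)%O%:R - (t <= y)%O%:R) :> R.
Proof.
move=> yx; have pos t : 0 <= ((t <= x)%O%:R - (t <= y)%O%:R : R).
  by rewrite subr_ge0 ler_nat; case ty : (t <= y)%O => //; rewrite (le_trans ty yx).
have [xy|xy] /= := eqVneq x y; first by apply: sumr_ge0 => t _; apply: pos.
rewrite (bigD1 x) //= lexx (_ : (x <= y)%O = false); last first.
  by apply/negbTE; rewrite -ltNge lt_neqAle eq_sym xy yx.
by rewrite subr0 lerDl; apply: sumr_ge0.
Qed.

Context {o : nat -> rel V} (o_lin : forall k, linear_order (o k)).

Lemma increasing_dyn s L a k n v t :
  increasing [set omega | (t <= dyn F s L o a k n omega v)%O].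
Proof.
move=> tau omega to /= h; apply: le_trans h _.
have := dyn_mono F_mono o_lin s L a k n.
case: s => H; first exact: (H tau omega).
exact: (H omega tau).
Qed.

Lemma measurable_dyn s L a k n v t : v \in L ->
  measurable [set omega | (t <= dyn F s L o a k n omega v)%O].
Proof.
move=> vL; apply: (measurable_local L) => omega omega' ag /=; case: n => [|n].
  by rewrite /= ag.
by rewrite (dyn_agree s L o a k n omega omega').
Qed.


Lemma weighted_mean {L M} {E : (field -> R) -> R} (EP : noise_mean rho F L M E) s
    (f : {ffun L -> S} -> field -> R) :
  \sum_x weight rho s L x * E (f x) = E (fun a => \sum_x weight rho s L x * f x a).
Proof.
rewrite (mean_sum EP); apply: eq_bigr => x _.
by rewrite (mean_scale EP).
Qed.

Lemma pr_weight L s (Q : config V S -> bool) : measurable [set omega | Q omega] ->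
  pr (rho L (pm s)) [set omega | Q omega] = \sum_x weight rho s L x * (Q (ext s L x))%:R.
Proof.
move=> mQ; rewrite (pr_expand s L) //; last first.
  exact: (pr_bc rho_spec _ _ (pm_Omega s)).
by apply: eq_bigr => x _; congr (_ * _%:R); rewrite /= asboolb.
Qed.

Lemma stationary_mean {L M} {E : (field -> R) -> R} (EP : noise_mean rho F L M E)
    s k n v t : (k + n <= M)%N -> v \in L ->
  E (fun a => pr (rho L (pm s)) [set omega | (t <= dyn F s L o a k n omega v)%O]) =
  pr (rho L (pm s)) [set omega | (t <= omega v)%O].
Proof.
move=> kn vL.
transitivity (E (fun a => \sum_x weight rho s L x *
    ((t <= ext s L (enc L (dyn F s L o a k n (ext s L x))) v)%O)%:R)).
  apply: (mean_eq EP) => a; rewrite pr_weight; last exact: measurable_dyn.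
  apply: eq_bigr => x _; rewrite extK //; apply: supported_dyn; exact: supported_ext.
rewrite -(weighted_mean EP) (dyn_stationary EP rho_spec s o k n
  (fun x => ((t <= ext s L x v)%O)%:R)) // pr_weight //.
exact: (measurable_at v [set x | (t <= x)%O]).
Qed.

(** The older sweeps in [L] hand over a configuration with law [rho L (pm true)]. On increasing
    events this law lies between the - and the + measures of the ball, which are stationary for the
    two dynamics in the ball; the sweeps disappear and weak mixing at [v] remains. *)
Lemma boundary_influence {L M} {E : (field -> R) -> R} (EP : noise_mean rho F L M E)
    v r k n n' : (vball e v r `<=` L)%fset -> (k + n + n' <= M)%N ->
  \sum_x weight rho true L x * Pr E (fun a =>
     dyn F true (vball e v r) o a k n (dyn F true L o a (k + n) n' (ext true L x)) v !=
     dyn F false (vball e v r) o a k n (dyn F true L o a (k + n) n' (ext true L x)) v)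
  <= #|S|%:R * (C * expR (- (c * r%:R))).
Proof.
set L' := vball e v r => LL kn.
have vL' : v \in L' by apply: vball_center.
have knM : (k + n <= M)%N by apply: leq_trans kn; apply: leq_addr.
have EP' : noise_mean rho F L' M E := noise_mean_sub LL (leqnn M) EP.
pose D (a : field) omega :=
  dyn F true L' o a k n omega v != dyn F false L' o a k n omega v.
pose U s (a : field) t := [set omega | (t <= dyn F s L' o a k n omega v)%O].
have mU s a t : measurable (U s a t) by apply: measurable_dyn.
have iU s a t : increasing (U s a t) by apply: increasing_dyn.
have -> : \sum_x weight rho true L x *
      Pr E (fun a => D a (dyn F true L o a (k + n) n' (ext true L x))) =
    \sum_x weight rho true L x *
      E (fun a => (D a (ext true L (enc L (dyn F true L o a (k + n) n' (ext true L x)))))%:R).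
  apply: eq_bigr => x _; congr (_ * _); apply: (mean_eq EP) => a.
  by rewrite extK //; apply: supported_dyn; apply: supported_ext.
rewrite (dyn_stationary_mix EP rho_spec true o k n n'
  (fun z a => (D a (ext true L z))%:R)) //; last first.
  move=> z a a' aa; rewrite /D !(dyn_local _ _ _ a a') // => j u /andP[_ jn] _;
  exact: aa.
apply: (@le_trans _ _ (E (fun a => \sum_(t : S)
    (pr (rho L (pm true)) (U true a t) - pr (rho L (pm true)) (U false a t))))).
  rewrite (weighted_mean EP); apply: (mean_le EP) => a.
  have WU s t : pr (rho L (pm true)) (U s a t) = \sum_x weight rho true L x *
      ((t <= dyn F s L' o a k n (ext true L x) v)%O)%:R.
    exact: (pr_weight L true _ (mU s a t)).
  rewrite sumrB; under [X in _ <= X - _]eq_bigr => t _ do rewrite WU.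
  under [X in _ <= _ - X]eq_bigr => t _ do rewrite WU.
  rewrite [X in _ <= X - _]exchange_big /= [X in _ <= _ - X]exchange_big /= -sumrB.
  apply: ler_sum => x _; rewrite -!mulr_sumr -mulrBr.
  apply: ler_wpM2l; first exact: weight_ge0.
  rewrite -sumrB; apply: neq_count.
  by apply: (dyn_le F_mono) => w; apply: lexx.
apply: (@le_trans _ _ (E (fun a => \sum_(t : S)
    (pr (rho L' (pm true)) (U true a t) - pr (rho L' (pm false)) (U false a t))))).
  apply: (mean_le EP) => a; apply: ler_sum => t _; apply: lerB.
    exact: (dom_top rho_spec rho_mono).
  exact: (dom_bot rho_spec rho_mono).
rewrite (mean_sum EP) mulr_natl -sumr_const; apply: ler_sum => t _.
rewrite (mean_sub EP) (stationary_mean EP' true) // (stationary_mean EP' false) //.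
exact: mixing_ge.
Qed.

End Influence.

(** * Recursions for the probability of a discrepancy *)

Section Discrepancy.
Context {R : realType} {V : countType} {dS : Order.disp_t} {S : finTBOrderType dS}.
Context {dA : measure_display} {TA : measurableType dA}.
Context (e : rel V) (rho : spec R V S) (F : config V S -> V -> TA -> S).
Implicit Types (s : bool) (L : {fset V}) (omega : config V S).

Local Notation field := (nat -> V -> TA).

Definition disc L o (a : field) k n v :=
  dyn F true L o a k n (pm true) v != dyn F false L o a k n (pm false) v.

(** The bound is required in every model of the noise, for all linear orders and all shifts [k] of
    the ages, so that it can be applied to subvolumes and to older periods. *)
Definition disc_bound n (b : R) := forall L M E o v k,
  noise_mean rho F L M E -> (forall j, linear_order (o j)) ->
  (vball e v n `<=` L)%fset -> (k + n <= M)%N ->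
  Pr E (fun a => disc (vball e v n) o a k n v) <= b.

(** A supremum over models, volumes and orders, written as the least admissible bound; [1] is always
    admissible. *)
Definition phi n : R := inf [set b | 0 <= b /\ disc_bound n b].

Lemma phi_has_inf n : has_inf [set b : R | 0 <= b /\ disc_bound n b].
Proof.
split; last by exists 0 => b [].
by exists 1; split => // L M E o v k EP _ _ _; apply: (Pr_le1 EP).
Qed.

Lemma phi_ge0 n : 0 <= phi n.
Proof. by apply: lb_le_inf => [|b []//]; case: (phi_has_inf n). Qed.

Lemma phi_le n b : 0 <= b -> disc_bound n b -> phi n <= b.
Proof. by move=> b0 hb; apply: ge_inf; [case: (phi_has_inf n)|split]. Qed.

Lemma phi_le1 n : phi n <= 1.
Proof. by apply: phi_le => // L M E o v k EP _ _ _; apply: (Pr_le1 EP). Qed.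

Lemma phi_bound n : disc_bound n (phi n).
Proof.
move=> L M E o v k EP ol vL kM; apply: lb_le_inf; first by case: (phi_has_inf n).
by move=> b [_ hb]; apply: (hb L M).
Qed.

Context (rho_spec : updown_specification rho) (rho_mono : monotone_spec rho).
Context (F_mono : forall omega omega' v x, Omega_pm omega -> Omega_pm omega' ->
  conf_le omega omega' -> (F omega v x <= F omega' v x)%O).
Context (esym : symmetric e) (fin : locally_finite e) {c C : R}.
Context (mixing : forall v r,
  (dTV (rho (vball e v r) (pm true)) (fun sigma => sigma v)
       (rho (vball e v r) (pm false)) (fun sigma => sigma v)
   <= (C * expR (- (c * r%:R)))%:E)%E).
Local Notation K := (#|S|%:R * C).

Section Pointwise.
Context {o : nat -> rel V} (o_lin : forall k, linear_order (o k)).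

Lemma pm_le omega omega' : conf_le (pm false) omega /\ conf_le omega' (pm true).
Proof. by split=> v; [apply: le0x | apply: lex1]. Qed.

(** The configurations in the larger volume lie between the - and the + configurations of the
    smaller one, so they agree wherever these do. *)
Lemma disc_sub {L L' a k n v} : (L' `<=` L)%fset -> disc L o a k n v -> disc L' o a k n v.
Proof.
move=> LL; apply: contra => /eqP h; apply/eqP; apply: le_anti; apply/andP; split.
  apply: le_trans (dyn_shrink F_mono o_lin true L L' a k n _ _ LL (confs_le_refl _ _) v) _.
  by rewrite h; apply: (dyn_shrink F_mono o_lin false L L' a k n _ _ LL (confs_le_refl _ _) v).
by apply: (dyn_le F_mono) => w; apply: le0x.
Qed.

(** Older sweeps merely replace the extremal starting configurations by intermediate ones. *)
Lemma disc_time {L a k n m v} : (n <= m)%N -> disc L o a k m v -> disc L o a k n v.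
Proof.
move=> /subnKC <-; apply: contra => /eqP h; rewrite !dynD.
apply/eqP; apply: le_anti; apply/andP; split.
  apply: le_trans (dyn_mono F_mono o_lin true L a k n _ (pm true) (confs_le_pm _ _) v) _.
  by rewrite h; apply: (dyn_mono F_mono o_lin false L a k n _ (pm false) (confs_le_pm _ _) v).
by do 2!apply: (dyn_le F_mono); move=> w; apply: le0x.
Qed.

(* A discrepancy at [v] that no discrepancy in [L'] accounts for is due to the
   boundary of [L'] alone, whatever the configuration [tau] started from. *)
Lemma disc_boundary {L L' a k T n v} tau eta : (L' `<=` L)%fset -> v \in L' ->
  disc L o a k (T + n) v -> ~~ has (fun u => disc L o a (k + T) n u) L' ->
  eta = dyn F true L o a (k + T) n tau ->
  dyn F true L' o a k T eta v != dyn F false L' o a k T eta v.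
Proof.
move=> LL vL' dv /hasPn nd etaE.
have lo : conf_le (dyn F false L o a (k + T) n (pm false)) eta.
  by rewrite etaE; apply: (dyn_le F_mono); case: (pm_le tau tau).
have hi : conf_le eta (dyn F true L o a (k + T) n (pm true)).
  by rewrite etaE; exact: (dyn_mono F_mono o_lin true L a (k + T) n _ _ (confs_le_pm _ _)).
have ag u : u \in L' -> dyn F true L o a (k + T) n (pm true) u = eta u /\
    dyn F false L o a (k + T) n (pm false) u = eta u.
  move=> /nd; rewrite negbK => /eqP h; split; apply: le_anti; rewrite ?lo ?hi ?andbT //=.
    by rewrite h lo.
  by rewrite -h hi.
move: dv; apply: contra => /eqP h.
(* For [T = 0] no sweep erases the values outside [L'] and [dyn_agree] does not apply; but then [v]
   itself is one of the excluded discrepancies. *)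
case: T => [|T] in etaE lo hi ag h nd *.
  by move: (nd v vL'); rewrite negbK addn0 add0n.
apply/eqP; apply: le_anti; apply/andP; split; rewrite !dynD.
  apply: le_trans (dyn_shrink F_mono o_lin true L L' a k T.+1 _ _ LL (confs_le_refl _ _) v) _.
  rewrite (dyn_agree true L' o a k T _ eta) => [|u /ag[]//]; rewrite h.
  rewrite (dyn_agree false L' o a k T eta (dyn F false L o a (k + T.+1) n (pm false))).
    exact: (dyn_shrink F_mono o_lin false L L' a k T.+1 _ _ LL (confs_le_refl _ _) v).
  by move=> u /ag[].
by do 2!apply: (dyn_le F_mono); move=> w; apply: le0x.
Qed.

Lemma disc_depends L k n v :
  depends_on [set p | (k < p.1 <= k + n)%N /\ p.2 \in L] (fun a => disc L o a k n v).
Proof. by move=> a a' aa; rewrite /disc !(dyn_local _ _ _ a a') // => j u h uL; apply: aa. Qed.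

Lemma has_depends (Z : eqType) (r : seq Z) I (Q : Z -> field -> bool) :
  (forall z, z \in r -> depends_on I (Q z)) -> depends_on I (fun a => has (fun z => Q z a) r).
Proof. by move=> h a a' aa; apply: eq_in_has => z zr; apply: h. Qed.

End Pointwise.

Lemma disc_le_phi {L0 L M E o v k n m} : noise_mean rho F L M E ->
  (forall j, linear_order (o j)) -> (vball e v n `<=` L0)%fset -> (L0 `<=` L)%fset ->
  (n <= m)%N -> (k + n <= M)%N -> Pr E (fun a => disc L0 o a k m v) <= phi n.
Proof.
move=> EP ol v0 L0L nm kM.
apply: le_trans (phi_bound n L M E o v k EP ol (fsubset_trans v0 L0L) kM).
by apply: (Pr_le EP) => a /(disc_time ol nm) /(disc_sub ol v0).
Qed.

Lemma phi_nonincr n m : (n <= m)%N -> phi m <= phi n.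
Proof.
move=> nm; apply: phi_le; first exact: phi_ge0.
move=> L M E o v k EP ol vL kM; apply: (disc_le_phi EP ol _ vL nm).
  exact: vball_mono.
by apply: leq_trans kM; rewrite leq_add2l.
Qed.

(** The event does not involve the start [tau] of [disc_boundary], so [tau] may be drawn from
    [rho L (pm true)], which brings in [boundary_influence]. *)
Lemma Pr_disc_boundary {L M E o v k T n r} : noise_mean rho F L M E ->
  (forall j, linear_order (o j)) -> (vball e v r `<=` L)%fset -> (k + (T + n) <= M)%N ->
  Pr E (fun a => disc L o a k (T + n) v &&
                 ~~ has (fun u => disc L o a (k + T) n u) (vball e v r)) <=
  K * expR (- (c * r%:R)).
Proof.
move=> EP ol vL kM; rewrite addnA in kM.
rewrite -mulrA; apply: le_trans (boundary_influence rho_spec rho_mono F_mono esym fin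
  mixing ol EP v r k T n vL kM).
rewrite -[leLHS]mul1r -(weight_sum rho_spec true L) mulr_suml.
apply: ler_sum => x _; apply: ler_wpM2l; first exact: weight_ge0.
apply: (Pr_le EP) => a /andP[dv nd].
exact: (disc_boundary ol (ext true L x) _ vL (vball_center esym fin v r) dv nd).
Qed.

Context {B : nat -> R} (ballB : forall v r, (#|` vball e v r|)%:R <= B r).

Context (C_ge0 : 0 <= C) (B_ge0 : forall r, 0 <= B r).

Lemma K_ge0 : 0 <= K.
Proof. by apply: mulr_ge0. Qed.

Lemma K_exp_ge0 r : 0 <= K * expR (- (c * r%:R)).
Proof. by apply: mulr_ge0; [exact: K_ge0|exact: expR_ge0]. Qed.

Lemma Pr_near_disc {L M E o v k n m r} : noise_mean rho F L M E ->
  (forall j, linear_order (o j)) -> (vball e v (r + n) `<=` L)%fset ->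
  (n <= m)%N -> (k + n <= M)%N ->
  Pr E (fun a => has (fun u => disc L o a k m u) (vball e v r)) <= B r * phi n.
Proof.
move=> EP ol vL nm kM.
apply: (@le_trans _ _ ((#|` vball e v r|)%:R * phi n)).
  apply: (Pr_has_le EP) => u /(in_vball esym fin) vu.
  apply: (disc_le_phi EP ol _ (fsubset_refl L)) => //.
  by apply: fsubset_trans vL; apply: (vball_sub esym fin vu).
by apply: ler_wpM2r; [exact: phi_ge0|exact: ballB].
Qed.

Lemma time_disjoint (P Q : set (nat * V)) k :
  (forall p, P p -> (p.1 <= k)%N) -> (forall p, Q p -> (k < p.1)%N) -> P `&` Q = set0.
Proof.
move=> h h'; apply/seteqP; split => // p [/h p1 /h'].
by rewrite ltnNge p1.
Qed.

(** The disagreement at [v] over the ages up to [T] and the older discrepancies use disjoint ages,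
    whence the product. The condition [r <= T] keeps the balls of radius [n] around these
    discrepancies inside the volume of radius [T + n]. *)
Lemma phi_rec T n r : (r <= T)%N ->
  phi (T + n) <= B r * phi T * phi n + K * expR (- (c * r%:R)).
Proof.
move=> rT.
apply: phi_le.
  by apply: addr_ge0; rewrite ?K_exp_ge0 // !mulr_ge0 ?phi_ge0.
move=> L M E o v k EP ol vL kM.
have {}EP := noise_mean_sub vL (leqnn M) EP.
set L' := vball e v (T + n) in EP vL *.
apply: (@le_trans _ _ (Pr E (fun a =>
   (disc L' o a k T v && has (fun u => disc L' o a (k + T) n u) (vball e v r)) ||
   (disc L' o a k (T + n) v && ~~ has (fun u => disc L' o a (k + T) n u) (vball e v r))))).
  apply: (Pr_le EP) => a dv; rewrite dv (disc_time ol (leq_addr n T) dv) /=.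
  exact: orbN.
apply: le_trans (Pr_or EP _ _) _; apply: lerD; last first.
  apply: (Pr_disc_boundary EP ol) => //; apply: vball_mono => //.
  exact: leq_trans rT (leq_addr _ _).
have kTM : (k + T <= M)%N by apply: leq_trans kM; rewrite leq_add2l leq_addr.
have knM : (k + T + n <= M)%N by rewrite -addnA.
rewrite (Pr_and EP _ _ _ _ (time_disjoint _ _ (k + T)%N _ _) (disc_depends L' k T v)
   (has_depends V (vball e v r) [set p | (k + T < p.1)%N] (fun u a => disc L' o a (k + T) n u) _)).
- rewrite [B r * _]mulrC -mulrA; apply: ler_pM; rewrite ?(Pr_ge0 EP) //.
    apply: (disc_le_phi EP ol _ (fsubset_refl _)) => //.
    by apply: vball_mono => //; apply: leq_addr.
  apply: (Pr_near_disc EP ol) => //.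
  by apply: vball_mono => //; rewrite leq_add2r.
- by move=> p /= [/andP[]].
- by move=> p.
- move=> u _; apply: depends_onW; last exact: disc_depends.
  by move=> p /= [/andP[]].
Qed.


Definition scale_error q :=
  K * expR (- (c * q%:R)) *+ 6.

Lemma all_iotaS (P : pred nat) J : all P (iota 0 J.+1) = all P (iota 0 J) && P J.
Proof. by rewrite -addn1 iotaD all_cat /= andbT add0n. Qed.

(* The discrepancies at time [T] lie at distance between [3q] and [6q] from
   [v], and some at time [T + 6q] lie at distance at most [6q].  Either the
   configuration near [v] is settled at one of the times [T + jq], and the
   influence of everything beyond distance [q] is exponentially small, or
   coalescence fails near [v] during six consecutive periods of length [q], and
   also, independently, near the discrepancy at time [T]. *)
Lemma Pr_scale {E o v k n q T L} :
  L = vball e v (T + 6 * q + n) -> noise_mean rho F L (k + (T + 6 * q + n)) E ->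
  (forall j, linear_order (o j)) -> (0 < q)%N -> (q <= T + n)%N ->
  Pr E (fun a => [&& disc L o a k (T + 6 * q + n) v,
    ~~ has (fun u => disc L o a (k + T) (6 * q + n) u) (vball e v (3 * q)),
    has (fun u => disc L o a (k + T) (6 * q + n) u) (vball e v (6 * q)) &
    has (fun u => disc L o a (k + (T + 6 * q)) n u) (vball e v (6 * q))]) <=
  (scale_error q + phi T * (B (6 * q) * phi q * (B q * phi q) ^+ 6)) * (B (6 * q) * phi n).
Proof.
move=> LE EP ol q0 qT.
pose D T' n' u a := disc L o a (k + T') n' u.
set N' := (T + 6 * q)%N in EP LE *.
pose W'' a := has (fun u => D N' n u a) (vball e v (6 * q)).
pose G j a := disc L o a k N' v &&
  ~~ has (fun u => D (T + j * q)%N (N' - (T + j * q))%N u a) (vball e v q).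
(* [U j] and [W] are localized in balls of radius [q], so [U j] depends on the vertices within
   [2 * q] of [v] and [W] on those beyond. The ages of [W] are those of [U 0]: these two are
   independent for spatial reasons only. *)
pose U j a := has (fun u => disc (vball e u q) o a (k + (T + j * q)) q u) (vball e v q).
pose W a := has (fun w => disc (vball e w q) o a (k + T) q w)
  [seq w <- vball e v (6 * q) | w \notin vball e v (3 * q)].
have ball6 w : w \in vball e v (6 * q) -> (vball e w q `<=` L)%fset.
  move=> /(in_vball esym fin) vw; rewrite LE; apply: (vball_sub esym fin vw); rewrite /N'; lia.
have ball1 u : u \in vball e v q -> (vball e u q `<=` vball e v (2 * q))%fset.
  by move=> /(in_vball esym fin) vu; apply: (vball_sub esym fin vu); lia.
have ball2L : (vball e v (2 * q) `<=` L)%fset.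
  by rewrite LE; apply: vball_mono => //; rewrite /N'; lia.
(* If no [G j] occurs, each of the ages [T + j * q] shows a discrepancy near [v], which gives [U j]
   for all six periods. *)
apply: (@le_trans _ _ (Pr E (fun a =>
    (has (fun j => G j a) (iota 0 6) ||
     (disc L o a k T v && (W a && all (fun j => U j a) (iota 0 6)))) && W'' a))).
  apply: (Pr_le EP) => a /and4P[Dv clear near near'].
  have DN' : disc L o a k N' v by apply: (disc_time ol _ Dv); apply: leq_addr.
  rewrite [W'' a]near' andbT.
  have [//|/hasPn noG] := boolP (has _ _).
  rewrite orFb (_ : disc L o a k T v) ?andTb; last first.
    by apply: (disc_time ol _ Dv); rewrite /N'; lia.
  apply/andP; split.
    case/hasP: near => w wv Dw; apply/hasP; exists w.
      rewrite mem_filter wv andbT; apply: contra clear => w3.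
      by apply/hasP; exists w.
    by apply: (disc_sub ol (ball6 w wv)); apply: (disc_time ol _ Dw); lia.
  apply/allP => j jJ; move/noG: (jJ); rewrite negb_and DN' orFb negbK.
  case/hasP => u uv Du; apply/hasP; exists u => //.
  apply: (disc_sub ol (fsubset_trans (ball1 u uv) ball2L)).
  by apply: (disc_time ol _ Du); move: jJ; rewrite mem_iota /N'; nia.
have UD j : depends_on [set p | (k + (T + j * q) < p.1 <= k + (T + j.+1 * q))%N /\
     p.2 \in vball e v (2 * q)] (U j).
  apply: has_depends => u uv; apply: depends_onW; last exact: disc_depends.
  move=> [i w] /= [/andP[i1 i2] wu]; split; first by rewrite i1 /=; lia.
  exact: (fsubsetP (ball1 u uv)).
have allD J : depends_on [set p | (p.1 <= k + (T + J * q))%N /\ p.2 \in vball e v (2 * q)]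
    (fun a => all (fun j => U j a) (iota 0 J)).
  move=> a a' aa; apply: eq_in_all => j; rewrite mem_iota => jJ.
  apply: UD => i w /= [/andP[i1 i2] wv]; apply: aa; split => //=.
  by apply: leq_trans i2 _; nia.
have W''D : depends_on [set p | (k + N' < p.1)%N] W''.
  apply: has_depends => u uv; apply: depends_onW; last exact: disc_depends.
  by move=> [i w] /= [/andP[]].
have DD T' n' u : (T' + n' <= N')%N -> depends_on [set p | (p.1 <= k + N')%N] (D T' n' u).
  move=> h; apply: depends_onW; last exact: disc_depends.
  by move=> [i w] /= [/andP[_ h'] _]; lia.
have WD : depends_on [set p | (k + T < p.1 <= k + (T + q))%N /\ p.2 \notin vball e v (2 * q)] W.
  apply: has_depends => w; rewrite mem_filter => /andP[w3 w6].
  apply: depends_onW; last exact: disc_depends.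
  move=> [i x] /= [i1 xw]; split; first by rewrite addnA.
  apply: contra w3 => /(in_vball esym fin) vx; apply/(in_vball esym fin).
  move/(in_vball esym fin): xw => /(dist_le_sym esym) xw.
  by apply: dist_le_mono (dist_le_trans vx xw); lia.
have Upr j : (j < 6)%N -> Pr E (U j) <= B q * phi q.
  move=> j6; apply: (@le_trans _ _ ((#|` vball e v q|)%:R * phi q)).
    apply: (Pr_has_le EP) => u uv; apply: (disc_le_phi EP ol _ _ (leqnn q)) => //.
      exact: fsubset_trans (ball1 u uv) ball2L.
    by rewrite /N'; nia.
  by apply: ler_wpM2r; [exact: phi_ge0|exact: ballB].
have allpr J : (J <= 6)%N -> Pr E (fun a => all (fun j => U j a) (iota 0 J)) <= (B q * phi q) ^+ J.
  elim: J => [|J IH] J6; first by rewrite expr0; apply: (Pr_le1 EP).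
  have -> : Pr E (fun a => all (fun j => U j a) (iota 0 J.+1)) =
      Pr E (fun a => all (fun j => U j a) (iota 0 J) && U J a).
    by apply: (mean_eq EP) => a; rewrite all_iotaS.
  rewrite (Pr_and EP _ _ _ _ (time_disjoint _ _ (k + (T + J * q))%N _ _) (allD J) (UD J)).
  - by rewrite exprSr; apply: ler_pM; rewrite ?(Pr_ge0 EP) ?IH ?Upr //; apply: ltnW.
  - by move=> p /= [].
  - by move=> p /= [/andP[]].
have Wpr : Pr E W <= B (6 * q) * phi q.
  apply: (@le_trans _ _ ((#|` vball e v (6 * q)|)%:R * phi q)).
    apply: (@le_trans _ _
      ((size [seq w <- vball e v (6 * q) | w \notin vball e v (3 * q)])%:R * phi q)).
      apply: (Pr_has_le EP) => w; rewrite mem_filter => /andP[_ w6].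
      by apply: (disc_le_phi EP ol _ _ (leqnn q)) => //; [exact: ball6|rewrite /N'; lia].
    by apply: ler_wpM2r; [exact: phi_ge0|rewrite ler_nat size_filter count_size].
  by apply: ler_wpM2r; [exact: phi_ge0|exact: ballB].
have Gpr j : (j < 6)%N -> Pr E (G j) <= K * expR (- (c * q%:R)).
  move=> j6; have e1 : N' = (T + j * q + (N' - (T + j * q)))%N by rewrite /N'; nia.
  rewrite /G /D {1}e1; apply: (Pr_disc_boundary EP ol).
    by rewrite LE; apply: vball_mono => //; rewrite /N'; lia.
  by rewrite -e1; lia.
pose Q1 a := has (fun j => G j a) (iota 0 6) ||
     (disc L o a k T v && (W a && all (fun j => U j a) (iota 0 6))).
have Q1D : depends_on [set p | (p.1 <= k + N')%N] Q1.
  have h1 : depends_on [set p | (p.1 <= k + N')%N] (fun a => has (fun j => G j a) (iota 0 6)).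
    apply: has_depends => j; rewrite mem_iota => j6.
    move=> a a' aa; rewrite /G; congr (_ && ~~ _).
      by apply: (disc_depends L k N' v) => i w /= [/andP[_ h] _]; apply: aa.
    by apply: eq_has => u; apply: DD aa; rewrite /N'; nia.
  move=> a a' aa; rewrite /Q1 (h1 a a' aa); congr (_ || _); congr [&& _, _ & _].
  - by apply: (disc_depends L k T v) => i w /= [/andP[_ h] _]; apply: aa => /=; rewrite /N'; lia.
  - by apply: WD => i w /= [/andP[_ h] _]; apply: aa => /=; rewrite /N'; lia.
  - by apply: allD => i w /= [h _]; apply: aa => /=; rewrite /N'; lia.
rewrite (Pr_and EP _ _ Q1 W'' (time_disjoint _ _ (k + N')%N _ _) Q1D W''D) //.
apply: ler_pM; rewrite ?(Pr_ge0 EP) //; last first.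
  apply: (Pr_near_disc EP ol) => //; last by rewrite addnA.
  by rewrite LE; apply: vball_mono => //; rewrite /N'; lia.
apply: le_trans (Pr_or EP _ _) _; apply: lerD.
  rewrite /scale_error -mulr_natl; apply: (Pr_has_le EP) => j; rewrite mem_iota => j6.
  exact: Gpr.
have WUD : depends_on [set p | (k + T < p.1)%N] (fun a => W a && all (fun j => U j a) (iota 0 6)).
  move=> a a' aa; congr (_ && _); first by apply: WD => i w /= [/andP[h _] _]; apply: aa.
  apply: eq_in_all => j _; apply: UD => i w /= [/andP[h _] _]; apply: aa => /=; lia.
rewrite (Pr_and EP _ _ _ _ (time_disjoint _ _ (k + T)%N _ _) (disc_depends L k T v) WUD);
  [|by move=> p /= [/andP[]]|by []].
rewrite (Pr_and EP _ _ _ _ _ WD (allD 6%N)); last first.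
  by apply/seteqP; split => // p [/= [_ h] [_]]; rewrite (negbTE h).
apply: ler_pM; rewrite ?mulr_ge0 ?(Pr_ge0 EP) //.
  apply: (disc_le_phi EP ol _ (fsubset_refl _)) => //; last by rewrite /N'; lia.
  by rewrite LE; apply: vball_mono => //; rewrite /N'; lia.
by apply: ler_pM; rewrite ?(Pr_ge0 EP) ?Wpr ?allpr.
Qed.

(** The first term covers a discrepancy within [3 * q0] at age [6 * q0]. Otherwise take the largest
    scale [q] from [q0] to [2 * Q] for which some age [T] in the window of length [6 * q] after
    [6 * q0] shows no discrepancy within [3 * q]. If [q <= Q], the scale [2 * q] fails, so all ages
    in the window of length [12 * q] show one within [6 * q], in particular [T] and [T + 6 * q]:
    this is the event of [Pr_scale]. If [q > Q], the boundary at distance [3 * Q] is responsible. *)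
Lemma phi_multiscale q0 Q N : (0 < q0)%N -> (q0 <= Q)%N -> (6 * q0 + 12 * Q <= N)%N ->
  phi N <= phi (6 * q0) * (B (3 * q0) * phi (N - 6 * q0))
   + \sum_(q <- iota q0 (Q.+1 - q0)) \sum_(T <- iota (6 * q0) (6 * q).+1)
       (scale_error q + phi T * (B (6 * q) * phi q * (B q * phi q) ^+ 6)) *
       (B (6 * q) * phi (N - T - 6 * q))
   + (12 * Q).+1%:R * (K * expR (- (c * (3 * Q)%N%:R))).
Proof.
move=> q0_gt0 q0Q tQN; set t := (6 * q0)%N in tQN *.
have X0 q T : 0 <= (scale_error q + phi T * (B (6 * q) * phi q * (B q * phi q) ^+ 6)) *
       (B (6 * q) * phi (N - T - 6 * q)).
  rewrite /scale_error; apply: mulr_ge0; last by rewrite mulr_ge0 ?phi_ge0.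
  by rewrite addr_ge0 ?mulrn_wge0 ?K_exp_ge0 // !mulr_ge0 ?exprn_ge0 ?mulr_ge0 ?phi_ge0.
apply: phi_le.
  rewrite !addr_ge0 // ?mulr_ge0 ?phi_ge0 ?mulrn_wge0 ?K_ge0 ?expR_ge0 //.
  by apply: sumr_ge0 => q _; apply: sumr_ge0.
move=> L0 M E o v k EP0 ol vL kM.
set L := vball e v N in vL *.
have EP : noise_mean rho F L (k + N) E := noise_mean_sub vL kM EP0.
pose D T u a := disc L o a (k + T) (N - T) u.
pose near T r a := has (fun u => D T u a) (vball e v r).
pose event1 a := disc L o a k t v && near t (3 * q0)%N a.
pose event2 q T a := [&& disc L o a k N v, ~~ near T (3 * q)%N a,
  near T (6 * q)%N a & near (T + 6 * q)%N (6 * q)%N a].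
pose event3 T a := disc L o a k N v && ~~ near T (3 * Q)%N a.
have near_mono T r r' a : (r <= r')%N -> near T r a -> near T r' a.
  move=> rr /hasP[u ur Du]; apply/hasP; exists u => //.
  exact: (fsubsetP (vball_mono esym fin rr)).
apply: (@le_trans _ _ (Pr E (fun a => (event1 a ||
    has (fun q => has (fun T => event2 q T a) (iota t (6 * q).+1)) (iota q0 (Q.+1 - q0))) ||
    has (fun T => event3 T a) (iota t (12 * Q).+1)))).
  apply: (Pr_le EP) => a Dv.
  have [//|ne1] := boolP (event1 a); rewrite orFb.
  pose P q := (q0 <= q <= 2 * Q)%N && has (fun T => ~~ near T (3 * q)%N a) (iota t (6 * q).+1).
  have P0 : P q0.
    rewrite /P leqnn (leq_trans q0Q) /=; last by lia.
    apply/orP; left; move: ne1; rewrite /event1 (disc_time ol _ Dv) //; lia.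
  have Pub q : P q -> (q <= 2 * Q)%N by case/andP => /andP[].
  case: (ex_maxnP (ex_intro P q0 P0) Pub) => q /andP[/andP[q0q qQ] /hasP[T Tt far]] qmax.
  move: Tt; rewrite mem_iota => Tt.
  have [qQ'|Qq] := leqP q Q; apply/orP; [left | right].
    apply/hasP; exists q; first by rewrite mem_iota; lia.
    have nearq T' : (t <= T' <= t + 12 * q)%N -> near T' (6 * q)%N a.
      move=> T'b; apply: contraT => farT'.
      have : P (2 * q)%N.
        apply/andP; split; first by lia.
        apply/hasP; exists T'; first by rewrite mem_iota; lia.
        by rewrite (_ : (3 * (2 * q))%N = (6 * q)%N) //; lia.
      by move/qmax; rewrite /t in tQN *; lia.
    apply/hasP; exists T; first by rewrite mem_iota.
    by rewrite /event2 Dv far !nearq //; lia.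
  apply/hasP; exists T; first by rewrite mem_iota; lia.
  by rewrite /event3 Dv; apply: contra far; apply: near_mono; lia.
apply: le_trans (Pr_or EP _ _) _; apply: lerD; last first.
  rewrite -[(12 * Q).+1 in leRHS](size_iota t); apply: (Pr_has_le EP) => T.
  rewrite mem_iota => Tt; rewrite /event3.
  have e1 : N = (T + (N - T))%N by lia.
  rewrite {1}e1; apply: (Pr_disc_boundary EP ol); first by apply: vball_mono => //; lia.
  by rewrite -e1.
apply: le_trans (Pr_or EP _ _) _; apply: lerD.
  rewrite /event1 (Pr_and EP _ _ _ _ (time_disjoint _ _ (k + t)%N _ _) (disc_depends L k t v)
   (has_depends V (vball e v (3 * q0)) [set p | (k + t < p.1)%N] (fun u a => D t u a) _)).
  - apply: ler_pM; rewrite ?(Pr_ge0 EP) //.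
      apply: (disc_le_phi EP ol _ (fsubset_refl _)) => //; last by lia.
      by apply: vball_mono => //; lia.
    apply: (Pr_near_disc EP ol) => //; last by lia.
    by apply: vball_mono => //; rewrite /t; lia.
  - by move=> p /= [/andP[]].
  - by move=> p.
  - move=> u _; apply: depends_onW; last exact: disc_depends.
    by move=> p /= [/andP[]].
apply: le_trans (Pr_has EP _ _ _) _.
rewrite big_seq [leRHS]big_seq; apply: ler_sum => q; rewrite mem_iota => qb.
apply: le_trans (Pr_has EP _ _ _) _.
rewrite big_seq [leRHS]big_seq; apply: ler_sum => T; rewrite mem_iota => Tb.
set n := (N - T - 6 * q)%N.
have e1 : (T + 6 * q + n)%N = N by lia.
have e2 : (6 * q + n)%N = (N - T)%N by lia.
have e3 : (N - (T + 6 * q))%N = n by lia.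
have EPn : noise_mean rho F L (k + (T + 6 * q + n)) E by rewrite e1.
have LE : L = vball e v (T + 6 * q + n) by rewrite e1.
have q_gt0 : (0 < q)%N by lia.
have qT : (q <= T + n)%N by lia.
apply: le_trans (Pr_scale (v := v) LE EPn ol q_gt0 qT).
by apply: (Pr_le EP) => a; rewrite /event2 /near /D e1 e2 e3.
Qed.

End Discrepancy.

(** * Decay of solutions of the recursions *)

Section Asymptotics.
Context {R : realType}.

Lemma expR_ge_cube (x : R) : 0 <= x -> (x / 3) ^+ 3 <= expR x.
Proof.
move=> x0; have -> : expR x = expR (x / 3) ^+ 3.
  by rewrite -expRM_natl; congr expR; field.
rewrite ler_pXn2r ?nnegrE ?expR_ge0 ?divr_ge0 //.
by apply: le_trans (expR_ge1Dx _); lra.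
Qed.

Lemma sqr_le_expR (A eps : R) : 0 < eps ->
  exists n0, forall n, (n0 <= n)%N -> A * n%:R ^+ 2 <= expR (eps * n%:R).
Proof.
move=> e0; have e3 : 0 < (eps / 3) ^+ 3 by rewrite exprn_gt0 // divr_gt0.
exists (Num.truncn (A / (eps / 3) ^+ 3)).+1 => n nn.
apply: le_trans (expR_ge_cube _ _); last by rewrite mulr_ge0 // ltW.
have -> : (eps * n%:R / 3) ^+ 3 = (eps / 3) ^+ 3 * n%:R * n%:R ^+ 2 :> R by field.
apply: ler_wpM2r; first by rewrite exprn_ge0.
rewrite mulrC -ler_pdivrMr //.
apply: ltW; apply: lt_le_trans (truncnS_gt _) _.
by rewrite ler_nat.
Qed.

Lemma ln_le_eps (eps : R) : 0 < eps ->
  exists n0, forall n, (n0 <= n)%N -> ln n%:R <= eps * n%:R.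
Proof.
move=> e0; have [n0 h] := sqr_le_expR 1 _ e0.
exists n0.+1 => -[//|n] nn; rewrite -[leRHS]expRK ler_ln ?posrE ?expR_gt0 //.
apply: le_trans (h _ (ltnW nn)); rewrite mul1r expr2 ler_peMr // ler1n //.
Qed.

Lemma le_nat_exists (x : R) : exists n0, forall n, (n0 <= n)%N -> x <= n%:R.
Proof.
exists (Num.truncn x).+1 => n nn; apply: ltW; apply: lt_le_trans (truncnS_gt _) _.
by rewrite ler_nat.
Qed.

(** Telescoping against [2 / q], whose successive differences dominate [1 / q^2] for [q >= 1]. *)
Lemma sum_inv_sqr q0 m : (0 < q0)%N ->
  \sum_(q <- iota q0 m) (q%:R ^+ 2)^-1 <= 2 / q0%:R :> R.
Proof.
move=> q0_gt0.
suff h : \sum_(q <- iota q0 m) (q%:R ^+ 2)^-1 <= 2 / q0%:R - 2 / (q0 + m)%:R :> R.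
  by apply: le_trans h _; rewrite gerBl divr_ge0.
elim: m => [|m IH]; first by rewrite big_nil addn0 subrr.
rewrite -addn1 iotaD big_cat /= big_seq1.
have p0 : 0 < (q0 + m)%:R :> R by rewrite ltr0n addn_gt0 q0_gt0.
have p1 : 1 <= (q0 + m)%:R :> R by rewrite ler1n addn_gt0 q0_gt0.
apply: le_trans (lerD IH (lexx _)) _.
rewrite addn1 addnS -[(q0 + m).+1%:R]natr1; move: ((q0 + m)%:R) p0 p1 => x x0 x1.
have x10 : 0 < x + 1 by lra.
rewrite -subr_ge0.
have -> : 2 / q0%:R - 2 / (x + 1) - (2 / q0%:R - 2 / x + (x ^+ 2)^-1) =
    (x - 1) / (x ^+ 2 * (x + 1)) :> R.
  have q0' : q0%:R != 0 :> R by rewrite pnatr_eq0 -lt0n.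
  by field; rewrite q0' !gt_eqF.
by rewrite divr_ge0 ?mulr_ge0 ?sqr_ge0 //; lra.
Qed.

Context {c K : R} (c_gt0 : 0 < c) (K_ge0 : 0 <= K).
Context {phi B : nat -> R}.
Context (phi_ge0 : forall n, 0 <= phi n) (phi_le1 : forall n, phi n <= 1).
Context (phi_mono : forall n m, (n <= m)%N -> phi m <= phi n).
Context (phi_cvg0 : forall x : R, 0 < x -> exists n, phi n <= x).
Context (B_ge0 : forall r, 0 <= B r).
Context (rec : forall T n r, (r <= T)%N ->
  phi (T + n) <= B r * phi T * phi n + K * expR (- (c * r%:R))).

Lemma phi_small (x : R) n0 : 0 < x -> exists2 n, (n0 <= n)%N & phi n <= x.
Proof.
move=> /phi_cvg0[n h]; exists (maxn n0 n); first exact: leq_maxl.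
by apply: le_trans h; apply: phi_mono; exact: leq_maxr.
Qed.

Lemma expRN1_half : expR (- 1) <= 1 / 2 :> R.
Proof.
rewrite expRN div1r lef_pV2 ?posrE ?expR_gt0 //.
by apply: le_trans (expR_ge1Dx _); lra.
Qed.

(** Each term of the recursion gets half of the target: the [1] in the first condition on exponents
    provides [e^{-1} <= 1/2], the [2 * K] in the second provides [K e^{-2K} <= 1/2]. *)
Lemma doubling n L a a' b : (L <= n)%N -> phi n <= expR (- a) -> B L <= expR b ->
  b + 1 + a' <= 2 * a -> a' + 2 * K <= c * L%:R -> phi (n + n) <= expR (- a').
Proof.
move=> Ln ha hB h1 h2; apply: le_trans (rec _ _ _ Ln) _.
have -> : expR (- a') = expR (- a') / 2 + expR (- a') / 2 by field.
apply: lerD.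
  rewrite -mulrA; apply: (@le_trans _ _ (expR b * (expR (- a) * expR (- a)))).
    by rewrite ler_pM ?mulr_ge0 ?ler_pM.
  rewrite -!expRD; apply: (@le_trans _ _ (expR (- a' + - 1))); first by rewrite ler_expR; lra.
  by rewrite expRD ler_wpM2l ?expR_ge0 //; have := expRN1_half; lra.
apply: (@le_trans _ _ (K * expR (- (a' + 2 * K)))).
  by rewrite ler_wpM2l // ler_expR; lra.
rewrite opprD expRD mulrCA ler_wpM2l ?expR_ge0 //.
rewrite expRN -div1r mulrA mulr1 ler_pdivrMr ?expR_gt0 //.
by have := expR_ge1Dx (2 * K); lra.
Qed.

Lemma dyadic n0 n : (0 < n0)%N -> (n0 <= n)%N ->
  exists k, (2 ^ k * n0 <= n)%N /\ (n < 2 ^ k.+1 * n0)%N.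
Proof.
move=> n0_gt0 n0n; pose P k := (2 ^ k * n0 <= n)%N.
have P0 : P 0%N by rewrite /P mul1n.
have Pub k : P k -> (k <= n)%N.
  by move=> h; apply: leq_trans h; apply: leq_trans (leq_pmulr _ n0_gt0); apply/ltnW/ltn_expl.
case: (ex_maxnP (ex_intro P 0%N P0) Pub) => k Pk kmax.
by exists k; split => //; rewrite ltnNge; apply: contraT; rewrite negbK => /kmax; rewrite ltnn.
Qed.

Lemma ln2_gt0 : 0 < ln 2 :> R.
Proof. by rewrite ln_gt0 // ltr1n. Qed.

Lemma expR_ln2 k : expR (k%:R * ln 2) = 2 ^+ k :> R.
Proof. by rewrite expRM_natl lnK // posrE. Qed.

Lemma powR_expR_ln (x y : R) : 0 < x -> x `^ y = expR (y * ln x).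
Proof. by move=> x0; rewrite /powR gt_eqF. Qed.

Lemma dyadic_ln n0 n k : (0 < n0)%N -> (2 ^ k * n0 <= n)%N -> (n < 2 ^ k.+1 * n0)%N ->
  ln n%:R <= k.+1%:R * ln 2 + ln n0%:R :> R.
Proof.
move=> n0_gt0 h1 h2.
have n_gt0 : (0 < n)%N by apply: leq_trans h1; rewrite muln_gt0 expn_gt0.
rewrite -ler_expR expRD expR_ln2 !lnK ?posrE ?ltr0n //.
by rewrite -natrX -natrM ler_nat ltnW.
Qed.

(** With [B L <= e^{c del L / 2}] and [c * L] close to [g * a], a doubling multiplies the exponent
    [a] by [g = 2 (1 - del) = 2^{1 - eps/2}]; the missing [2 del a] pays for the ball and the
    constants. The exponent is then of order [n^{1 - eps/2}], and the other half of [eps] absorbs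
    the prefactor. *)
Lemma stretched (eps : R) : 0 < eps < 1 ->
  (forall x : R, 0 < x -> exists r0, forall r, (r0 <= r)%N -> B r <= expR (x * r%:R)) ->
  exists n0, forall n, (n0 <= n)%N -> phi n <= expR (- (n%:R `^ (1 - eps))).
Proof.
move=> /andP[e0 e1] hB; have l2 := ln2_gt0; have c0 := c_gt0; have K0 := K_ge0.
pose s := 1 - eps / 2; pose g := expR (s * ln 2).
pose del := 1 - expR (- (eps / 2) * ln 2).
have gE : g = 2 * (1 - del).
  rewrite /g /s /del mulrDl mul1r expRD lnK ?posrE //; ring.
have del0 : 0 < del by rewrite subr_gt0 expR_lt1 mulNr oppr_lt0 mulr_gt0 // divr_gt0.
have del1 : del <= 1 / 2.
  suff : 1 / 2 <= expR (- (eps / 2) * ln 2) by rewrite /del; lra.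
  have -> : 1 / 2 = expR (- ln 2) :> R by rewrite expRN lnK ?posrE // div1r.
  rewrite ler_expR mulNr lerN2; apply: (@le_trans _ _ (1 * ln 2)); last by rewrite mul1r.
  by rewrite ler_wpM2r //; [exact: ltW|lra].
have g1 : 1 <= g by lra.
have kap0 : 0 < c * del / 2 by rewrite divr_gt0 ?mulr_gt0.
have [r0 hr0] := hB _ kap0.
(* For [a] above this threshold the constants on the left of [qE] are at most [del * a]. *)
pose q := (del * K + c * del / 2 + 1) / del.
have q_gt0 : 0 < q.
  by rewrite divr_gt0 // addr_gt0 // ltr_wpDl // mulr_ge0 // ltW.
have qE : del * K + c * del / 2 + 1 = q * del by rewrite /q divfK // gt_eqF.
clearbody q.
(* Large enough for the threshold [q], for [L >= r0] and for [c * L <= 4 * a]. *)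
pose a0 := q + c * r0%:R + K + c.
have cr0 : 0 <= c * r0%:R by rewrite mulr_ge0 // ltW.
have a0_1 : q <= a0 by rewrite /a0; lra.
have a0_2 : c * r0%:R <= a0 by rewrite /a0; lra.
have a0_3 : K + c <= a0 by rewrite /a0; lra.
have a0_gt0 : 0 < a0 by lra.
have step a n : a0 <= a -> 4 * a / c <= n%:R -> phi n <= expR (- a) ->
    phi (n + n) <= expR (- (g * a)).
  move=> aa an ph; pose x := (g * a + 2 * K) / c.
  have a_gt0 : 0 < a by lra.
  have ga : g * a = 2 * a - 2 * (del * a) by rewrite gE; ring.
  have da : 0 < del * a by rewrite mulr_gt0.
  have da2 : del * a <= a / 2.
    by apply: (@le_trans _ _ (1 / 2 * a)); [rewrite ler_wpM2r // ltW|lra].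
  have x0 : 0 <= x by apply: divr_ge0; lra.
  have /andP[Lx xL] := truncn_itv x0.
  have xc : c * x = g * a + 2 * K by rewrite /x; field; rewrite gt_eqF.
  have Lx1 : (Num.truncn x).+1%:R <= x + 1 by rewrite -natr1 lerD2r.
  have cLx : c * x <= c * (Num.truncn x).+1%:R by rewrite ler_wpM2l // ltW.
  have cL1 : c * (Num.truncn x).+1%:R <= g * a + 2 * K + c.
    by rewrite -xc -[X in _ + X]mulr1 -mulrDr ler_wpM2l // ltW.
  apply: (doubling n (Num.truncn x).+1 a (g * a) (c * del / 2 * (Num.truncn x).+1%:R)) => //.
  - rewrite -(ler_nat R); apply: le_trans an; rewrite ler_pdivlMr // mulrC.
    by lra.
  - apply: hr0; rewrite -(ler_nat R) -(ler_pM2l c_gt0); lra.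
  - have : del * (c * (Num.truncn x).+1%:R) <= del * (2 * a + 2 * K + c).
      by rewrite ler_wpM2l ?ltW //; lra.
    have : del * K + c * del / 2 + 1 <= del * a.
      by rewrite qE mulrC; apply: ler_wpM2l; [exact: ltW|lra].
    rewrite ga; lra.
  - by lra.
have [m0 hm0] := le_nat_exists (4 * a0 / c).
have [n0 n0m hn0] := phi_small (expR (- a0)) m0.+1 (expR_gt0 _).
have n0_gt0 : (0 < n0)%N by apply: leq_trans n0m.
have iter k : phi (2 ^ k * n0) <= expR (- (g ^+ k * a0)) /\
    4 * (g ^+ k * a0) / c <= (2 ^ k * n0)%:R.
  elim: k => [|k [IH1 IH2]]; first by rewrite expr0 mul1r mul1n hn0 hm0 // ltnW.
  rewrite exprS -mulrA expnS -mulnA mul2n -addnn; split.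
    by apply: step => //; apply: ler_peMl; [exact: ltW|exact: exprn_ege1].
  rewrite natrD; apply: (@le_trans _ _ (2 * (4 * (g ^+ k * a0) / c))); last by lra.
  rewrite (_ : 4 * (g * (g ^+ k * a0)) / c = g * (4 * (g ^+ k * a0) / c)).
    2: by field; rewrite gt_eqF.
  rewrite ler_wpM2r //; last by rewrite gE; lra.
  by rewrite !mulr_ge0 ?invr_ge0 ?exprn_ge0 // ltW // (lt_le_trans _ g1).
(* The constants lost when [k] is compared with [ln n / ln 2]; beyond [n1] they are at most
   [eps / 2 * ln n]. *)
pose D := s * (ln 2 + ln n0%:R) - ln a0.
have [n1 hn1] := le_nat_exists (expR (2 * D / eps)).
exists (maxn n0 n1) => n; rewrite geq_max => /andP[n0n n1n].
have [k [k1 k2]] := dyadic n0 n n0_gt0 n0n.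
have n_gt0 : (0 < n)%N by apply: leq_trans n0n.
apply: le_trans (phi_mono _ _ k1) _; apply: le_trans (iter k).1 _.
rewrite ler_expR lerN2 powR_expR_ln ?ltr0n //.
have -> : g ^+ k * a0 = expR (k%:R * (s * ln 2) + ln a0).
  by rewrite expRD lnK ?posrE // /g expRM_natl.
rewrite ler_expR.
have lnn := dyadic_ln _ _ _ n0_gt0 k1 k2.
have lnD : 2 * D / eps <= ln n%:R.
  by rewrite -ler_expR lnK ?posrE ?ltr0n // hn1.
have s0 : 0 <= s by rewrite /s; lra.
have : s * ln n%:R <= s * (k.+1%:R * ln 2 + ln n0%:R) by rewrite ler_wpM2l.
have : D <= eps / 2 * ln n%:R.
  apply: le_trans (_ : D <= eps / 2 * (2 * D / eps)) _.
    by rewrite le_eqVlt; apply/orP; left; apply/eqP; field; rewrite gt_eqF.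
  by rewrite ler_wpM2l // divr_ge0 // ltW.
have -> : (1 - eps) * ln n%:R = s * ln n%:R - eps / 2 * ln n%:R by rewrite /s; field.
rewrite /D -natr1.
lra.
Qed.

(** Diagonal argument: [kk n] is the largest [k <= n] for which the bound with loss [1 / (k + 2)]
    holds from [n] on. It tends to infinity, and its choice contains the bound at [n]. *)
Lemma vanishing_exponent :
  (forall eps : R, 0 < eps < 1 -> exists n0, forall n, (n0 <= n)%N ->
    phi n <= expR (- (n%:R `^ (1 - eps)))) ->
  exists2 eps : R^nat, eps n @[n --> \oo] --> 0 &
    \forall n \near \oo, phi n <= expR (- (n%:R `^ (1 - eps n))).
Proof.
move=> h; pose ep k : R := (k.+2%:R)^-1.
have ep01 k : 0 < ep k < 1.
  by rewrite /ep invr_gt0 ltr0n /= invf_lt1 ?ltr0n // ltr1n.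
pose Q k n := forall m, (n <= m)%N -> phi m <= expR (- (m%:R `^ (1 - ep k))).
pose kk n := \max_(k < n.+1 | `[< Q k n >]) (k : nat).
have kkQ n : Q 0%N n -> Q (kk n) n.
  move=> h0; have : (0 < #|[pred k : 'I_n.+1 | `[< Q k n >]]|)%N.
    by apply/card_gt0P; exists ord0; rewrite inE; apply/asboolP; exact: asboolT.
  case/(eq_bigmax_cond (fun k : 'I_n.+1 => k : nat)) => k Qk.
  by rewrite /kk => ->; exact: asboolW Qk.
exists (fun n => ep (kk n)).
  apply/cvgrPdist_le => /= x x0.
  have [k0 hk0] := le_nat_exists x^-1.
  have [n0 hn0] := h _ (ep01 k0).
  near=> n.
  rewrite sub0r normrN gtr0_norm; last by case/andP: (ep01 (kk n)).
  have kkn : (k0 <= kk n)%N.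
    have k0n : (k0 < n.+1)%N by rewrite ltnS; near: n; exact: nbhs_infty_ge.
    have Qn : `[< Q k0 n >].
      apply: asboolT => m nm; apply: hn0; apply: leq_trans nm.
      by near: n; exact: nbhs_infty_ge.
    exact: (@leq_bigmax_cond _ (fun k : 'I_n.+1 => `[< Q k n >])
      (fun k => k : nat) (Ordinal k0n) Qn).
  rewrite /ep invf_ple ?posrE ?ltr0n //.
  by apply: hk0; apply: leq_trans kkn _; rewrite ltnW.
have [n0 hn0] := h _ (ep01 0%N).
near=> n; apply: (kkQ n _ n (leqnn n)) => m nm; apply: hn0; apply: leq_trans nm.
by near: n; exact: nbhs_infty_ge.
Unshelve. all: by end_near.
Qed.

Lemma ln_succ_sub k : (0 < k)%N -> (k.+1%:R)^-1 <= ln k.+1%:R - ln k%:R :> R.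
Proof.
move=> k0; have kp : 0 < k%:R :> R by rewrite ltr0n.
rewrite -ln_div ?posrE // -lerN2 -lnV ?posrE ?divr_gt0 // invf_div.
have -> : k%:R / k.+1%:R = 1 + - (k.+1%:R)^-1 :> R.
  by rewrite -natr1; field; rewrite natr1 pnatr_eq0.
apply: le_ln1Dx; rewrite ltrN2 invf_lt1 // ltr1n.
by rewrite ltnS.
Qed.

(** This is [2^k / k^theta], written so that comparing consecutive scales amounts to comparing
    exponents. *)
Definition almost_lin (theta : R) k := expR (k%:R * ln 2 - theta * ln k%:R).

(** At scale [j = m + 1], [ln L] is nearly [j ln 2] and [c * L] nearly [a'], so the ball costs about
    [th1 * a' / j] at most, whereas [2 * a] exceeds [a'] by at least [th * a' / j]. There is room
    for [th0 < th1 < th < 1] because [beta < c ln 2]. *)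
Lemma almost_linear (beta : R) : 0 < beta < c * ln 2 ->
  (exists r0, forall r, (r0 <= r)%N -> B r <= expR (beta * r%:R / ln r%:R)) ->
  exists theta n1 k0, [/\ 0 < theta < 1, (0 < n1)%N &
    forall k, (k0 <= k)%N -> phi (2 ^ k * n1) <= expR (- almost_lin theta k)].
Proof.
move=> /andP[b0 bc] [r0 hr0]; have l2 := ln2_gt0; have c0 := c_gt0; have K0 := K_ge0.
have cl2 : 0 < c * ln 2 by rewrite mulr_gt0.
pose th0 := beta / (c * ln 2).
have th00 : 0 < th0 by rewrite divr_gt0.
have th01 : th0 < 1 by rewrite ltr_pdivrMr // mul1r.
have betaE : beta = th0 * (c * ln 2) by rewrite /th0 divfK // gt_eqF.
clearbody th0.
pose th1 := (1 + 2 * th0) / 3; pose th := (2 + th0) / 3.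
have th1_gt0 : 0 < th1 by rewrite /th1; lra.
have th_lt1 : th < 1 by rewrite /th; lra.
have th1th : th1 < th by rewrite /th /th1; lra.
have th0th1 : th0 < th1 by rewrite /th1; lra.
clearbody th1 th.
(* The loss allowed in [ln L >= mu * j * ln 2]; dividing by it turns [th0] into [th1]. *)
pose mu := th0 / th1.
have mu0 : 0 < mu by rewrite divr_gt0.
have mu1 : mu < 1 by rewrite ltr_pdivrMr // mul1r.
have muE : th0 = th1 * mu by rewrite /mu mulrC divfK // gt_eqF.
clearbody mu.
pose ep := (1 - mu) * ln 2 / 2.
have ep0 : 0 < ep by rewrite divr_gt0 // mulr_gt0 // subr_gt0.
have [j1 hj1] := ln_le_eps _ ep0.
have [j2 hj2] := le_nat_exists (ln c / ep).
(* Once [A * j <= a'], the difference [(th - th1) * a'] covers the additive constants. *)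
pose A := (1 + th1 * (2 * K + c)) / (th - th1).
have tt0 : 0 < th - th1 by rewrite subr_gt0.
have AE : (th - th1) * A = 1 + th1 * (2 * K + c) by rewrite /A mulrC divfK // gt_eqF.
have A0 : 0 < A by rewrite divr_gt0 // addr_gt0 // mulr_gt0 //; lra.
clearbody A.
have [j3 hj3] := sqr_le_expR A _ l2.
have [j4 hj4] := le_nat_exists (c * r0%:R / A).
pose k0 := (maxn (maxn j1 j2) (maxn j3 j4)).+1.
have [n2 hn2] := le_nat_exists ((2 + 2 * K + c) / c).
have [n1 n1n2 hn1] := phi_small (expR (- almost_lin th k0)) (2 ^ k0 * n2.+1) (expR_gt0 _).
exists th, (maxn n1 n2.+1), k0; split; first by rewrite th_lt1 andbT; lra.
  by rewrite leq_max orbT.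
move=> k /subnK <-; elim: (k - k0)%N => [|i IH].
  rewrite add0n; apply: le_trans hn1; apply: phi_mono.
  by apply: leq_trans (leq_maxl _ n2.+1) _; rewrite leq_pmull // expn_gt0.
set m := (i + k0)%N in IH *; have mk0 : (k0 <= m)%N by rewrite leq_addl.
rewrite -[(i.+1 + k0)%N]/(m.+1); have j_gt0 : 0 < m.+1%:R :> R by rewrite ltr0n.
set j := m.+1%:R : R.
have jb : [/\ (j1 <= m.+1)%N, (j2 <= m.+1)%N, (j3 <= m.+1)%N & (j4 <= m.+1)%N].
  move: mk0; rewrite /k0 gtn_max !gtn_max => /andP[/andP[? ?] /andP[? ?]].
  by split; apply: leqW; apply: ltnW.
case: jb => /hj1 J1 /hj2 J2 /hj3 J3 /hj4 J4; rewrite -/j in J1 J2 J3 J4.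
have m_gt0 : (0 < m)%N by apply: leq_trans mk0.
have lnj0 : 0 <= ln j by rewrite ln_ge0 // ler1n.
set a := almost_lin th m; set a' := almost_lin th m.+1.
have a'_gt0 : 0 < a' by apply: expR_gt0.
have a'_le : a' <= 2 ^+ m.+1.
  rewrite -expR_ln2 ler_expR -/j gerBl mulr_ge0 //; lra.
have a'_ge : A * j <= a'.
  have -> : a' = expR (ln 2 * j) * expR (- (th * ln j)).
    by rewrite -expRD /a' /almost_lin -/j; congr expR; ring.
  apply: (@le_trans _ _ (A * j ^+ 2 * expR (- ln j))).
    by rewrite expRN lnK ?posrE // expr2 mulrA mulfK // gt_eqF.
  apply: ler_pM => //; first by rewrite mulr_ge0 ?exprn_ge0 // ltW.
  by rewrite ler_expR lerN2 ler_piMl // ltW.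
(* The quotient of the two exponents is [(j / m)^th], which is at least [1 + th / j]. *)
have gain : a' + a' * (th / j) <= 2 * a.
  have -> : 2 * a = a' * expR (th * (ln j - ln m%:R)).
    rewrite -{1}[2](@lnK R) ?posrE // -!expRD; congr expR.
    rewrite /almost_lin -/j /j -natr1; ring.
  rewrite -[X in X + _]mulr1 -mulrDr (ler_pM2l a'_gt0).
  apply: le_trans (expR_ge1Dx _); rewrite lerD2l; apply: ler_wpM2l; first by lra.
  exact: ln_succ_sub.
pose x := (a' + 2 * K) / c.
have x0 : 0 <= x by apply: divr_ge0; lra.
have /andP[Lx xL] := truncn_itv x0.
have xc : c * x = a' + 2 * K by rewrite /x; field; rewrite gt_eqF.
set L := (Num.truncn x).+1 in xL.
have cLx : c * x <= c * L%:R by rewrite ler_wpM2l // ltW.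
have cL1 : c * L%:R <= a' + 2 * K + c.
  rewrite -xc -[X in _ + X]mulr1 -mulrDr (ler_pM2l c0).
  by rewrite /L -natr1 lerD2r.
have L0 : 0 < L%:R :> R by rewrite ltr0n.
have lnL : mu * (j * ln 2) <= ln L%:R.
  apply: (@le_trans _ _ (ln (a' / c))).
    rewrite ln_div ?posrE // /a' /almost_lin expRK -/j.
    have : th * ln j <= ep * j by apply: le_trans J1; rewrite ler_piMl // ltW.
    have : ln c <= ep * j by rewrite mulrC -ler_pdivrMr.
    by rewrite /ep; lra.
  rewrite ler_ln ?posrE ?divr_gt0 // ler_pdivrMr // mulrC; lra.
have ell0 : 0 < mu * (j * ln 2) by rewrite !mulr_gt0.
rewrite expnS -mulnA mul2n -addnn.
apply: (doubling _ L a a' (th1 * (a' + 2 * K + c) / j)) => //.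
- have n2M : n2%:R <= (maxn n1 n2.+1)%:R :> R by rewrite ler_nat (leq_trans (leqnSn _)) // leq_maxr.
  rewrite -(ler_nat R) -(ler_pM2l c0) natrM natrX.
  apply: (@le_trans _ _ (2 ^+ m * (2 + 2 * K + c))).
    have p1 : 1 <= 2 ^+ m :> R by rewrite exprn_ege1 // ler1n.
    apply: le_trans cL1 _; rewrite exprS in a'_le.
    have : 2 * K + c <= 2 ^+ m * (2 * K + c) by rewrite ler_peMl //; lra.
    lra.
  rewrite mulrCA; apply: ler_wpM2l; first exact: exprn_ge0.
  rewrite [leRHS]mulrC -ler_pdivrMr //.
  exact: le_trans (hn2 _ (leqnn _)) n2M.
- apply: le_trans (hr0 L _) _.
    rewrite -(ler_nat R) -(ler_pM2l c0).
    have : c * r0%:R <= A * j by rewrite [leRHS]mulrC -ler_pdivrMr.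
    lra.
  rewrite ler_expR.
  have lnL0 : 0 < ln L%:R := lt_le_trans ell0 lnL.
  apply: (@le_trans _ _ (beta * L%:R / (mu * (j * ln 2)))).
    by apply: ler_wpM2l; [rewrite mulr_ge0 ?ltW|rewrite lef_pV2 ?posrE].
  have -> : beta * L%:R / (mu * (j * ln 2)) = th1 * (c * L%:R) / j.
    by rewrite betaE muE; field; rewrite !gt_eqF.
  apply: ler_wpM2r; first by rewrite invr_ge0 ltW.
  by apply: ler_wpM2l => //; exact: ltW.
- apply: le_trans gain.
  rewrite [leLHS]addrC lerD2l.
  rewrite mulrA ler_pdivlMr // mulrDl divfK ?gt_eqF // mul1r.
  have : (th - th1) * (A * j) <= (th - th1) * a' by rewrite ler_wpM2l // ltW.
  have j1' : 1 <= j by rewrite ler1n.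
  have : th1 * (2 * K + c) <= th1 * (2 * K + c) * j.
    by rewrite ler_peMr // mulr_ge0 ?ltW //; lra.
  rewrite mulrA AE; lra.
- by lra.
Qed.

(** For [q] of order [2^k], both [D * q / ln q] and [4 * ln q] are at most multiples of [2^k / k],
    while the exponent of [phi q] is at least [2^k / k^th], larger by the unbounded factor
    [k^{1 - th}]. *)
Lemma super_summable (beta D : R) : 0 < beta < c * ln 2 -> 0 <= D ->
  (exists r0, forall r, (r0 <= r)%N -> B r <= expR (beta * r%:R / ln r%:R)) ->
  exists q0, forall q, (q0 <= q)%N ->
    phi q * expR (D * q%:R / ln q%:R) * q%:R ^+ 4 <= 1.
Proof.
move=> hb D0 hB; have l2 := ln2_gt0.
have [th [n1 [k0 [/andP[th0 th1] n1_gt0 hphi]]]] := almost_linear _ hb hB.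
pose D' : R := 2 * D * n1%:R / ln 2; pose D'' : R := 4 * (2 * ln 2 + ln n1%:R).
have D'0 : 0 <= D' by rewrite divr_ge0 ?mulr_ge0 // ltW.
have lnn1 : 0 <= ln n1%:R :> R by rewrite ln_ge0 // ler1n.
have [k1 hk1] := sqr_le_expR D'' _ l2.
have [k2 hk2] := le_nat_exists (expR (D' / (1 - th))).
exists (2 ^ (maxn (maxn k0 k1) k2).+1 * n1)%N => q qb.
have n1q : (n1 <= q)%N by apply: leq_trans qb; rewrite leq_pmull // expn_gt0.
have [k [kq qk]] := dyadic n1 q n1_gt0 n1q.
have kb : ((maxn (maxn k0 k1) k2).+1 <= k)%N.
  rewrite -ltnS -(@ltn_exp2l 2) // -(ltn_pmul2r n1_gt0).
  exact: leq_ltn_trans qb qk.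
move: kb; rewrite gtn_max gtn_max => /andP[/andP[k0k k1k] k2k].
have k_gt0 : (0 < k)%N by apply: leq_ltn_trans k0k.
have kp : 0 < k%:R :> R by rewrite ltr0n.
have q_gt0 : (0 < q)%N by apply: leq_trans n1q.
have qp : 0 < q%:R :> R by rewrite ltr0n.
have lnq : k%:R * ln 2 <= ln q%:R :> R.
  rewrite -ler_expR expR_ln2 lnK ?posrE // -natrX ler_nat.
  by apply: leq_trans kq; rewrite leq_pmulr.
have kl : 0 < k%:R * ln 2 :> R by rewrite mulr_gt0.
have lnq' := dyadic_ln _ _ _ n1_gt0 kq qk.
have phiq : phi q <= expR (- almost_lin th k).
  by apply: le_trans (phi_mono _ _ kq) _; apply: hphi; apply: ltnW.
have -> : q%:R ^+ 4 = expR (4 * ln q%:R) :> R by rewrite expRM_natl lnK ?posrE.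
apply: (@le_trans _ _ (expR (- almost_lin th k) * expR (D * q%:R / ln q%:R) * expR (4 * ln q%:R))).
  by rewrite !ler_wpM2r ?expR_ge0.
rewrite -!expRD -[leRHS]expR0 ler_expR.
have q1 : D * q%:R / ln q%:R <= D' * 2 ^+ k / k%:R.
  apply: (@le_trans _ _ (D * q%:R / (k%:R * ln 2))).
    apply: ler_wpM2l; first by rewrite mulr_ge0.
    by rewrite lef_pV2 ?posrE //; exact: lt_le_trans kl lnq.
  have -> : D' * 2 ^+ k / k%:R = D * (2 ^+ k.+1 * n1%:R) / (k%:R * ln 2).
    by rewrite /D' exprS; field; rewrite !gt_eqF.
  apply: ler_wpM2r; first by rewrite invr_ge0 ltW.
  by apply: ler_wpM2l => //; rewrite -natrX -natrM ler_nat ltnW.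
have q2 : 4 * ln q%:R <= D'' * k%:R.
  have : 1 <= k%:R :> R by rewrite ler1n.
  have : ln n1%:R <= ln n1%:R * k%:R :> R by rewrite ler_peMr // ler1n.
  have : ln 2 <= ln 2 * k%:R :> R by rewrite ler_peMr ?ler1n //; exact: ltW.
  move: lnq'; rewrite /D'' -natr1; lra.
have q3 : D'' * k%:R <= 2 ^+ k / k%:R.
  rewrite ler_pdivlMr // -mulrA -expr2 -expR_ln2 mulrC [_ * ln 2]mulrC mulrC.
  exact: hk1 (ltnW k1k).
have q4 : (D' + 1) * (2 ^+ k / k%:R) <= almost_lin th k.
  have -> : almost_lin th k = expR ((1 - th) * ln k%:R) * (2 ^+ k / k%:R).
    rewrite -expR_ln2 -[X in _ * (_ / X)](@lnK R) ?posrE // -expRN -!expRD.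
    by congr expR; ring.
  apply: ler_wpM2r; first by rewrite divr_ge0 ?exprn_ge0.
  apply: le_trans (expR_ge1Dx _); rewrite addrC lerD2l.
  rewrite mulrC -ler_pdivrMr ?subr_gt0 //.
  rewrite -ler_expR lnK ?posrE //; exact: hk2 (ltnW k2k).
have q5 : D' * 2 ^+ k / k%:R + 2 ^+ k / k%:R <= almost_lin th k.
  by rewrite -mulrA -[X in _ + X]mul1r -mulrDl.
have := le_trans (lerD q1 (le_trans q2 q3)) q5.
move: (D * q%:R / ln q%:R) (4 * ln q%:R) (almost_lin th k) => x y z h.
lra.
Qed.

(** Induction on [phi n <= e^{1 - c' n}] through the multiscale recursion. In the main term [phi T],
    [phi n] and six factors [phi q] reproduce the target with a surplus [e^7]. The seventh factor
    [phi q] is kept and outweighs the eight ball sizes, leaving [q^{-2}] after the sum over [T], so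
    that the sum over [q >= q0] is a small multiple of the target. *)
Lemma exponential_decay (beta : R) : 0 < beta < c * ln 2 ->
  (exists r0, forall r, (r0 <= r)%N -> B r <= expR (beta * r%:R / ln r%:R)) ->
  (forall q0 Q N, (0 < q0)%N -> (q0 <= Q)%N -> (6 * q0 + 12 * Q <= N)%N ->
    phi N <= phi (6 * q0) * (B (3 * q0) * phi (N - 6 * q0))
     + \sum_(q <- iota q0 (Q.+1 - q0)) \sum_(T <- iota (6 * q0) (6 * q).+1)
         (K * expR (- (c * q%:R)) *+ 6 + phi T * (B (6 * q) * phi q * (B q * phi q) ^+ 6)) *
         (B (6 * q) * phi (N - T - 6 * q))
     + (12 * Q).+1%:R * (K * expR (- (c * (3 * Q)%N%:R)))) ->
  exists2 c' : R, 0 < c' & exists n0, forall n, (n0 <= n)%N -> phi n <= expR (- (c' * n%:R)).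
Proof.
move=> hb hB multi; have c0 := c_gt0; have K0 := K_ge0; have l2 := ln2_gt0.
have b0 : 0 < beta by case/andP: hb.
(* Eight ball sizes, each at most [e^{6 beta q / ln q}], account for [48 * beta]. *)
have [q1 hq1] := super_summable _ (48 * beta) hb (mulr_ge0 (ler0n _ 48) (ltW b0)) hB.
have [r0 hr0] := hB.
(* [q2] ensures [B (6 * q) <= e^{c q / 4}], and [q3] bounds [q^4] by an exponential. In [q4],
   [8 * e^7] makes the sum over scales at most half of the target, [42 * K] stands for six errors at
   up to [7 * q] ages, and [4 * e] serves the first term. *)
have [q2 hq2] := le_nat_exists (expR (24 * beta / c)).
have [q3 hq3] := sqr_le_expR 1 _ (divr_gt0 c0 (ltr0n R 64) : 0 < c / 64).
have [q4 hq4] := le_nat_exists (8 * expR 7 + 42 * K + 7 + 4 * expR 1).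
pose q0 := (maxn (maxn q1 r0) (maxn (maxn q2 q3) q4)).+2.
have [q0_1 q0_r q0_2 q0_3 q0_4] :
    [/\ (q1 <= q0)%N, (r0 <= q0)%N, (q2 <= q0)%N, (q3 <= q0)%N & (q4 <= q0)%N].
  by rewrite /q0; split; lia.
have q0_gt1 : (1 < q0)%N by [].
clearbody q0.
have Bq m q : (0 < m <= 6)%N -> (q0 <= q)%N ->
    B (m * q) <= expR (6 * beta * q%:R / ln q%:R).
  move=> /andP[m0 m6] qq; have q2' : (1 < q)%N by apply: leq_trans qq.
  have lnq : 0 < ln q%:R :> R by rewrite ln_gt0 // ltr1n.
  have mq : (q <= m * q)%N by rewrite leq_pmull.
  apply: le_trans (hr0 _ _) _.
    exact: leq_trans q0_r (leq_trans qq mq).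
  rewrite ler_expR; apply: ler_pM.
  - by rewrite mulr_ge0 // ltW.
  - by rewrite invr_ge0 ln_ge0 // ler1n muln_gt0 m0 ltnW.
  - rewrite natrM mulrA; apply: ler_wpM2r => //; rewrite [6 * _]mulrC.
    by apply: ler_wpM2l; [exact: ltW|rewrite ler_nat].
  - rewrite lef_pV2 ?posrE //; last first.
      by apply: lt_le_trans lnq _; rewrite ler_ln ?posrE ?ltr0n ?ler_nat //; lia.
    by rewrite ler_ln ?posrE ?ltr0n ?ler_nat //; lia.
have qbig q : (q0 <= q)%N -> [/\ (2 <= q)%N, 8 * expR 7 <= q%:R :> R, 42 * K <= q%:R,
    7 <= q%:R :> R & 4 * expR 1 <= q%:R :> R].
  move=> qq; have /hq4 : (q4 <= q)%N by apply: leq_trans qq.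
  have := expR_gt0 (7 : R); have := expR_gt0 (1 : R) => e1 e7 h.
  by split; [exact: leq_trans q0_gt1 qq|lra..].
have seven q : (q0 <= q)%N -> (6 * q).+1%:R <= 7 * q%:R :> R.
  by move=> /qbig[q2' _ _ _ _]; rewrite -natrM ler_nat; lia.
have termA q : (q0 <= q)%N ->
    (6 * q).+1%:R * (K * expR (- (c * q%:R)) *+ 6 * B (6 * q)) * expR (c / 2 * q%:R) <=
    (q%:R ^+ 2)^-1.
  move=> qq; have [q2' _ h42 _ _] := qbig q qq.
  have qp : 0 < q%:R :> R by rewrite ltr0n; lia.
  have lnq : 24 * beta / c <= ln q%:R.
    by rewrite -ler_expR lnK ?posrE //; apply: hq2 _ (leq_trans q0_2 qq).
  have lnq0 : 0 < ln q%:R :> R by apply: lt_le_trans lnq; rewrite divr_gt0 ?mulr_gt0.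
  have B6 : B (6 * q) <= expR (c / 4 * q%:R).
    apply: le_trans (Bq 6%N q isT qq) _; rewrite ler_expR ler_pdivrMr //.
    rewrite [leRHS]mulrAC; apply: ler_wpM2r; first exact: ltW.
    move: lnq; rewrite ler_pdivrMr // => ?; lra.
  have q4' : q%:R ^+ 4 <= expR (c / 4 * q%:R) :> R.
    have q2'' := hq3 q (leq_trans q0_3 qq).
    rewrite mul1r in q2''.
    apply: (@le_trans _ _ (expR (c / 64 * q%:R) * expR (c / 64 * q%:R))).
      by rewrite (_ : q%:R ^+ 4 = q%:R ^+ 2 * q%:R ^+ 2) ?ler_pM ?exprn_ge0 // -exprD.
    rewrite -expRD ler_expR -mulrDl; apply: ler_wpM2r; lra.
  have X : (6 * q).+1%:R * (K * expR (- (c * q%:R)) *+ 6 * B (6 * q)) * expR (c / 2 * q%:R) <=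
      42 * K * q%:R * expR (- (c / 4 * q%:R)).
    apply: (@le_trans _ _ (7 * q%:R *
        (K * expR (- (c * q%:R)) *+ 6 * expR (c / 4 * q%:R)) * expR (c / 2 * q%:R))).
      apply: ler_wpM2r; first exact: expR_ge0.
      apply: ler_pM => //; first by rewrite mulr_ge0 // mulrn_wge0 // mulr_ge0 // expR_ge0.
        exact: seven.
      by apply: ler_wpM2l => //; rewrite mulrn_wge0 // mulr_ge0 // expR_ge0.
    have -> : expR (- (c / 4 * q%:R)) =
        expR (- (c * q%:R)) * expR (c / 4 * q%:R) * expR (c / 2 * q%:R) :> R.
      by rewrite -!expRD; congr expR; field.
    rewrite le_eqVlt; apply/orP; left; apply/eqP; rewrite -mulr_natl; ring.
  apply: le_trans X _; rewrite expRN ler_pdivrMr ?expR_gt0 //.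
  rewrite [leRHS]mulrC ler_pdivlMr ?exprn_gt0 //.
  apply: le_trans q4'; rewrite (_ : q%:R ^+ 4 = q%:R * q%:R * q%:R ^+ 2); last by ring.
  by do 2!(apply: ler_wpM2r; first by rewrite ?exprn_ge0).
have phiB q : (q0 <= q)%N -> phi q * expR (6 * beta * q%:R / ln q%:R) ^+ 8 <= (q%:R ^+ 4)^-1.
  move=> qq; have [q2' _ _ _ _] := qbig q qq.
  have qp : 0 < q%:R :> R by rewrite ltr0n; lia.
  rewrite -expRM_natl (_ : 8%:R * _ = 48 * beta * q%:R / ln q%:R); last by ring.
  rewrite -[leRHS]mul1r ler_pdivlMr ?exprn_gt0 //.
  exact: hq1 _ (leq_trans q0_1 qq).
have termB q : (q0 <= q)%N ->
    (6 * q).+1%:R * (B (6 * q) * phi q * B q ^+ 6 * B (6 * q)) <= (q%:R ^+ 2)^-1.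
  move=> qq; have [q2' _ _ h7 _] := qbig q qq.
  have qp : 0 < q%:R :> R by rewrite ltr0n; lia.
  set X := expR (6 * beta * q%:R / ln q%:R).
  have B6 : B (6 * q) <= X := Bq 6%N q isT qq.
  have B1 : B q <= X by have := Bq 1%N q isT qq; rewrite mul1n.
  have X0 : 0 <= X by apply: expR_ge0.
  apply: (@le_trans _ _ (7 * q%:R * (phi q * X ^+ 8))).
    apply: ler_pM => //; first by rewrite !mulr_ge0 ?exprn_ge0.
      exact: seven.
    have -> : phi q * X ^+ 8 = X * phi q * X ^+ 6 * X by ring.
    apply: ler_pM => //; first by rewrite !mulr_ge0 ?exprn_ge0.
    apply: ler_pM; rewrite ?mulr_ge0 ?exprn_ge0 //; first by apply: ler_pM.
    by rewrite lerXn2r ?nnegrE.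
  apply: (@le_trans _ _ (q%:R * q%:R * (q%:R ^+ 4)^-1)).
    apply: ler_pM; rewrite ?mulr_ge0 ?exprn_ge0 //; last exact: phiB.
    exact: ler_wpM2r.
  rewrite le_eqVlt; apply/orP; left; apply/eqP; field.
  by rewrite gt_eqF.
have first : phi (6 * q0) * B (3 * q0) <= expR (- 1) / 4.
  have [q2' _ _ _ h4] := qbig q0 (leqnn _).
  have qp : 0 < q0%:R :> R by rewrite ltr0n; lia.
  set X := expR (6 * beta * q0%:R / ln q0%:R).
  have X1 : 1 <= X.
    by rewrite -[leLHS]expR0 ler_expR divr_ge0 ?ln_ge0 ?ler1n ?mulr_ge0 // ?ltW //; lia.
  apply: (@le_trans _ _ (phi q0 * X ^+ 8)).
    apply: ler_pM => //; first by apply: phi_mono; lia.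
    apply: le_trans (Bq 3%N q0 isT (leqnn _)) _.
    by rewrite -[leLHS]expr1; apply: ler_weXn2l.
  apply: le_trans (phiB _ (leqnn _)) _.
  rewrite expRN -invfM lef_pV2 ?posrE ?exprn_gt0 ?mulr_gt0 ?expR_gt0 //.
  rewrite mulrC; apply: le_trans h4 _; rewrite -[leLHS]expr1.
  by apply: ler_weXn2l => //; rewrite ler1n; lia.
(* The bound [12 * Q + 1 <= 2 * N^2] and the share of a quarter give the factor [8]; the exponential
   corrects [12 * Q] against [N]. *)
pose A5 := 8 * K * expR (c / 4 * (6 * q0 + 11)%:R).
have [n5 hn5] := sqr_le_expR A5 _ (divr_gt0 c0 (ltr0n R 8) : 0 < c / 8).
pose n0 := (maxn n5 (18 * q0)).+1.
have n0_5 : (n5 < n0)%N by rewrite ltnS leq_maxl.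
have n0_q : (18 * q0 < n0)%N by rewrite ltnS leq_maxr.
have n0p : 0 < n0%:R :> R by rewrite ltr0n.
clearbody n0.
(* [1 / n0] makes the claim trivial up to [n0]; [c / 36] gives [c' * (T + 6 * q) <= c * q / 2],
   because [T + 6 * q <= 18 * q]. *)
pose c' := Num.min (n0%:R)^-1 (c / 36).
have c'0 : 0 < c' by rewrite lt_min invr_gt0 n0p divr_gt0.
have c'n0 : c' * n0%:R <= 1 by rewrite -ler_pdivlMr // mul1r ge_min lexx.
have c'c : c' <= c / 36 by rewrite ge_min lexx orbT.
have claim N : phi N <= expR (1 - c' * N%:R).
  elim/ltn_ind: N => N IH; have [Nn0|n0N] := leqP N n0.
    apply: le_trans (phi_le1 _) _; rewrite -[leLHS]expR0 ler_expR subr_ge0.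
    by apply: le_trans c'n0; rewrite ler_wpM2l ?ler_nat // ltW.
  (* [Q] is as large as the recursion permits, so that [3 * Q] is about [N / 4]. *)
  have [Q [q0Q QN NQ]] : exists Q,
      [/\ (q0 <= Q)%N, (6 * q0 + 12 * Q <= N)%N & (N < 12 * Q + (6 * q0 + 12))%N].
    by clear - n0_q n0N; exists ((N - 6 * q0) %/ 12)%N; split; lia.
  have q0_gt0 : (0 < q0)%N by apply: ltnW.
  have [N6 q6N q6n0 Np] :
      [/\ (N - 6 * q0 < N)%N, (6 * q0 <= N)%N, (6 * q0 <= n0)%N & (0 < N)%N].
    by clear - n0_q n0N q0_gt0; split; lia.
  apply: le_trans (multi q0 Q N q0_gt0 q0Q QN) _.
  set Y := expR (1 - c' * N%:R).
  have Y0 : 0 < Y by apply: expR_gt0.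
  have -> : Y = Y / 4 + Y / 2 + Y / 4 by field.
  apply: lerD; first apply: lerD.
  - rewrite mulrA; apply: (@le_trans _ _ (expR (- 1) / 4 * expR (1 - c' * (N - 6 * q0)%:R))).
      by apply: ler_pM => //; [rewrite mulr_ge0|apply: IH].
    have : expR (- 1) * expR (1 - c' * (N - 6 * q0)%:R) <= Y.
      rewrite -expRD ler_expR natrB //.
      have : c' * (6 * q0)%:R <= 1.
        by apply: le_trans c'n0; rewrite ler_wpM2l ?ler_nat // ltW.
      by lra.
    by lra.
  - apply: (@le_trans _ _ (\sum_(q <- iota q0 (Q.+1 - q0)) Y * (1 + expR 7) * (q%:R ^+ 2)^-1)).
      rewrite big_seq [leRHS]big_seq; apply: ler_sum => q; rewrite mem_iota => qb.
      have qq : (q0 <= q)%N by case/andP: qb.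
      apply: (@le_trans _ _ (\sum_(T <- iota (6 * q0) (6 * q).+1) Y *
          (K * expR (- (c * q%:R)) *+ 6 * B (6 * q) * expR (c / 2 * q%:R) +
           expR 7 * (B (6 * q) * phi q * B q ^+ 6 * B (6 * q))))).
        rewrite big_seq [leRHS]big_seq; apply: ler_sum => T; rewrite mem_iota => Tb.
        set n := (N - T - 6 * q)%N.
        have [nN TN qN TqN T18] : [/\ (n < N)%N, (T < N)%N, (q < N)%N,
            (T + 6 * q <= N)%N & (T + 6 * q <= 18 * q)%N].
          by rewrite /n; clear - qb Tb QN q0_gt0; split; lia.
        have nE : n%:R = N%:R - T%:R - 6 * q%:R :> R.
          by rewrite /n -subnDA natrB // natrD natrM; ring.
        have B6 := B_ge0 (6 * q).
        rewrite mulrDl mulrDr; apply: lerD.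
          have -> : Y * (K * expR (- (c * q%:R)) *+ 6 * B (6 * q) * expR (c / 2 * q%:R)) =
            K * expR (- (c * q%:R)) *+ 6 * (B (6 * q) * (Y * expR (c / 2 * q%:R))) by ring.
          apply: ler_wpM2l; first by rewrite mulrn_wge0 // mulr_ge0 ?expR_ge0.
          apply: ler_wpM2l => //; apply: le_trans (IH n nN) _.
          rewrite -expRD ler_expR nE.
          have : c' * (T%:R + 6 * q%:R) <= c / 36 * (18 * q%:R).
            apply: (@le_trans _ _ (c / 36 * (T%:R + 6 * q%:R))).
              by apply: ler_wpM2r => //; rewrite addr_ge0 ?mulr_ge0.
            apply: ler_wpM2l; first by apply: divr_ge0 => //; exact: ltW.
            by rewrite -!natrM -natrD ler_nat.
          by lra.
        apply: (@le_trans _ _ (expR (1 - c' * T%:R) *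
             (B (6 * q) * phi q * (B q * expR (1 - c' * q%:R)) ^+ 6) *
             (B (6 * q) * expR (1 - c' * n%:R)))).
          apply: ler_pM; rewrite ?mulr_ge0 ?exprn_ge0 ?mulr_ge0 //.
            apply: ler_pM; rewrite ?mulr_ge0 ?exprn_ge0 ?mulr_ge0 ?IH //.
            apply: ler_wpM2l; first by rewrite mulr_ge0.
            by rewrite lerXn2r ?nnegrE ?mulr_ge0 ?expR_ge0 // ler_wpM2l // IH.
          by apply: ler_wpM2l => //; apply: IH.
        rewrite le_eqVlt; apply/orP; left; apply/eqP.
        have -> : Y * (expR 7 * (B (6 * q) * phi q * B q ^+ 6 * B (6 * q))) =
           (B (6 * q) * phi q * B q ^+ 6 * B (6 * q)) *
           (expR (1 - c' * T%:R) * expR (1 - c' * q%:R) ^+ 6 * expR (1 - c' * n%:R)).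
          rewrite -expRM_natl -!expRD mulrCA mulrA [RHS]mulrC; congr (_ * _).
          by rewrite /Y -expRD; congr expR; rewrite nE; ring.
        by rewrite exprMn; ring.
      rewrite big_const_seq count_predT iter_addr_0 size_iota.
      have tA := termA q qq; have tB := termB q qq.
      have e7 := expR_ge0 (7 : R).
      move: (K * expR (- (c * q%:R)) *+ 6 * B (6 * q)) (expR (c / 2 * q%:R))
        (B (6 * q) * phi q * B q ^+ 6 * B (6 * q)) tA tB => x y z tA tB.
      rewrite -[leLHS]mulr_natl.
      have -> : (6 * q).+1%:R * (Y * (x * y + expR 7 * z)) =
          Y * ((6 * q).+1%:R * x * y + expR 7 * ((6 * q).+1%:R * z)) by ring.
      rewrite -[leRHS]mulrA; apply: ler_wpM2l; first exact: ltW.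
      by rewrite mulrDl mul1r; apply: lerD => //; apply: ler_wpM2l.
    rewrite -mulr_sumr; apply: (@le_trans _ _ (Y * (1 + expR 7) * (2 / q0%:R))).
      apply: ler_wpM2l; last exact: sum_inv_sqr.
      by rewrite mulr_ge0 ?addr_ge0 ?expR_ge0 ?ltW.
    have [q2' h8 _ _ _] := qbig q0 (leqnn _).
    have qp : 0 < q0%:R :> R by rewrite ltr0n.
    have e1 : 1 <= expR 7 :> R by rewrite -[leLHS]expR0 ler_expR.
    rewrite -mulrA; apply: ler_wpM2l; first exact: ltW.
    by rewrite mulrA ler_pdivrMr //; lra.
  - have h5 := hn5 N (ltnW (ltn_trans n0_5 n0N)).
    apply: (@le_trans _ _ (2 * N%:R ^+ 2 *
        (K * (expR (c / 4 * (6 * q0 + 11)%:R) * expR (- (c / 4 * N%:R)))))).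
      apply: ler_pM; rewrite ?mulr_ge0 ?expR_ge0 //.
        by rewrite -natrX -natrM ler_nat; clear - QN q0_gt0; nia.
      apply: ler_wpM2l => //; rewrite -expRD ler_expR.
      have : N%:R <= (12 * Q + (6 * q0 + 11))%:R :> R by rewrite ler_nat; clear - NQ; lia.
      rewrite natrD !natrM => h.
      have : c * N%:R <= c * (12 * Q%:R + (6 * q0 + 11)%:R).
        by apply: ler_wpM2l => //; exact: ltW.
      by lra.
    have -> : 2 * N%:R ^+ 2 * (K * (expR (c / 4 * (6 * q0 + 11)%:R) * expR (- (c / 4 * N%:R)))) =
        A5 * N%:R ^+ 2 * expR (- (c / 4 * N%:R)) / 4 by rewrite /A5; field.
    apply: ler_wpM2r; first by rewrite invr_ge0.
    apply: (@le_trans _ _ (expR (c / 8 * N%:R) * expR (- (c / 4 * N%:R)))).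
      by apply: ler_wpM2r => //; apply: expR_ge0.
    rewrite -expRD ler_expR.
    have : c' * N%:R <= c / 36 * N%:R by rewrite ler_wpM2r.
    have : 0 <= c * N%:R by rewrite mulr_ge0 // ltW.
    by lra.
have [n1 hn1] := le_nat_exists (2 / c').
exists (c' / 2); first by rewrite divr_gt0.
exists n1 => n /hn1; rewrite ler_pdivrMr // => h.
by apply: le_trans (claim n) _; rewrite ler_expR; lra.
Qed.

End Asymptotics.

(** * Consequences of irreducibility *)

Section Ergodicity.
Context {R : realType} {V : countType} {dS : Order.disp_t} {S : finTBOrderType dS}.
Context {dA : measure_display} {TA : measurableType dA}.
Context {rho : spec R V S} {F : config V S -> V -> TA -> S}.
Context (rho_spec : updown_specification rho).
Implicit Types (s : bool) (L : {fset V}) (omega : config V S).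

Local Notation field := (nat -> V -> TA).

Definition mass s L omega : R := pr (rho L (pm s)) [set omega].

Lemma mass_supported {s L omega} : 0 < mass s L omega -> supported s L omega.
Proof.
move=> m0; apply: contrapT => h; move: m0; rewrite /mass.
rewrite -(pr_full _ [set omega] (Omega_bc L (pm s))).
- rewrite (_ : _ `&` _ = set0) ?pr_set0 ?ltxx //.
  by apply/seteqP; split => // t [/= ->].
- exact: measurable_point.
- exact: measurable_Omega_bc.
- exact: (pr_bc rho_spec _ _ (pm_Omega s)).
Qed.

(** A step may leave the configuration unchanged, so paths can be prolonged to a common length. *)
Fixpoint reach s L n omega : Prop :=
  if n is m.+1 then exists omega' u, [/\ u \in L, 0 < mass s L omega',
    agree_off [fset u]%fset omega omega' & reach s L m omega']
  else omega = pm s.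

(* A quantitative form of irreducibility with a single parameter [m], kept
   invariant under automorphisms so as to be uniform over orbits. *)
Definition accessible s L m :=
  [/\ (#|` L| <= m)%N, forall omega, 0 < mass s L omega -> reach s L m omega &
    forall omega omega' u, u \in L -> 0 < mass s L omega -> 0 < mass s L omega' ->
      agree_off [fset u]%fset omega omega' ->
      (m.+1%:R)^-1 <= pr (rho [fset u]%fset omega) [set omega']].

Lemma reachS s L n omega u : u \in L -> 0 < mass s L omega ->
  reach s L n omega -> reach s L n.+1 omega.
Proof. by move=> uL m0 h; exists omega, u; split. Qed.

Lemma reachW {s L n m omega u} : u \in L -> (n <= m)%N -> 0 < mass s L omega ->
  reach s L n omega -> reach s L m omega.
Proof.
move=> uL /subnKC <- m0 h; elim: (m - n)%N => [|i IH]; first by rewrite addn0.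
by rewrite addnS; apply: (reachS _ _ _ _ u).
Qed.

Lemma accessibleW {s L n m u} : u \in L -> (n <= m)%N -> accessible s L n -> accessible s L m.
Proof.
move=> uL nm [h1 h2 h3]; split.
- exact: leq_trans h1 nm.
- by move=> omega m0; apply: (reachW uL nm m0); apply: h2.
- move=> omega omega' w wL m0 m0' ag; apply: le_trans (h3 _ _ _ wL m0 m0' ag).
  by rewrite lef_pV2 ?posrE ?ltr0n // ler_nat ltnS.
Qed.

(** If this transition had probability zero, conditioning on the values off [u] would give [omega']
    mass zero. *)
Lemma mass_site s L omega omega' u : u \in L -> 0 < mass s L omega ->
  0 < mass s L omega' -> agree_off [fset u]%fset omega omega' ->
  0 < pr (rho [fset u]%fset omega) [set omega'].
Proof.
move=> uL m0 m0' ag; have h := mass_supported m0; have h' := mass_supported m0'.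
have uLf : ([fset u] `<=` L)%fset by rewrite fsub1set.
rewrite lt_def pr_ge0 andbT; apply/eqP => p0.
have := pr_cond rho_spec s L [fset u]%fset omega [set omega'] uLf h (measurable_point omega').
rewrite p0 mulr0 => m00; move: m0'; rewrite /mass -m00.
rewrite (_ : _ `&` _ = [set omega']) ?ltxx //.
by apply/seteqP; split => [t []//|t /= ->]; split.
Qed.

Lemma hamming_reach s L p omega :
  path hamming_adj omega p -> last omega p = pm s -> 0 < mass s L omega ->
  (forall sigma, sigma \in p -> spec_support rho L s sigma) -> reach s L (size p) omega.
Proof.
elim: p omega => [|omega' p IH] omega //= /andP[/asboolP[u [du uniqu]] op] lp m0 hp.
have m0' : 0 < mass s L omega'.
  have [_ h] := hp omega' (mem_head _ _).
  by rewrite -lte_fin pr_fin //; apply: measurable_point.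
exists omega', u; split => //.
- apply: contrapT => /negP uL; apply: du.
  by rewrite (mass_supported m0 _ uL) (mass_supported m0' _ uL).
- move=> w; rewrite in_fset1 => wu; apply: contrapT => /nesym /uniqu uw.
  by rewrite uw eqxx in wu.
- by apply: IH => // sigma sp; apply: hp; rewrite inE sp orbT.
Qed.

Context (rho_irr : irreducible_spec rho).

Lemma mass_reach s L omega : 0 < mass s L omega -> exists n, reach s L n omega.
Proof.
move=> m0; have [supp conn] := rho_irr L s.
have h : spec_support rho L s omega.
  split; first exact: supported_sign (mass_supported m0).
  by rewrite -pr_fin ?lte_fin //; apply: measurable_point.
have [p [op lp hp]] := conn _ _ h supp.
by exists (size p); apply: hamming_reach.
Qed.

(** Only finitely many configurations are supported in [L], so path lengths and inverses of positive
    transition probabilities have maxima. *)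
Lemma accessible_exists s L u : u \in L -> exists m, accessible s L m.
Proof.
move=> uL.
have /fin_all_exists[f1 hf1] (x : {ffun L -> S}) : exists n, 0 < mass s L (ext s L x) ->
    reach s L n (ext s L x).
  have [m0|m0] := boolP (0 < mass s L (ext s L x)); last by exists 0%N.
  by have [n hn] := mass_reach _ _ _ m0; exists n.
have /fin_all_exists[f2 hf2] (z : {ffun L -> S} * {ffun L -> S} * L) : exists n,
    0 < pr (rho [fset val z.2]%fset (ext s L z.1.1)) [set ext s L z.1.2] ->
    (n.+1%:R)^-1 <= pr (rho [fset val z.2]%fset (ext s L z.1.1)) [set ext s L z.1.2].
  set p := pr _ _; have [n hn] := le_nat_exists p^-1; exists n => p0.
  by rewrite invf_ple ?posrE ?ltr0n //; apply: hn.
exists (maxn #|` L| (maxn (\max_x f1 x) (\max_z f2 z))); split.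
- exact: leq_maxl.
- move=> omega m0; have h := mass_supported m0.
  rewrite -(extK s L omega h) in m0 *; apply: (reachW uL _ m0 (hf1 _ m0)).
  by rewrite !leq_max leq_bigmax orbT.
- move=> omega omega' w wL m0 m0' ag.
  have p0 := mass_site _ _ _ _ _ wL m0 m0' ag.
  have h := mass_supported m0; have h' := mass_supported m0'.
  pose z := (enc L omega, enc L omega', [` wL]%fset).
  have := hf2 z; rewrite /= !extK // => /(_ p0); apply: le_trans.
  by rewrite lef_pV2 ?posrE ?ltr0n // ler_nat ltnS !leq_max leq_bigmax !orbT.
Qed.

Section Invariance.
Context {Gamma : groupType} {act : Gamma -> V -> V} (act_action : group_action act).
Context (rho_inv : invariant_spec act rho).

Lemma actK g v : act g^-1%g (act g v) = v.
Proof. by case: act_action => a1 aM; rewrite -aM mulVg a1. Qed.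

Lemma actVK g v : act g (act g^-1%g v) = v.
Proof. by case: act_action => a1 aM; rewrite -aM mulgV a1. Qed.

Local Notation "g .: L" := [fset act g v | v in L]%fset (at level 30).

Lemma mem_image g L v : (v \in g .: L) = (act g^-1%g v \in L).
Proof.
apply/imfsetP/idP => [[w /= wL ->]|h]; first by rewrite actK.
by exists (act g^-1%g v) => //; rewrite actVK.
Qed.

Lemma pr_image g U tau omega : Omega_pm tau ->
  pr (rho (g .: U) (act_fun act g tau)) [set act_fun act g omega] =
  pr (rho U tau) [set omega].
Proof.
move=> Ot; rewrite /pr -(rho_inv g U tau Ot [set omega] (measurable_point omega)).
congr (fine (rho _ _ _)); apply/seteqP; split => sigma /=.
  move=> ->; apply/funext => v; rewrite /act_fun invgK actK //.
move=> <-; apply/funext => v; rewrite /act_fun invgK actVK //.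
Qed.

Lemma mass_image g s L omega : mass s (g .: L) (act_fun act g omega) = mass s L omega.
Proof. exact: (pr_image g L (pm s) omega (pm_Omega s)). Qed.

Lemma act_fun_inv g omega : act_fun act g (act_fun act g^-1%g omega) = omega.
Proof. by apply/funext => v; rewrite /act_fun invgK actVK. Qed.

Lemma agree_image g u omega omega' : agree_off [fset u]%fset omega omega' ->
  agree_off [fset (act g u)]%fset (act_fun act g omega) (act_fun act g omega').
Proof.
move=> ag v; rewrite in_fset1 => vu; apply: ag; rewrite in_fset1.
by apply: contra vu => /eqP <-; rewrite actVK.
Qed.

Lemma reach_image g s L n omega : reach s L n omega ->
  reach s (g .: L) n (act_fun act g omega).
Proof.
elim: n omega => [|n IH] omega /= => [-> //|[omega' [u [uL m0 ag h]]]].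
exists (act_fun act g omega'), (act g u); split.
- by rewrite mem_image actK.
- by rewrite mass_image.
- exact: agree_image.
- exact: IH.
Qed.

Lemma accessible_image g s L m : accessible s L m -> accessible s (g .: L) m.
Proof.
case=> h1 h2 h3; split.
- by apply: leq_trans h1; rewrite card_imfset //; apply: (can_inj (actK g)).
- move=> omega; rewrite -(act_fun_inv g omega) mass_image => m0.
  by apply: reach_image; apply: h2.
- move=> omega omega' u; rewrite mem_image => uL.
  rewrite -(act_fun_inv g omega) -(act_fun_inv g omega') !mass_image => m0 m0' ag.
  rewrite !act_fun_inv in ag.
  have := h3 _ _ _ uL m0 m0' (agree_image g^-1%g u _ _ ag).
  rewrite -(pr_image g); last exact: supported_Omega (mass_supported m0).
  rewrite (_ : g .: [fset act g^-1%g u]%fset = [fset u]%fset) //.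
  by apply/fsetP => w; rewrite mem_image !in_fset1 (can_eq (actK g^-1%g)).
Qed.

Context {e : rel V} (esym : symmetric e) (fin : locally_finite e).
Context (act_aut : acts_by_automorphisms act e) (act_qt : quasi_transitive act).

Lemma dist_le_act g u v r : dist_le e u v r -> dist_le e (act g u) (act g v) r.
Proof.
case=> p [ep pv pr]; exists (map (act g) p); split.
- by rewrite path_map; apply: sub_path ep => x y; rewrite /= act_aut.
- by rewrite last_map pv.
- by rewrite size_map.
Qed.

Lemma vball_act g v r : vball e (act g v) r = g .: vball e v r.
Proof.
apply/fsetP => u; rewrite mem_image; apply/idP/idP => /(in_vball esym fin) h;
  apply/(in_vball esym fin).
  by rewrite -(actK g v); apply: dist_le_act.
by rewrite -(actVK g u); apply: dist_le_act.
Qed.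

(** The constant found at one vertex serves its whole orbit, because the group transports
    accessibility; finitely many orbits leave a maximum of finitely many constants. *)
Lemma accessible_uniform r : exists m, forall v s, accessible s (vball e v r) m.
Proof.
have /choice[f hf] (v : V) : exists m, forall s, accessible s (vball e v r) m.
  have vv := vball_center esym fin v r.
  have [m1 h1] := accessible_exists true _ _ vv.
  have [m2 h2] := accessible_exists false _ _ vv.
  exists (maxn m1 m2); case.
    exact: (accessibleW vv (leq_maxl _ _) h1).
  exact: (accessibleW vv (leq_maxr _ _) h2).
have /finite_seqP[Os hOs] := act_qt.
(* [h X] is the constant of a chosen representative of the orbit [X], and [0] for a set that is not
   an orbit. *)
have /choice[h hh] (X : set V) : exists m, (exists v, range (act^~ v) = X) ->
    exists2 w, range (act^~ w) = X & f w = m.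
  have [[v vX]|nv] := pselect (exists v, range (act^~ v) = X); last by exists 0%N.
  by exists (f v) => _; exists v.
exists (\max_(X <- Os) h X) => v s.
have vOs : range (act^~ v) \in Os.
  suff : [set` Os] (range (act^~ v)) by [].
  by rewrite -hOs; exists v.
have [w wX fw] := hh _ (ex_intro _ v erefl).
have [g _ gw] : range (act^~ w) v by rewrite wX; exists 1%g => //; case: act_action.
apply: (accessibleW (vball_center esym fin v r) (n := f w)).
  by rewrite fw; apply: (@leq_bigmax_seq _ Os xpredT h).
by rewrite -gw vball_act; apply: accessible_image; apply: hf.
Qed.

End Invariance.
End Ergodicity.

Lemma ler_bool {R : numDomainType} (b b' : bool) : (b -> b') -> b%:R <= b'%:R :> R.
Proof. by rewrite ler_nat; case: b => //= ->. Qed.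

(** * Coalescence in a fixed finite volume *)

Section Coalescence.
Context {R : realType} {V : countType} {dS : Order.disp_t} {S : finTBOrderType dS}.
Context {dA : measure_display} {TA : measurableType dA}.
Context {rho : spec R V S} {F : config V S -> V -> TA -> S}.
Context (rho_spec : updown_specification rho).
Context (F_mono : forall omega omega' v x, Omega_pm omega -> Omega_pm omega' ->
  conf_le omega omega' -> (F omega v x <= F omega' v x)%O).
Implicit Types (s : bool) (omega : config V S).

Local Notation field := (nat -> V -> TA).

Context {o : nat -> rel V} (o_lin : forall k, linear_order (o k)).
Context {L : {fset V}} {M : nat} {E : (field -> R) -> R} (EP : noise_mean rho F L M E).
Context {s : bool} {m : nat} (acc : accessible (rho := rho) s L m).

Local Notation delta := ((m.+1%:R)^-1 : R).

Lemma delta_ge0 : 0 <= delta.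
Proof. by rewrite invr_ge0. Qed.

Lemma delta_le1 : delta <= 1.
Proof. by rewrite invf_le1 ?ltr0n // ler1n. Qed.

Lemma kern_ge u x y : u \in L -> 0 < weight rho s L x -> 0 < weight rho s L y ->
  agree_off [fset u]%fset (ext s L x) (ext s L y) -> delta <= kern rho s L [fset u]%fset x y.
Proof. by case: acc => _ _ h uL x0 y0 ag; apply: h. Qed.

Lemma Pr_update_after {l u k x z y} : u \notin l -> u \in L -> {subset l <= L} ->
  (0 < k <= M)%N ->
  0 <= Pr E (fun a => enc L (sweep F l (a k) (ext s L x)) == z) * kern rho s L [fset u]%fset z y
    <= Pr E (fun a => enc L (sweep F (u :: l) (a k) (ext s L x)) == y).
Proof.
move=> ul uL lL kM; rewrite mulr_ge0 ?(Pr_ge0 EP) ?kern_ge0 //=.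
rewrite -(Pr_update EP rho_spec s u k z y uL kM).
rewrite -(Pr_and EP [set p | p.1 = k /\ p.2 \in l] [set (k, u)]).
- apply: (Pr_le EP) => a /andP[/eqP h /eqP <-]; rewrite -h extK //.
  by apply: supported_sweep => //; apply: supported_ext.
- by apply/seteqP; split => // -[j w] /= [[_ wl] [_ wu]]; rewrite -wu wl in ul.
- by apply: (depends_on_comp _ (fun w => w == z)); apply: sweep_depends.
- by move=> a a' aa; rewrite (aa k u).
Qed.

(** A sweep updates every vertex of [l], so besides the wanted change all other vertices must be
    resampled to their present value; an update of either kind costs a factor [delta]. *)
Lemma Pr_sweep {l k x y} : uniq l -> {subset l <= L} -> (0 < k <= M)%N ->
  0 < weight rho s L x -> 0 < weight rho s L y ->
  (x = y \/ exists2 u, u \in l & agree_off [fset u]%fset (ext s L x) (ext s L y)) ->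
  delta ^+ size l <= Pr E (fun a => enc L (sweep F l (a k) (ext s L x)) == y).
Proof.
move=> + + kM x0; elim: l y => [|u l IH] y /=.
  move=> _ _ _ [<-|[//]]; rewrite expr0 -[leLHS](mean_one EP); apply: (mean_le EP) => a.
  by rewrite encK eqxx.
case/andP=> ul uniql lL y0 xy.
have uL : u \in L by apply: lL; rewrite mem_head.
have lL' : {subset l <= L} by move=> w wl; apply: lL; rewrite inE wl orbT.
(* [z] precedes the last update, made at the head of the list: it is already [y] if the change
   occurs in the tail, and still [x] otherwise. *)
suff [z [z0 xz zy]] : exists z, [/\ 0 < weight rho s L z,
    x = z \/ exists2 u, u \in l & agree_off [fset u]%fset (ext s L x) (ext s L z) &
    agree_off [fset u]%fset (ext s L z) (ext s L y)].
  have /andP[_] := Pr_update_after (x := x) (z := z) (y := y) ul uL lL' kM.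
  apply: le_trans; rewrite exprSr; apply: ler_pM.
  - by rewrite exprn_ge0 // delta_ge0.
  - exact: delta_ge0.
  - exact: IH.
  - exact: kern_ge.
case: xy => [<-|[w]]; first by exists x; split => //; left.
rewrite inE => /orP[/eqP -> ag|wl ag]; first by exists x; split => //; left.
by exists y; split => //; right; exists w.
Qed.

Lemma Pr_reach n k x : (k + n <= M)%N -> 0 < weight rho s L x ->
  reach (rho := rho) s L n (ext s L x) ->
  delta ^+ (m * n) <= Pr E (fun a => dyn F s L o a k n (ext s L x) == pm s).
Proof.
have mL : (#|` L| <= m)%N by case: acc.
elim: n x => [|n IH] x kn x0 /=.
  move=> <-; rewrite muln0 expr0 -[leLHS](mean_one EP); apply: (mean_le EP) => a.
  by rewrite eqxx.
case=> omega' [u [uL m0 ag h]].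
have so := mass_supported rho_spec m0.
rewrite -(extK s L omega' so) in m0 ag h.
set z := enc L omega' in m0 ag h.
have kn' : (k + n <= M)%N by apply: leq_trans kn; rewrite addnS.
have {}IH := IH z kn' m0 h.
have kM : (0 < k + n.+1 <= M)%N by rewrite addnS -addnS kn addnS.
have P1 : delta ^+ m <= Pr E (fun a => enc L (step F s L o a (k + n.+1) (ext s L x)) == z).
  apply: (@le_trans _ _ (delta ^+ size (sort (o (k + n.+1)%N) L))).
    by apply: ler_wiXn2l; rewrite ?delta_ge0 ?delta_le1 // size_sort.
  apply: (@le_trans _ _ (Pr E (fun a => enc L
      (sweep F (sort (o (k + n.+1)%N) L) (a (k + n.+1)%N) (ext s L x)) == z))).
    apply: Pr_sweep => //; rewrite ?sort_uniq ?fset_uniq //.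
    + by move=> w; rewrite mem_sort.
    + by right; exists u; rewrite ?mem_sort.
  apply: (Pr_le EP) => a; rewrite /step restrict_id //; exact: supported_ext.
rewrite mulnS exprD.
apply: (@le_trans _ _ (Pr E (fun a => enc L (step F s L o a (k + n.+1) (ext s L x)) == z) *
    Pr E (fun a => dyn F s L o a k n (ext s L z) == pm s))).
  by apply: ler_pM => //; rewrite exprn_ge0 // delta_ge0.
rewrite -(Pr_and EP [set p | p.1 = (k + n.+1)%N] [set p | (p.1 <= k + n)%N]).
- apply: (Pr_le EP) => a /andP[/eqP <- /eqP <-]; rewrite extK //.
  exact: supported_step.
- by apply/seteqP; split => // p /= [-> ]; rewrite addnS ltnn.
- move=> a a' aa; congr (enc L _ == z); apply: sweep_local => w _; exact: aa.
- move=> a a' aa; rewrite (dyn_local s L o a a') // => j w /andP[_ jk] _.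
  exact: aa.
Qed.

(** By stationarity the weighted sum of these probabilities over all starts is the weight of [z],
    which is zero. *)
Lemma Pr_leave_support k n x z : (k + n <= M)%N -> 0 < weight rho s L x ->
  weight rho s L z = 0 ->
  Pr E (fun a => enc L (dyn F s L o a k n (ext s L x)) == z) = 0.
Proof.
move=> kn x0 z0.
have e0 : \sum_y weight rho s L y * (y == z)%:R = 0.
  rewrite (bigD1 z) //= z0 mul0r add0r big1 // => y yz.
  by rewrite (negbTE yz) mulr0.
have := dyn_stationary EP rho_spec s o k n (fun y => (y == z)%:R) kn.
rewrite e0.
move=> /eqP; rewrite psumr_eq0; last first.
  move=> y _; rewrite mulr_ge0 ?weight_ge0 //.
  exact: (Pr_ge0 EP (fun a => enc L (dyn F s L o a k n (ext s L y)) == z)).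
move=> /allP /(_ x (mem_index_enum x)); rewrite mulf_eq0 gt_eqF //= => /eqP.
exact.
Qed.

(** The oldest [m] sweeps bring the chain from [x] to [pm s] with probability at least
    [delta ^+ (m * m)]; the chain from [pm s] dominates it and is then at [pm s] too. Otherwise the
    chain is at another configuration of positive weight. If a fresh start from [pm s] coalesced
    with it, both original chains would agree by monotonicity, so the bound for the [j] younger
    blocks applies. *)
Lemma Pr_no_coalescence j k x : (k + j * m <= M)%N -> 0 < weight rho s L x ->
  Pr E (fun a => dyn F s L o a k (j * m) (pm s) != dyn F s L o a k (j * m) (ext s L x)) <=
  (1 - delta ^+ (m * m)) ^+ j.
Proof.
set ep := 1 - _; have ep0 : 0 <= ep.
  by rewrite subr_ge0 exprn_ile1 ?delta_ge0 ?delta_le1.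
elim: j k x => [|j IH] k x kM x0; first by rewrite expr0; apply: (Pr_le1 EP).
have kM' : (k + j * m <= M)%N by apply: leq_trans kM; rewrite leq_add2l leq_mul2r leqnSn orbT.
have kM'' : (k + j * m + m <= M)%N by rewrite -addnA -mulSnr.
rewrite mulSnr.
pose G (a : field) := enc L (dyn F s L o a (k + j * m) m (ext s L x)).
pose h z (a : field) := ((ext s L z != pm s) &&
  (dyn F s L o a k (j * m) (pm s) != dyn F s L o a k (j * m) (ext s L z)))%:R : R.
have GE a : ext s L (G a) = dyn F s L o a (k + j * m) m (ext s L x).
  by rewrite extK //; apply: supported_dyn; apply: supported_ext.
apply: (@le_trans _ _ (E (fun a => h (G a) a))).
  apply: (mean_le EP) => a; rewrite /h GE !dynD; apply: ler_bool.
  set w := dyn F s L o a (k + j * m) m (ext s L x).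
  set w' := dyn F s L o a (k + j * m) m (pm s).
  have ww' : confs_le s w w' by apply: (dyn_mono F_mono o_lin); apply: confs_le_pm.
  move=> ne; have key : dyn F s L o a k (j * m) (pm s) = dyn F s L o a k (j * m) w ->
      dyn F s L o a k (j * m) w' = dyn F s L o a k (j * m) w.
    move=> eqw; apply/funext => v; apply: (@sign_le_anti _ _ s).
      rewrite -eqw; exact: (dyn_mono F_mono o_lin s L a k (j * m) _ _ (confs_le_pm s w') v).
    exact: (dyn_mono F_mono o_lin s L a k (j * m) _ _ ww' v).
  by apply/andP; split; apply: contra ne => /eqP h'; apply/eqP/key; rewrite ?h'.
have dep0 : depends_on [set p | (k + j * m < p.1)%N] G.
  apply: (depends_on_comp _ (enc L)) => a a' aa; apply: dyn_local => i w /andP[ik _] _.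
  exact: aa.
have dep1 z : depends_on [set p | (p.1 <= k + j * m)%N] (h z).
  move=> a a' aa; rewrite /h !(dyn_local s L o a a') // => i w /andP[_ ik] _;
  exact: aa.
rewrite (mean_mix EP _ [set p | (k + j * m < p.1)%N] [set p | (p.1 <= k + j * m)%N]) //; last first.
  by apply/seteqP; split => // p /= []; rewrite ltnNge => /negP.
rewrite (mean_fin EP _ G (fun z => E (h z))).
apply: (@le_trans _ _ (\sum_z Pr E (fun a => G a == z) * ((ext s L z != pm s)%:R * ep ^+ j))).
  apply: ler_sum => z _.
  have [z0|z0] := boolP (0 < weight rho s L z); last first.
    rewrite (Pr_leave_support (k + j * m) m x z) ?mul0r //.
    by apply: le_anti; rewrite weight_ge0 andbT leNgt.
  apply: ler_wpM2l; first exact: (Pr_ge0 EP).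
  rewrite /h; case: (ext s L z != pm s); last first.
    by rewrite mul0r -(mean_cst EP 0); apply: (mean_le EP) => a.
  by rewrite mul1r; apply: IH.
rewrite exprS.
have -> : \sum_z Pr E (fun a => G a == z) * ((ext s L z != pm s)%:R * ep ^+ j) =
    E (fun a => (dyn F s L o a (k + j * m) m (ext s L x) != pm s)%:R) * ep ^+ j.
  rewrite -(mean_fin EP _ G (fun z => (ext s L z != pm s)%:R * ep ^+ j)) mulrC -(mean_scale EP).
  by apply: (mean_eq EP) => a; rewrite GE mulrC.
apply: ler_wpM2r; first by rewrite exprn_ge0.
rewrite /ep lerBrDr -[leRHS](mean_one EP).
apply: (@le_trans _ _ (E (fun a => (dyn F s L o a (k + j * m) m (ext s L x) != pm s)%:R) +
   Pr E (fun a => dyn F s L o a (k + j * m) m (ext s L x) == pm s))).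
  rewrite lerD2l; apply: Pr_reach => //.
  by case: acc => _ + _; apply.
rewrite -(mean_add EP); apply: (mean_le EP) => a.
by rewrite -natrD; case: (_ == _).
Qed.

End Coalescence.

(** * Convergence of [phi] to zero *)

Section PhiVanishes.
Context {R : realType} {V : countType} {dS : Order.disp_t} {S : finTBOrderType dS}.
Context {dA : measure_display} {TA : measurableType dA}.
Context {rho : spec R V S} {F : config V S -> V -> TA -> S} {e : rel V}.
Context (rho_spec : updown_specification rho) (rho_mono : monotone_spec rho).
Context (F_mono : forall omega omega' v x, Omega_pm omega -> Omega_pm omega' ->
  conf_le omega omega' -> (F omega v x <= F omega' v x)%O).
Context (esym : symmetric e) (fin : locally_finite e) {c C : R} (c_gt0 : 0 < c).
Context (C_ge0 : 0 <= C).
Context (mixing : forall v r,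
  (dTV (rho (vball e v r) (pm true)) (fun sigma => sigma v)
       (rho (vball e v r) (pm false)) (fun sigma => sigma v)
   <= (C * expR (- (c * r%:R)))%:E)%E).
Context (uniform : forall r, exists m, forall v s, accessible (rho := rho) s (vball e v r) m).

Local Notation field := (nat -> V -> TA).

(** A start drawn from the stationary weights keeps the law [rho L (pm s)], and the chain from
    [pm s] coalesces with it outside the event of [Pr_no_coalescence]. *)
Lemma Pr_spin_near s {L M} {E : (field -> R) -> R} {o k m j v} t (Q : S -> bool) :
  noise_mean rho F L M E -> (forall i, linear_order (o i)) ->
  accessible (rho := rho) s L m -> (k + j * m <= M)%N -> v \in L ->
  (forall x, Q x = (t <= x)%O) ->
  `|Pr E (fun a => Q (dyn F s L o a k (j * m) (pm s) v)) -
    pr (rho L (pm s)) [set omega | (t <= omega v)%O]| <= (1 - (m.+1%:R)^-1 ^+ (m * m)) ^+ j.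
Proof.
move=> EP ol acc kM vL Qt.
have -> : pr (rho L (pm s)) [set omega | (t <= omega v)%O] = \sum_x weight rho s L x *
    Pr E (fun a => Q (dyn F s L o a k (j * m) (ext s L x) v)).
  rewrite -(stationary_mean rho_spec (o := o) EP s k (j * m) v t kM vL).
  rewrite (weighted_mean EP s (fun x a => (Q (dyn F s L o a k (j * m) (ext s L x) v))%:R)).
  apply: (mean_eq EP) => a; rewrite (pr_weight rho_spec L s); last exact: measurable_dyn.
  by apply: eq_bigr => x _; rewrite Qt.
set q := _ ^+ j; set p := Pr E _.
have -> : p = \sum_x weight rho s L x * p by rewrite -mulr_suml (weight_sum rho_spec) mul1r.
rewrite -sumrB.
apply: le_trans (ler_norm_sum _ _ _) _.
apply: (@le_trans _ _ (\sum_x weight rho s L x * q)); last first.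
  by rewrite -mulr_suml (weight_sum rho_spec) mul1r.
apply: ler_sum => x _.
rewrite -mulrBr normrM ger0_norm ?weight_ge0 //.
have [x0|x0] := boolP (0 < weight rho s L x); last first.
  suff -> : weight rho s L x = 0 by rewrite !mul0r.
  by apply: le_anti; rewrite weight_ge0 andbT leNgt.
apply: ler_wpM2l; first exact: weight_ge0.
apply: le_trans (Pr_no_coalescence rho_spec F_mono ol EP acc j k x kM x0).
rewrite -(mean_sub EP) ler_norml -[- Pr _ _]mulN1r -(mean_scale EP); apply/andP; split;
  apply: (mean_le EP) => a; (case: eqP => [->|_]; first by rewrite subrr ?mulr0);
  by case: (Q _); case: (Q _) => /=; lra.
Qed.

(** Fix a radius [r] for which weak mixing makes the two stationary laws close at [v], then run both
    dynamics in this ball until they are close to stationary. Their order turns closeness of laws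
    into a small probability of disagreement. *)
Lemma phi_vanishes (x : R) : 0 < x -> exists n, phi e rho F n <= x.
Proof.
move=> x0; pose K := #|S|%:R * C.
have K0 : 0 <= K by apply: mulr_ge0.
have [r hr] : exists r, K * expR (- (c * r%:R)) <= x / 2.
  have [r hr] := le_nat_exists (2 * K / (x * c)); exists r.
  rewrite expRN ler_pdivrMr ?expR_gt0 //.
  apply: le_trans (_ : x / 2 * (1 + c * r%:R) <= _); last first.
    by rewrite ler_wpM2l ?expR_ge1Dx // divr_ge0 // ltW.
  have := hr r (leqnn r); rewrite ler_pdivrMr ?mulr_gt0 // => h; lra.
have [m0 hm0] := uniform r.
(* With [m > r] the number of sweeps [j.+1 * m] is at least [r], so the ball of radius [r] lies in
   the volume of [phi]. *)
pose m := maxn m0 r.+1.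
have hm v s : accessible (rho := rho) s (vball e v r) m.
  exact: (accessibleW (vball_center esym fin v r) (leq_maxl _ _) (hm0 v s)).
pose ep := 1 - (m.+1%:R)^-1 ^+ (m * m) : R.
have ep01 : 0 <= ep < 1.
  have i0 : 0 < (m.+1%:R)^-1 :> R by rewrite invr_gt0 ltr0n.
  rewrite subr_ge0 exprn_ile1 ?invf_le1 ?ler1n ?ltr0n ?ltW //= ltrBlDr ltrDl.
  by rewrite exprn_gt0.
have [j hj] : exists j, #|S|%:R * 2 * ep ^+ j.+1 <= x / 2.
  have /andP[ep0 ep1] := ep01.
  have := cvg_geometric (#|S|%:R * 2) (z := ep); rewrite ger0_norm // => /(_ ep1).
  move=> /cvgrPdist_le /(_ (x / 2)) [|j _ hj]; first by rewrite divr_gt0.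
  exists j; have := hj j.+1 (leqnSn j); rewrite /= /geometric sub0r normrN.
  by apply: le_trans; apply: ler_norm.
exists (j.+1 * m)%N.
have rn : (r <= j.+1 * m)%N.
  by apply: leq_trans (_ : m <= _)%N; [rewrite leq_max leqnSn orbT|rewrite leq_pmull].
apply: phi_le; first exact: ltW.
move=> L M E o v k EP ol vL kM.
have EP' : noise_mean rho F (vball e v r) M E.
  by apply: (noise_mean_sub _ (leqnn M) EP); apply: fsubset_trans vL; apply: vball_mono.
apply: (@le_trans _ _ (Pr E (fun a => disc F (vball e v r) o a k (j.+1 * m) v))).
  by apply: (Pr_le EP) => a; apply: (disc_sub F F_mono ol); apply: vball_mono.
have vv := vball_center esym fin v r.
set L' := vball e v r in EP' vv *.
apply: (@le_trans _ _ (\sum_(t : S)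
    (Pr E (fun a => (t <= dyn F true L' o a k (j.+1 * m) (pm true) v)%O) -
     Pr E (fun a => (t <= dyn F false L' o a k (j.+1 * m) (pm false) v)%O)))).
  under eq_bigr => t _ do rewrite -(mean_sub EP).
  rewrite -(mean_sum EP); apply: (mean_le EP) => a; apply: neq_count.
  by apply: (dyn_le F_mono) => w; apply: le0x.
apply: (@le_trans _ _ (\sum_(t : S) (2 * ep ^+ j.+1 + C * expR (- (c * r%:R))))).
  apply: ler_sum => t _.
  have A := Pr_spin_near true t (fun x => (t <= x)%O) EP' ol (hm v true) kM vv (fun=> erefl).
  have B := Pr_spin_near false t (fun x => (t <= x)%O) EP' ol (hm v false) kM vv (fun=> erefl).
  have mx := mixing_ge mixing v r t.
  rewrite -/L' in mx; rewrite -/ep in A B.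
  move: A B; rewrite !ler_norml => /andP[_ A] /andP[B _].
  move: A B mx; lra.
rewrite sumr_const -mulr_natl; move: hr hj; rewrite /K; lra.
Qed.

End PhiVanishes.

(** * From deterministic to random orders *)

Section FiniteProduct.
Context {R : realType} {I Y : finType} {w : Y -> R}.
Context (w_ge0 : forall z, 0 <= w z) (w_sum : \sum_z w z = 1).

Definition prod_weight (y : {ffun I -> Y}) : R := \prod_c w (y c).

Lemma prod_weight_ge0 y : 0 <= prod_weight y.
Proof. by apply: prodr_ge0. Qed.

Lemma prod_weight_marginal c (h : Y -> R) :
  \sum_y prod_weight y * h (y c) = \sum_z w z * h z.
Proof.
pose g c' z := w z * (if c' == c then h z else 1).
transitivity (\sum_(y : {ffun I -> Y}) \prod_c' g c' (y c')).
  apply: eq_bigr => y _; rewrite big_split /=; congr (_ * _).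
  rewrite (bigD1 c) //= eqxx big1 ?mulr1 // => c' /negbTE -> //.
rewrite -(bigA_distr_bigA g) (bigD1 c) //= /g [X in _ * X]big1 ?mulr1.
  by apply: eq_bigr => z _; rewrite eqxx.
by move=> c' /negbTE ->; under eq_bigr do rewrite mulr1.
Qed.

Lemma prod_weight_sum : \sum_y prod_weight y = 1.
Proof.
rewrite -(bigA_distr_bigA (fun _ => w)) big1 // => c _; exact: w_sum.
Qed.

Definition splice (J : pred I) (y y' : {ffun I -> Y}) : {ffun I -> Y} :=
  [ffun c => if J c then y c else y' c].

(* Exchanging the coordinates outside [J] preserves the square of the product
   measure, and turns [f y * g y'] into a function of one sample. *)
Lemma prod_weight_indep (J : pred I) (f g : {ffun I -> Y} -> R) :
  (forall y y', f (splice J y y') = f y) -> (forall y y', g (splice J y y') = g y') ->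
  \sum_y prod_weight y * (f y * g y) =
  (\sum_y prod_weight y * f y) * (\sum_y prod_weight y * g y).
Proof.
move=> fJ gJ; pose flip (p : {ffun I -> Y} * {ffun I -> Y}) :=
  (splice J p.1 p.2, splice J p.2 p.1).
have flipK : involutive flip.
  by case=> y y'; congr pair; apply/ffunP => c; rewrite !ffunE; case: (J c).
have flipW p : prod_weight (flip p).1 * prod_weight (flip p).2 =
    prod_weight p.1 * prod_weight p.2.
  rewrite -!big_split; apply: eq_bigr => c _; rewrite /= !ffunE.
  by case: (J c) => //; rewrite mulrC.
transitivity (\sum_p prod_weight p.1 * prod_weight p.2 * (f p.1 * g p.1)).
  rewrite -(pair_bigA _ (fun y y' => prod_weight y * prod_weight y' * (f y * g y))) /=.
  apply: eq_bigr => y _; rewrite -[LHS]mulr1 -prod_weight_sum mulr_sumr.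
  by apply: eq_bigr => y' _; rewrite mulrAC.
rewrite (reindex_inj (inv_inj flipK)) /= big_distrl /=.
rewrite -(pair_bigA _ (fun y y' => prod_weight (flip (y, y')).1 *
  prod_weight (flip (y, y')).2 * (f (flip (y, y')).1 * g (flip (y, y')).1))) /=.
apply: eq_bigr => y _; rewrite mulr_sumr; apply: eq_bigr => y' _.
by have /= -> := flipW (y, y'); rewrite fJ gJ mulrACA.
Qed.

End FiniteProduct.

(** The measurable sets independent of [A] form a Dynkin system. *)
Lemma pi_lambda_indep {R : realType} {d} {T : measurableType d} (P : probability T R)
    (A : set T) (G : set (set T)) :
  measurable A -> setI_closed G -> (forall X, G X -> measurable X) ->
  (forall X, G X -> P (A `&` X) = (P A * P X)%E) ->
  forall X, <<s G >> X -> measurable X /\ P (A `&` X) = (P A * P X)%E.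
Proof.
move=> mA GI mG GA; rewrite -(setI_closed_g_dynkin_g_sigma_algebra GI).
apply: smallest_sub => [|X GX]; last by split; [apply: mG|apply: GA].
split.
- by split; [exact: measurableT|rewrite setIT probability_setT mule1].
- move=> X [mX PX]; split; first exact: measurableC.
  rewrite -setDE measureD //; last by rewrite (le_lt_trans (probability_le1 P mA)) ?ltry.
  transitivity (P A - P A * P X)%E; first by congr (_ - _)%E; exact: PX.
  rewrite probability_setC // -(pr_fin P A mA) -(pr_fin P X mX).
  rewrite (_ : (1 - (pr P X)%:E)%E = (1 - pr P X)%:E) //.
  by rewrite -!EFinM -EFinB mulrBr mulr1.
- move=> X tX hX; have mX n : measurable (X n) by case: (hX n).
  split; first exact: bigcup_measurable.
  rewrite setI_bigcupr !measure_bigcup //; last 2 first.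
  + by move=> n _; apply: measurableI.
  + exact: trivIset_setIl.
  rewrite -(pr_fin P A mA) -nneseriesZl; last by move=> n _; exact: measure_ge0.
  by apply: eq_eseriesr => n _; rewrite (pr_fin P A mA); case: (hX n).
Qed.

(** * What the dynamics in a finite volume sees of its noise *)

Section DynamicsLocal.
Context {V : countType} {dS : Order.disp_t} {S : finTBOrderType dS}.
Context {dA : measure_display} {TA : measurableType dA}.
Context {F : config V S -> V -> TA -> S}.
Implicit Types (s : bool) (L : {fset V}) (omega : config V S).
Implicit Types (o : nat -> rel V) (a : nat -> V -> TA).

Lemma sort_agree {le le' : rel V} {L} : {in L &, le =2 le'} -> sort le L = sort le' L.
Proof.
(* Sorting the subtype [L] instead of its elements restricts the comparison to pairs in [L]. *)
move=> h; rewrite enum_fsetE !sort_map /relpre.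
suff -> : (fun u w : L => le (val u) (val w)) = (fun u w => le' (val u) (val w)) by [].
by apply/funext => u; apply/funext => w; apply: h; apply: valP.
Qed.

Lemma sweep_agree s L l nu nu' omega : {subset l <= L} -> supported s L omega ->
  (forall u omega', u \in L -> supported s L omega' -> F omega' u (nu u) = F omega' u (nu' u)) ->
  sweep F l nu omega = sweep F l nu' omega.
Proof.
move=> + so h; elim: l => //= u l IH ul.
rewrite IH => [|w wl]; last by apply: ul; rewrite inE wl orbT.
rewrite /update h //; first by apply: ul; rewrite mem_head.
by apply: supported_sweep => // w wl; apply: ul; rewrite inE wl orbT.
Qed.

(** The orders matter only on [L], and the variables only through their effect on supported
    configurations; hence finite tables determine the dynamics. *)
Lemma dyn_noise s L o o' a a' k n omega :
  (forall j, (k < j <= k + n)%N -> {in L &, o j =2 o' j}) ->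
  (forall j u omega', (k < j <= k + n)%N -> u \in L -> supported s L omega' ->
    F omega' u (a j u) = F omega' u (a' j u)) ->
  dyn F s L o a k n omega = dyn F s L o' a' k n omega.
Proof.
elim: n omega => //= n IH omega ho ha.
have jn j : (k < j <= k + n)%N -> (k < j <= k + n.+1)%N.
  by move=> /andP[-> h]; rewrite addnS ltnW.
rewrite IH => [|j /jn /ho //|j u omega' /jn h]; last exact: ha.
have kn : (k < k + n.+1 <= k + n.+1)%N by rewrite leqnn addnS ltnS leq_addr.
congr dyn; rewrite /step (sort_agree (ho _ kn)).
apply: (sweep_agree s L).
- by move=> w; rewrite mem_sort.
- exact: supported_restrict.
- by move=> u omega' uL so; apply: ha.
Qed.

Lemma fdyn_dyn {dB : measure_display} {TB : measurableType dB} e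
    (O : (V -> TB) -> rel V) nu eta s v r n omega :
  fdyn e F O nu eta s v r n omega =
  dyn F s (vball e v r) (fun j => O (eta j)) nu 0 n omega.
Proof. by elim: n omega => //= n IH omega; rewrite IH. Qed.

End DynamicsLocal.

(** * A finite model of the update variables *)

Section PatternModel.
Context {R : realType} {V : countType} {dS : Order.disp_t} {S : finTBOrderType dS}.
Context {dA : measure_display} {TA : measurableType dA}.
Context {rho : spec R V S} {mu : probability TA R} {F : config V S -> V -> TA -> S}.
Context (F_meas : forall v s, measurable ((Omega_pm `*` setT) `&`
  [set x : config V S * TA | F x.1 v x.2 = s])).
Context (F_law : forall omega v s, Omega_pm omega ->
  mu [set a | F omega v a = s] = rho [fset v]%fset omega [set sigma | sigma v = s]).
Context {L : {fset V}} {n : nat}.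

Local Notation field := (nat -> V -> TA).
Local Notation Y := {ffun (bool * {ffun L -> S} * L) -> S}.
Local Notation cell := ('I_n * L)%type.

(* All that the dynamics in [L] can see of an update variable. *)
Definition pattern (a : TA) : Y := [ffun z => F (ext z.1.1 L z.1.2) (val z.2) a].

Definition pattern_weight (z : Y) := pr mu [set a | pattern a = z].

(** A pattern that no value realizes is sent to [point]; its weight is zero. *)
Definition pattern_repr (z : Y) : TA := xget point [set a | pattern a = z].

(** The first index of a cell is shifted by one because sweeps are numbered from 1. *)
Definition unpattern (y : {ffun cell -> Y}) : field := fun k u =>
  if [pick c : cell | (c.1.+1 == k) && (val c.2 == u)] is Some c
  then pattern_repr (y c) else point.

Definition pattern_mean (f : field -> R) :=
  \sum_y prod_weight (w := pattern_weight) y * f (unpattern y).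

Lemma measurable_site omega v s : Omega_pm omega -> measurable [set a | F omega v a = s].
Proof.
move=> ho; have := measurable_xsection omega (F_meas v s).
congr measurable; apply/seteqP; split => a; first by move=> /xsectionP [].
by move=> h; apply/xsectionP.
Qed.

Lemma measurable_pattern z : measurable [set a | pattern a = z].
Proof.
have -> : [set a | pattern a = z] = \bigcap_(c in [set: bool * {ffun L -> S} * L])
    [set a | F (ext c.1.1 L c.1.2) (val c.2) a = z c].
  apply/seteqP; split => a /=; first by move=> <- c _; rewrite ffunE.
  by move=> h; apply/ffunP => c; rewrite ffunE; apply: h.
apply: fin_bigcap_measurable => [|c _]; first exact: finite_finset.
apply: measurable_site; exact: supported_Omega (supported_ext _ _ _).
Qed.

Lemma pattern_weight_sum : \sum_z pattern_weight z = 1.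
Proof.
rewrite -(pr_setT mu) -pr_sum; first last.
- by move=> z z' a /= -> ->.
- exact: measurable_pattern.
by congr pr; apply/seteqP; split => // a _; exists (pattern a).
Qed.

Lemma pattern_weight_ge0 z : 0 <= pattern_weight z.
Proof. exact: pr_ge0. Qed.

Lemma unpattern_cell y (i : 'I_n) (u : L) : unpattern y i.+1 (val u) = pattern_repr (y (i, u)).
Proof.
rewrite /unpattern; case: pickP => [[j w] /= /andP[/eqP [ji] /eqP wu]|/(_ (i, u))]; last first.
  by rewrite /= !eqxx.
by congr (pattern_repr (y (_, _))); apply: val_inj.
Qed.

Lemma pattern_reprK a : pattern (pattern_repr (pattern a)) = pattern a.
Proof. by apply: (@xgetPex _ point [set b | pattern b = pattern a]); exists a. Qed.

Lemma pattern_noise_mean : noise_mean rho F L n pattern_mean.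
Proof.
split.
- by move=> f g; rewrite -big_split; apply: eq_bigr => y _; rewrite mulrDr.
- by move=> x f; rewrite mulr_sumr; apply: eq_bigr => y _; rewrite mulrCA.
- move=> f g fg; apply: ler_sum => y _; apply: ler_wpM2l => //.
  exact: (prod_weight_ge0 pattern_weight_ge0).
- rewrite /pattern_mean -[RHS](prod_weight_sum (I := cell) pattern_weight_sum).
  by apply: eq_bigr => y _; rewrite mulr1.
- move=> I J f g IJ fI gJ.
  apply: (prod_weight_indep pattern_weight_sum
    (fun c : cell => `[< I (c.1.+1, val c.2) >])) => y y'.
    apply: fI => k u Iku; rewrite /unpattern; case: pickP => // c /andP[/eqP ck /eqP cu].
    by rewrite ffunE asboolT // ck cu.
  apply: gJ => k u Jku; rewrite /unpattern; case: pickP => // c /andP[/eqP ck /eqP cu].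
  rewrite ffunE asboolF // ck cu => Iku.
  by have : (I `&` J) (k, u) by []; rewrite IJ.
- move=> s omega u k t so uL; case: k => // k kn.
  have {}kn : (k < n)%N := kn.
  transitivity (\sum_z pattern_weight z * (z (s, enc L omega, [` uL]%fset) == t)%:R).
    rewrite -(prod_weight_marginal pattern_weight_sum (Ordinal kn, [` uL]%fset)).
    apply: eq_bigr => y _.
    (* A table of nonzero weight contains realized patterns only, so each representative has the
       prescribed pattern. *)
    have [y0|/prodf_neq0 y0] := eqVneq (prod_weight (w := pattern_weight) y) 0.
      by rewrite y0 !mul0r.
    congr (_ * (_ == _)%:R).
    have := unpattern_cell y (Ordinal kn) [` uL]%fset; rewrite /= => ->.
    set z := y _; have zE : pattern (pattern_repr z) = z.
      apply: (@xgetPex _ point [set b | pattern b = z]); apply: contrapT => h.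
      have := y0 (Ordinal kn, [` uL]%fset) isT; rewrite -/z /pattern_weight.
      suff -> : [set a | pattern a = z] = set0 by rewrite pr_set0 eqxx.
      by apply/seteqP; split => // a az; apply: h; exists a.
    by rewrite -[in RHS]zE ffunE /= extK.
  transitivity (pr mu [set a | F omega u a = t]); last first.
    by rewrite /pr F_law //; exact: supported_Omega so.
  transitivity (\sum_z pr mu ([set a | pattern a = z] `&` [set a | F omega u a = t])).
    apply: eq_bigr => z _; case: eqP => zt; rewrite ?mulr1 ?mulr0.
      congr pr; apply/seteqP; split => a; last by case.
      by move=> /= az; split => //=; rewrite -zt -az ffunE /= extK.
    rewrite (_ : _ `&` _ = set0) ?pr_set0 //; apply/seteqP; split => // a [/= az].
    by move: zt; rewrite -az ffunE /= extK.
  rewrite -pr_sum; first last.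
  + by move=> z z' a /= [-> _] [-> _].
  + move=> z; apply: measurableI; first exact: measurable_pattern.
    by apply: measurable_site; exact: supported_Omega so.
  congr pr; apply/seteqP; split => a /=; first by case=> z [].
  by move=> h; exists (pattern a).
Qed.

End PatternModel.

(** * Independent families of events and finite-valued variables *)

Section Independence.
Context {R : realType} {d : measure_display} {T : measurableType d} {P : probability T R}.

Lemma eventsP {d'} {T' : measurableType d'} (X : T -> T') (E : set T) :
  events X E <-> exists2 M, measurable M & E = X @^-1` M.
Proof.
by split=> [[M mM <-]|[M mM ->]]; exists M => //; rewrite setTI.
Qed.

Lemma indep_reindex {I I' : choiceType} (f : I' -> I) (g : I -> I') (C : I -> set (set T)) :
  cancel f g -> mutually_independent P C -> mutually_independent P (fun i => C (f i)).
Proof.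
move=> fK ind J E CE.
have := ind [fset f i | i in J]%fset (fun i => E (g i)).
rewrite big_imfset /=; last by move=> ? ? _ _; apply: (can_inj fK).
have -> : \bigcap_(i in [set` [fset f i | i in J]%fset]) E (g i) =
    \bigcap_(i in [set` J]) E i.
  apply/seteqP; split => t h i /=.
    by move=> iJ; rewrite -(fK i); apply: h; apply: in_imfset.
  by case/imfsetP => j /= jJ ->; rewrite fK; apply: h.
move=> ->; first by apply: eq_bigr => i _; rewrite fK.
by move=> i /imfsetP[j /= jJ ->]; rewrite fK; apply: CE.
Qed.

Lemma indep_pair {I : choiceType} (C : I -> set (set T)) (J1 J2 : {fset I}) (E : I -> set T) :
  mutually_independent P C -> [disjoint J1 & J2]%fset ->
  (forall i, i \in J1 -> C i (E i)) -> (forall i, i \in J2 -> C i (E i)) ->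
  P (\bigcap_(i in [set` J1]) E i `&` \bigcap_(i in [set` J2]) E i) =
  (P (\bigcap_(i in [set` J1]) E i) * P (\bigcap_(i in [set` J2]) E i))%E.
Proof.
move=> ind dJ C1 C2; rewrite (ind J1) // (ind J2) // -big_cat /=.
have -> : \bigcap_(i in [set` J1]) E i `&` \bigcap_(i in [set` J2]) E i =
    \bigcap_(i in [set` (J1 `|` J2)%fset]) E i.
  apply/seteqP; split => [t [h1 h2] i /=|t h].
    by rewrite in_fsetU => /orP[/h1|/h2].
  by split=> i /= iJ; apply: h; rewrite /= in_fsetU iJ ?orbT.
rewrite (ind (J1 `|` J2)%fset); last by move=> i; rewrite in_fsetU => /orP[/C1|/C2].
apply: perm_big; apply: uniq_perm; first exact: fset_uniq.
  rewrite cat_uniq !fset_uniq /= andbT; apply/hasPn => i iJ2; apply/negP => iJ1.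
  by move/fdisjointP: dJ => /(_ i iJ1); rewrite iJ2.
by move=> i; rewrite mem_cat in_fsetU.
Qed.

Lemma pr_finite {W : finType} (Z : T -> W) (Q : W -> bool) :
  (forall w, measurable [set t | Z t = w]) ->
  measurable [set t | Q (Z t)] /\
  pr P [set t | Q (Z t)] = \sum_w pr P [set t | Z t = w] * (Q w)%:R.
Proof.
move=> mZ.
have mQ w : measurable [set t | Z t = w /\ Q w].
  case: (Q w); first by rewrite (_ : [set t | _] = [set t | Z t = w]) //;
    apply/seteqP; split => t //= [].
  by rewrite (_ : [set t | _] = set0) //; apply/seteqP; split => t //= [].
have -> : [set t | Q (Z t)] = [set t | exists w, Z t = w /\ Q w].
  by apply/seteqP; split => t /=; [exists (Z t)|case=> w [->]].
split.
  have -> : [set t | exists w, Z t = w /\ Q w] = \bigcup_(w in [set: W]) [set t | Z t = w /\ Q w].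
    by apply/seteqP; split => t /= [w]; [exists w|move=> _; exists w].
  by apply: fin_bigcup_measurable => //; exact: finite_finset.
rewrite pr_sum //; last by move=> w w' t /= [-> _] [-> _].
apply: eq_bigr => w _; case: (Q w); rewrite ?mulr1 ?mulr0.
  by congr pr; apply/seteqP; split => t //= [].
by rewrite -(pr_set0 P); congr pr; apply/seteqP; split => t //= [].
Qed.

End Independence.

(** * Joint law of the orders and the update variables *)

Section OrderTable.
Context {R : realType} {V : countType} {dS : Order.disp_t} {S : finTBOrderType dS}.
Context {dA : measure_display} {TA : measurableType dA} {mu : probability TA R}.
Context {dB : measure_display} {TB : measurableType dB} {theta : probability TB R}.
Context {d : measure_display} {T : measurableType d} {P : probability T R}.
Context {F : config V S -> V -> TA -> S} {O : (V -> TB) -> rel V}.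
Context (F_meas : forall v s, measurable ((Omega_pm `*` setT) `&`
  [set x : config V S * TA | F x.1 v x.2 = s])).
Context (O_meas : forall u v, <<s cylinders measurable >> [set eta | O eta u v]).
Context {A : V -> nat -> T -> TA} {B : V -> nat -> T -> TB}.
Context (noise : driving_noise P mu theta A B).
Context {L : {fset V}} {n : nat}.

Local Notation cell := ('I_n * L)%type.
Local Notation Y := {ffun (bool * {ffun L -> S} * L) -> S}.

Definition order_table t : {ffun 'I_n * L * L -> bool} :=
  [ffun z : 'I_n * L * L => O (fun v => B v z.1.1.+1 t) (val z.1.2) (val z.2)].

Definition noise_table t : {ffun cell -> Y} :=
  [ffun c : cell => pattern (F := F) (A (val c.2) c.1.+1 t)].

(** The order on [L] may depend on [B] at infinitely many vertices, so its independence of the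
    update variables is proved on this pi-system and then extended. *)
Definition order_cylinders : set (set T) :=
  [set X | exists J : {fset V * nat}, exists2 E : V * nat -> set T,
    forall p, p \in J -> events (B p.1 p.2) (E p) & X = \bigcap_(p in [set` J]) E p].

Lemma noise_indep : mutually_independent P (fun i : (V * nat) + (V * nat) =>
  match i with inl p => events (A p.1 p.2) | inr p => events (B p.1 p.2) end).
Proof.
case: noise => _ _ ind J E h; apply: ind => i iJ.
by have := h i iJ; case: i iJ => [[]|[]].
Qed.

Lemma A_indep : mutually_independent P (fun p : V * nat => events (A p.1 p.2)).
Proof.
exact: (indep_reindex inl (fun i => match i with inl p => p | inr p => p end) _ _ noise_indep).
Qed.

Lemma B_iid k : iid P theta (fun v => B v k).
Proof.
case: (noise) => _ hB _; split => //.
apply: (indep_reindex (fun v => inr (v, k))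
  (fun i => match i with inl p => p.1 | inr p => p.1 end) _ _ noise_indep) => //.
Qed.

Lemma measurable_events {d'} {T' : measurableType d'} (X : T -> T') E :
  measurable_fun setT X -> events X E -> measurable E.
Proof.
by move=> mX /eventsP[M mM ->]; rewrite -[X in measurable X]setTI; apply: mX.
Qed.

Lemma order_cylinders_setI : setI_closed order_cylinders.
Proof.
move=> X X' [J [E hE ->]] [J' [E' hE' ->]].
exists (J `|` J')%fset; exists (fun p => (if p \in J then E p else setT) `&`
    (if p \in J' then E' p else setT)).
  move=> p _; apply/eventsP.
  have [M mM ->] : exists2 M, measurable M & (if p \in J then E p else setT) =
      B p.1 p.2 @^-1` M.
    case: ifP => [/hE /eventsP //|_]; exists setT => //; exact: measurableT.
  have [M' mM' ->] : exists2 M, measurable M & (if p \in J' then E' p else setT) =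
      B p.1 p.2 @^-1` M.
    case: ifP => [/hE' /eventsP //|_]; exists setT => //; exact: measurableT.
  by exists (M `&` M') => //; apply: measurableI.
apply/seteqP; split => [t [h h'] p /= _|t h].
  by split; case: ifP => // ?; [apply: h|apply: h'].
by split=> p /= pJ; have /= := h p; rewrite in_fsetU pJ ?orbT => /(_ isT) [].
Qed.

Lemma order_cylinders_measurable X : order_cylinders X -> measurable X.
Proof.
case=> J [E hE ->]; apply: fin_bigcap_measurable => [|p pJ]; first exact: finite_fset.
by apply: measurable_events (hE p pJ); case: noise => _ hB _; case: (hB p.1 p.2).
Qed.

Lemma order_table_cylinders th : <<s order_cylinders >> [set t | order_table t = th].
Proof.
pose Ts := g_sigma_algebraType order_cylinders.
have cyl k E : <<s cylinders measurable >> E ->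
    <<s order_cylinders >> [set t | E (fun v => B v k t)].
  move: E; apply: smallest_sub; first split.
  - exact: (@measurable0 _ Ts).
  - move=> E hE; rewrite setTD.
    exact: (@measurableC _ Ts _ hE).
  - by move=> E hE; exact: (@bigcup_measurable _ Ts _ _ (fun i _ => hE i)).
  - move=> _ [v _ [M mM <-]]; apply: sub_sigma_algebra.
    exists [fset (v, k)]%fset; exists (fun p => B p.1 p.2 @^-1` M).
      by move=> p _; apply/eventsP; exists M.
    apply/seteqP; split => t /=.
      by move=> [_ h] p /= /fset1P ->.
    by move=> h; split => //; apply: (h (v, k)); rewrite /= inE.
have -> : [set t | order_table t = th] = \bigcap_(z in [set: 'I_n * L * L])
    [set t | O (fun v => B v z.1.1.+1 t) (val z.1.2) (val z.2) = th z].
  apply/seteqP; split => t /=; first by move=> <- z _; rewrite ffunE.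
  by move=> h; apply/ffunP => z; rewrite ffunE; apply: h.
apply: (@fin_bigcap_measurable _ Ts) => [|z _]; first exact: finite_finset.
have mO := cyl z.1.1.+1 _ (O_meas (val z.1.2) (val z.2)).
case: (th z); first exact: mO.
rewrite (_ : [set t | _] = ~` [set t | O (fun v => B v z.1.1.+1 t) (val z.1.2) (val z.2)]).
  exact: (@measurableC _ Ts _ mO).
by apply/seteqP; split => t /=; [move=> ->|move=> /negP/negbTE].
Qed.

Let pos (c : cell) : V * nat := (val c.2, c.1.+1).
(** As [pos] is injective, the quantifier amounts to one condition at a position of the table and to
    none elsewhere. *)
Let EA (y : {ffun cell -> Y}) (p : V * nat) : set T :=
  [set t | forall c, pos c = p -> pattern (F := F) (A p.1 p.2 t) = y c].
Let JA : {fset V * nat} := seq_fset tt [seq pos c | c <- enum {: cell}].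

Let pos_inj : injective pos.
Proof. by move=> [i u] [j w] [] /val_inj -> /val_inj ->. Qed.

Let mem_JA p : (p \in JA) = (p \in [seq pos c | c <- enum {: cell}]).
Proof. by rewrite seq_fsetE. Qed.

Let pos_JA c : pos c \in JA.
Proof. by rewrite mem_JA map_f // mem_enum. Qed.

Let noise_table_cap y : [set t | noise_table t = y] = \bigcap_(p in [set` JA]) EA y p.
Proof.
apply/seteqP; split => t /=.
  by move=> <- p _ c <-; rewrite ffunE.
move=> h; apply/ffunP => c; rewrite ffunE.
by apply: (h (pos c)) => //=.
Qed.

Let EA_events y p : events (A p.1 p.2) (EA y p).
Proof.
apply/eventsP; exists (\bigcap_(c in [set c | pos c = p]) [set a | pattern (F := F) a = y c]) => //.
apply: fin_bigcap_measurable => [|c _]; first exact: finite_finset.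
exact: (measurable_pattern F_meas).
Qed.

Lemma noise_table_measurable y : measurable [set t | noise_table t = y].
Proof.
rewrite noise_table_cap; apply: fin_bigcap_measurable => [|p _]; first exact: finite_fset.
by apply: measurable_events (EA_events y p); case: noise => hA _ _; case: (hA p.1 p.2).
Qed.

Lemma pr_noise_table y :
  pr P [set t | noise_table t = y] = prod_weight (w := pattern_weight (mu := mu) (F := F)) y.
Proof.
apply: EFin_inj; rewrite pr_fin; last exact: noise_table_measurable.
rewrite noise_table_cap (A_indep JA) => [|p _]; last exact: EA_events.
rewrite (perm_big [seq pos c | c <- enum {: cell}]); last first.
  apply: uniq_perm; [exact: fset_uniq|by rewrite map_inj_uniq ?enum_uniq|exact: mem_JA].
rewrite big_map big_enum /= /prod_weight -prodEFin; apply: eq_bigr => c _.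
rewrite /pattern_weight pr_fin; last exact: (measurable_pattern F_meas).
case: noise => hA _ _; have [_ <-] := hA (val c.2) c.1.+1; last exact: (measurable_pattern F_meas).
congr (P _); apply/seteqP; split => t /=; first by move=> /(_ c erefl).
by move=> h c' /pos_inj ->.
Qed.

(** The noise table is determined by events of [A], hence is independent of every order cylinder,
    and of the order table by the Dynkin argument. *)
Lemma pr_tables y th :
  measurable [set t | order_table t = th] /\
  pr P ([set t | noise_table t = y] `&` [set t | order_table t = th]) =
  prod_weight (w := pattern_weight (mu := mu) (F := F)) y * pr P [set t | order_table t = th].
Proof.
have my := noise_table_measurable y.
have [mth Pth] : measurable [set t | order_table t = th] /\
    P ([set t | noise_table t = y] `&` [set t | order_table t = th]) =
    (P [set t | noise_table t = y] * P [set t | order_table t = th])%E.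
  apply: (pi_lambda_indep P _ order_cylinders) => //.
  - exact: order_cylinders_setI.
  - exact: order_cylinders_measurable.
  - move=> _ [J [E hE ->]]; rewrite noise_table_cap.
    pose E' (i : (V * nat) + (V * nat)) := match i with inl p => EA y p | inr p => E p end.
    have capl : \bigcap_(p in [set` JA]) EA y p =
        \bigcap_(i in [set` [fset (inl p : (V * nat) + (V * nat)) | p in JA]%fset]) E' i.
      apply/seteqP; split => t h i /=; first by case/imfsetP => p /= pJ ->; apply: h.
      by move=> iJ; apply: (h (inl i)); apply: in_imfset.
    have capr : \bigcap_(p in [set` J]) E p =
        \bigcap_(i in [set` [fset (inr p : (V * nat) + (V * nat)) | p in J]%fset]) E' i.
      apply/seteqP; split => t h i /=; first by case/imfsetP => p /= pJ ->; apply: h.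
      by move=> iJ; apply: (h (inr i)); apply: in_imfset.
    rewrite capl capr; apply: (indep_pair _ _ _ _ noise_indep).
    + apply/fdisjointP => _ /imfsetP[p /= _ ->]; apply/negP => /imfsetP[q /= _].
      by [].
    + by move=> _ /imfsetP[p /= _ ->]; apply: EA_events.
    + by move=> _ /imfsetP[p /= pJ ->]; apply: hE.
  - exact: order_table_cylinders.
split => //; apply: EFin_inj; rewrite EFinM -pr_noise_table !pr_fin //.
exact: measurableI.
Qed.

End OrderTable.

(** * Averaging over random orders *)

Section Quenched.
Context {R : realType} {V : countType} {dS : Order.disp_t} {S : finTBOrderType dS}.
Context {dA : measure_display} {TA : measurableType dA} {mu : probability TA R}.
Context {dB : measure_display} {TB : measurableType dB} {theta : probability TB R}.
Context {d : measure_display} {T : measurableType d} {P : probability T R}.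
Context {rho : spec R V S} {F : config V S -> V -> TA -> S} {O : (V -> TB) -> rel V}.
Context (F_meas : forall v s, measurable ((Omega_pm `*` setT) `&`
  [set x : config V S * TA | F x.1 v x.2 = s])).
Context (F_law : forall omega v s, Omega_pm omega ->
  mu [set a | F omega v a = s] = rho [fset v]%fset omega [set sigma | sigma v = s]).
Context (O_meas : forall u v, <<s cylinders measurable >> [set eta | O eta u v]).
Context {A : V -> nat -> T -> TA} {B : V -> nat -> T -> TB}.
Context (noise : driving_noise P mu theta A B).
Context (O_lin : forall k, {ae P, forall t, linear_order (O (fun v => B v k t))}).
Context {e : rel V} {v : V} {n : nat}.

Local Notation L := (vball e v n).
Local Notation cell := ('I_n * L)%type.
Local Notation Y := {ffun (bool * {ffun L -> S} * L) -> S}.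
Local Notation order_tab := (order_table (O := O) (B := B) (L := L) (n := n)).
Local Notation noise_tab := (noise_table (F := F) (A := A) (L := L) (n := n)).
Local Notation pat_weight := (prod_weight (w := pattern_weight (mu := mu) (F := F))).
Local Notation ordT := {ffun 'I_n * L * L -> bool}.

(** False outside [L], hence not a linear order in general; [table_disc] replaces it by the order of
    a sample with the same table. *)
Definition table_order (th : ordT) : nat -> rel V := fun j u w =>
  [exists z : 'I_n * L * L, [&& z.1.1.+1 == j, val z.1.2 == u, val z.2 == w & th z]].

Definition table_dyn s (z : {ffun cell -> Y} * ordT) :=
  dyn F s L (table_order z.2) (unpattern (F := F) z.1) 0 n (pm s) v.

Lemma pattern_eq {s : bool} {omega : config V S} {u a a'} : supported s L omega -> u \in L ->
  pattern (F := F) (L := L) a = pattern (F := F) (L := L) a' ->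
  F omega u a = F omega u a'.
Proof.
move=> so uL aa; have := congr1 (fun z : Y => z (s, enc L omega, [` uL]%fset)) aa.
by rewrite !ffunE /= !extK.
Qed.

Lemma table_orderE t j : (0 < j <= 0 + n)%N ->
  {in L &, (fun u w => O (fun x => B x j t) u w) =2
    table_order (order_tab t) j}.
Proof.
case: j => // j /= jn u w uL wL; apply/idP/existsP.
  move=> h; exists (Ordinal (jn : (j < n)%N), [` uL]%fset, [` wL]%fset).
  by rewrite /= !eqxx ffunE.
by case=> -[[i u'] w'] /= /and4P[/eqP <- /eqP <- /eqP <-]; rewrite ffunE.
Qed.

Lemma fdyn_spin_tables s t : fdyn_spin e F O A B s v n t =
  table_dyn s (noise_tab t, order_tab t).
Proof.
rewrite /fdyn_spin fdyn_dyn /table_dyn /=; congr (_ v); apply: dyn_noise.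
  exact: table_orderE.
case=> // j u omega jn uL so; apply: (pattern_eq so uL).
have := unpattern_cell (noise_tab t) (Ordinal (jn : (j < n)%N)) [` uL]%fset.
by move=> /= ->; rewrite ffunE pattern_reprK.
Qed.

(** The orders are almost surely all linear, so an event of positive probability contains a sample
    where they are. This supplies the linear orders on which [phi] gives a bound. *)
Lemma exists_linear (E : set T) : measurable E -> pr P E != 0 ->
  exists2 t, E t & forall k, linear_order (O (fun v => B v k t)).
Proof.
move=> mE; apply: contraNP => h.
have [N [mN N0 hN]] := ae_foralln O_lin.
apply/eqP/le_anti; rewrite pr_ge0 andbT.
have <- : pr P N = 0 by rewrite /pr N0.
apply: pr_le => // t Et; apply: hN => /= lin; apply: h; exists t => // k; exact: lin.
Qed.

Lemma table_disc th t : order_tab t = th -> (forall k, linear_order (O (fun v => B v k t))) ->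
  \sum_y pat_weight y *
    (table_dyn true (y, th) != table_dyn false (y, th))%:R <= phi e rho F n.
Proof.
move=> <- lin; pose o j := O (fun w => B w j t).
have := phi_bound e rho F n L n _ o v 0 (pattern_noise_mean F_meas F_law) lin
  (fsubset_refl _) (leqnn n).
apply: le_trans; apply: ler_sum => y _; rewrite /disc /table_dyn /=.
have E s : dyn F s L (table_order (order_tab t)) (unpattern (F := F) y) 0 n (pm s) =
    dyn F s L o (unpattern (F := F) y) 0 n (pm s).
  by apply: dyn_noise => // j jn u w uL wL; rewrite -(table_orderE t j jn).
by rewrite !E.
Qed.

(** Both spins are functions of the two tables. The distance of their laws is at most the
    probability that they differ, and for each order table of positive probability the mean over the
    independent patterns is at most [phi]. *)
Lemma dTV_le_phi :
  (dTV P (fdyn_spin e F O A B true v n) P (fdyn_spin e F O A B false v n)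
    <= (phi e rho F n)%:E)%E.
Proof.
pose W := ({ffun cell -> Y} * ordT)%type.
pose Z t : W := (noise_tab t, order_tab t).
have ZE z : [set t | Z t = z] = [set t | noise_tab t = z.1] `&`
    [set t | order_tab t = z.2].
  by apply/seteqP; split => t; case: z => y th /=; [case=> -> ->|case=> <- <-].
have mth th : measurable [set t | order_tab t = th].
  by case: (pr_tables F_meas O_meas noise [ffun=> [ffun=> \bot%O]] th).
have mZ z : measurable [set t | Z t = z].
  by rewrite ZE; apply: measurableI; [exact: (noise_table_measurable F_meas noise)|exact: mth].
have PZ z : pr P [set t | Z t = z] =
    pat_weight z.1 *
    pr P [set t | order_tab t = z.2].
  by rewrite ZE; case: (pr_tables F_meas O_meas noise z.1 z.2).
have bound : \sum_z pr P [set t | Z t = z] * (table_dyn true z != table_dyn false z)%:R <=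
    phi e rho F n.
  have one : \sum_th pr P [set t | order_tab t = th] = 1.
    rewrite -(pr_setT P) -pr_sum //; last by move=> th th' t /= -> ->.
    by congr pr; apply/seteqP; split => // t _; exists (order_tab t).
  rewrite -[leRHS]mulr1 -[in leRHS]one mulr_sumr.
  apply: (@le_trans _ _ (\sum_th \sum_y pat_weight y *
    pr P [set t | order_tab t = th] * (table_dyn true (y, th) != table_dyn false (y, th))%:R)).
    rewrite exchange_big pair_bigA /=; apply: ler_sum => -[y th] _.
    by rewrite PZ.
  apply: ler_sum => th _.
  under eq_bigr => y _ do rewrite mulrAC.
  rewrite -mulr_suml.
  (* A table of probability zero may come from no linear order; it contributes nothing. *)
  have [->|q0] := eqVneq (pr P [set t | order_tab t = th]) 0; first by rewrite !mulr0.
  apply: ler_wpM2r; first exact: pr_ge0.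
  have [t tth lin] := exists_linear _ (mth th) q0.
  exact: (table_disc th t tth lin).
rewrite /dTV; apply: (big_ind (fun x => (x <= (phi e rho F n)%:E)%E)).
- by rewrite lee_fin phi_ge0.
- by move=> x y hx hy; rewrite ge_max hx.
move=> D _.
have XE s : P [set t | fdyn_spin e F O A B s v n t \in D] =
    (\sum_z pr P [set t | Z t = z] * (table_dyn s z \in D)%:R)%:E.
  have [mX <-] := pr_finite (P := P) Z (fun z => table_dyn s z \in D) mZ.
  by rewrite pr_fin //; congr (P _); apply/seteqP; split => t /=; rewrite fdyn_spin_tables.
rewrite !XE -EFinB abse_EFin lee_fin; apply: le_trans bound.
rewrite -sumrB; apply: le_trans (ler_norm_sum _ _ _) _; apply: ler_sum => z _.
rewrite -mulrBr normrM ger0_norm ?pr_ge0 //; apply: ler_wpM2l; first exact: pr_ge0.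
case: eqP => [->|_]; first by rewrite subrr normr0.
by do 2!case: (_ \in D); rewrite ?subrr ?subr0 ?sub0r ?normrN ?normr0 ?normr1.
Qed.

End Quenched.

(** * Growth of balls and conclusion *)

Section Growth.
Context {R : realType} {V : countType} {e : rel V}.
Context (esym : symmetric e) (fin : locally_finite e).

Lemma card_vball_le v r : ((#|` vball e v r|%fset%:R)%:E <= max_ball R e r)%E.
Proof. by apply: ereal_sup_ubound; exists v. Qed.

Lemma subexponential_bound : subexponential_growth R e ->
  exists2 B : nat -> R, (forall v r, #|` vball e v r|%:R <= B r) &
    (forall r, 0 <= B r) /\ forall x : R, 0 < x ->
      exists r0, forall r, (r0 <= r)%N -> B r <= expR (x * r%:R).
Proof.
case=> g [go gE]; exists (fun r => expR (g r)).
  by move=> v r; rewrite -lee_fin -gE; apply: card_vball_le.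
split=> [r|x x0]; first exact: expR_ge0.
have /eqoP /(_ x x0) [r0 _ h] := go.
exists r0 => r r0r; rewrite ler_expR; apply: le_trans (ler_norm _) _.
by have := h r r0r; rewrite /= (ger0_norm (ler0n _ _)).
Qed.

(* [B] is evaluated at [maxn r r0] because the hypothesis says nothing about
   small balls, and [beta] is increased to a positive value. *)
Lemma almost_exponential_bound {c : R} : 0 < c ->
  (exists2 beta : R, beta < c * ln 2 &
      \forall r \near \oo,
        (max_ball R e r <= (expR (beta * r%:R / ln r%:R))%:E)%E) ->
  exists2 B : nat -> R, (forall v r, #|` vball e v r|%:R <= B r) &
    (forall r, 0 <= B r) /\ exists2 beta : R, 0 < beta < c * ln 2 &
      exists r0, forall r, (r0 <= r)%N -> B r <= expR (beta * r%:R / ln r%:R).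
Proof.
move=> c0 [beta hbeta [r1 _ hr1]].
have l2 : 0 < c * ln 2 by rewrite mulr_gt0 // ln2_gt0.
pose b := Num.max beta (c * ln 2 / 2); pose r0 := r1.+2.
exists (fun r => expR (b * (maxn r r0)%:R / ln (maxn r r0)%:R)).
  move=> v r; set m := maxn r r0.
  have r1m : (r1 <= m)%N by rewrite /m /r0; lia.
  have m1 : (0 < m)%N by rewrite /m /r0; lia.
  apply: (@le_trans _ _ (#|` vball e v m|%:R)).
    by rewrite ler_nat; apply: fsubset_leq_card; apply: vball_mono => //; apply: leq_maxl.
  rewrite -lee_fin; apply: le_trans (card_vball_le v m) _.
  apply: le_trans (hr1 m r1m) _; rewrite lee_fin ler_expR.
  apply: ler_wpM2r; first by rewrite invr_ge0 ln_ge0 // ler1n.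
  by apply: ler_wpM2r; rewrite ?ler0n // le_max lexx.
split=> [r|]; first exact: expR_ge0.
exists b; last by exists r0 => r /maxn_idPl ->.
apply/andP; split; first by rewrite lt_max divr_gt0 ?orbT.
by rewrite gt_max hbeta /=; lra.
Qed.

End Growth.

Theorem theorem16 (R : realType) (V : countType) (e : rel V)
  (Gamma : groupType) (act : Gamma -> V -> V)
  (dS : Order.disp_t) (S : finTBOrderType dS) (rho : spec R V S) (c : R)
  (dA : measure_display) (TA : measurableType dA) (pi : probability TA R)
  (F : config V S -> V -> TA -> S)
  (dB : measure_display) (TB : measurableType dB) (theta : probability TB R)
  (O : (V -> TB) -> rel V)
  (d : measure_display) (T : measurableType d) (P : probability T R)
  (A : V -> nat -> T -> TA) (B : V -> nat -> T -> TB)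
  (V_infinite : infinite_set [set: V])
  (e_simple : simple_graph e)
  (e_locally_finite : locally_finite e)
  (act_action : group_action act)
  (act_automorphisms : acts_by_automorphisms act e)
  (act_quasi_transitive : quasi_transitive act)
  (rho_spec : updown_specification rho)
  (rho_invariant : invariant_spec act rho)
  (rho_monotone : monotone_spec rho)
  (rho_irreducible : irreducible_spec rho)
  (c_gt0 : 0 < c)
  (rho_mixing : weak_spatial_mixing e rho c)
  (F_update : update_rule act rho pi F)
  (O_order : random_order act theta O)
  (AB_noise : driving_noise P pi theta A B) :
  (subexponential_growth R e ->
   exists2 eps : R^nat, eps n @[n --> \oo] --> 0 &
     \forall n \near \oo,
       (max_dTV e F O P A B n <= (expR (- (n%:R `^ (1 - eps n))))%:E)%E)
  /\
  ((exists2 beta : R, beta < c * ln 2 &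
      \forall r \near \oo,
        (max_ball R e r <= (expR (beta * r%:R / ln r%:R))%:E)%E) ->
   exists2 c' : R, 0 < c' &
     \forall n \near \oo,
       (max_dTV e F O P A B n <= (expR (- (c' * n%:R)))%:E)%E).
Proof.
case: e_simple => esym _.
have [F_meas F_law F_mono _] := F_update.
have [order_meas _ order_lin] := O_order.
(* The mixing constant is enlarged to a nonnegative one, so that [K] is nonnegative in the
   recursions. *)
have [C0 mixing0] := rho_mixing; pose C := Num.max C0 0.
have C_ge0 : 0 <= C by rewrite le_max lexx orbT.
have mixing v r : (dTV (rho (vball e v r) (pm true)) (fun sigma => sigma v)
    (rho (vball e v r) (pm false)) (fun sigma => sigma v)
   <= (C * expR (- (c * r%:R)))%:E)%E.
  apply: le_trans (mixing0 v r) _; rewrite lee_fin ler_wpM2r ?expR_ge0 //.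
  by rewrite le_max lexx.
pose ph := phi e rho F.
have dTV_phi n : (max_dTV e F O P A B n <= (ph n)%:E)%E.
  apply: ge_ereal_sup => _ [v _ <-].
  apply: (dTV_le_phi F_meas F_law order_meas AB_noise) => k.
  exact: order_lin (B_iid AB_noise k).
have vanishes := phi_vanishes rho_spec F_mono esym e_locally_finite c_gt0 C_ge0 mixing
  (accessible_uniform rho_spec rho_irreducible act_action rho_invariant esym
    e_locally_finite act_automorphisms act_quasi_transitive).
have ph0 n : 0 <= ph n by apply: phi_ge0.
have mono n m : (n <= m)%N -> ph m <= ph n by apply: phi_nonincr.
have K0 : 0 <= #|S|%:R * C by apply: mulr_ge0.
split.
  case/subexponential_bound => Bd ballB [Bd0 hB].
  have rec := phi_rec e rho F rho_spec rho_monotone F_mono esym e_locally_finite mixing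
    ballB C_ge0 Bd0.
  have [eps eps0 h] := vanishing_exponent (fun eps eps01 =>
    stretched c_gt0 K0 ph0 mono vanishes Bd0 rec eps eps01 hB).
  exists eps => //; near=> n; apply: le_trans (dTV_phi n) _; rewrite lee_fin.
  by near: n.
case/(almost_exponential_bound esym e_locally_finite c_gt0) => Bd ballB [Bd0 [beta hb hB]].
have rec := phi_rec e rho F rho_spec rho_monotone F_mono esym e_locally_finite mixing
  ballB C_ge0 Bd0.
have multi := phi_multiscale e rho F rho_spec rho_monotone F_mono esym e_locally_finite
  mixing ballB C_ge0 Bd0.
have [c' c'0 [n0 h]] := exponential_decay c_gt0 K0 ph0 (phi_le1 e rho F) mono vanishes Bd0
  rec beta hb hB multi.
exists c' => //; exists n0 => // n nn0; apply: le_trans (dTV_phi n) _; rewrite lee_fin.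
exact: h.
Unshelve. all: by end_near.
Qed.
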